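(* Suppose no sample splitting is performed, with $\hat\psi^{\mathrm{INT}}_{k_1,k_2}$, $\hat\psi^{\mathrm{MC}}_{k_1,k_2}$, $\hat\psi^{\mathrm{IF}}_{k_1,k_2}$ the estimators without sample splitting of $\psi(\mathbb P)=\mathbb E_{\mathbb P}[\mathrm{Cov}_{\mathbb P}(A,Y\mid X)]$ defined in the context. Write $k_{\min}=k_1\wedge k_2$ and $k_{\max}=k_1\vee k_2$. Then: 1) $\displaystyle\sup_{\mathbb P\in\mathcal P_{(\alpha,\beta)}}\left|\mathbb E_{\mathbb P}\left(\hat\psi^{\mathrm{INT}}_{k_1,k_2}-\psi(\mathbb P)\right)\right|\asymp k_{\min}^{-(\alpha+\beta)/d}\vee\frac{k_{\min}}n$ and $\displaystyle\sup_{\mathbb P\in\mathcal P_{(\alpha,\beta)}}\mathrm{Var}_{\mathbb P}(\hat\psi^{\mathrm{INT}}_{k_1,k_2})\lesssim\frac1n+\frac{k_{\min}}{n^2}+\frac{k_{\min}^2}{n^3}$. 2) For $k_1,k_2\ll n$, $\displaystyle\sup_{\mathbb P\in\mathcal P_{(\alpha,\beta)}}\left|\mathbb E_{\mathbb P}\left(\hat\psi^{\mathrm{MC}}_{k_1,k_2}-\psi(\mathbb P)\right)\right|\asymp k_{\min}^{-(\alpha+\beta)/d}\vee\frac{k_{\max}}n$, and for any $k_1,k_2$, $\displaystyle\sup_{\mathbb P\in\mathcal P_{(\alpha,\beta)}}\mathrm{Var}_{\mathbb P}(\hat\psi^{\mathrm{MC}}_{k_1,k_2})\lesssim\frac1n+\frac{k_{\max}}{n^2}+\frac{k_{\max}^2}{n^3}+\frac{k_{\min}k_{\max}^2}{n^4}+\frac{k_{\min}^2k_{\max}^2}{n^5}$.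 3) For $k_1,k_2\ll n$, $\displaystyle\sup_{\mathbb P\in\mathcal P_{(\alpha,\beta)}}\left|\mathbb E_{\mathbb P}\left(\hat\psi^{\mathrm{IF}}_{k_1,k_2}-\psi(\mathbb P)\right)\right|\asymp k_{\max}^{-(\alpha+\beta)/d}\vee\frac{k_{\max}}n$, and for any $k_1,k_2$, $\displaystyle\sup_{\mathbb P\in\mathcal P_{(\alpha,\beta)}}\mathrm{Var}_{\mathbb P}(\hat\psi^{\mathrm{IF}}_{k_1,k_2})\lesssim\frac1n+\frac{k_{\max}}{n^2}+\frac{k_{\max}^2}{n^3}+\frac{k_{\min}k_{\max}^2}{n^4}+\frac{k_{\min}^2k_{\max}^2}{n^5}$.
   Context: Notation. $a\vee b=\max(a,b)$, $a\wedge b=\min(a,b)$; integrals are over $[0,1]^d$. For nonnegative sequences, $a_n\lesssim b_n$ means there is a constant $C>0$ with $a_n\le Cb_n$ for all $n\ge n_0$; $a_n\gtrsim b_n$ means $b_n\lesssim a_n$; $a_n\asymp b_n$ means both; $a_n\ll b_n$ means $a_n/b_n\to0$. Resolutions $k_1,k_2$ may depend on $n$; implicit constants do not depend on $n$ or the resolutions. Wavelets. Fix a compactly supported Cohen–Daubechies–Vial type orthonormal wavelet basis $\{\Phi_{J_0m},\Psi^{\iota}_{lm'}: m\in\mathcal Z_{J_0},\,m'\in\mathcal Z_l,\,\iota\in\{0,1\}^d\setminus\{0\},\,l\ge J_0\}$ of $L^2([0,1]^d)$ of regularity $S\ge1$, $S>\alpha\vee\beta$, with $2^{J_0}\ge S$,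 $|\mathcal Z_l|\asymp 2^{ld}$. For $j\ge J_0$ let $V_j=\mathrm{span}\{\Phi_{jm}:m\in\mathcal Z_j\}$ ($\{\Phi_{jm}\}_m$ the orthonormal scaling functions at level $j$; the $V_j$ are nested). A resolution is a number $k=2^{jd}$, $j\ge J_0$; write $V_k,\Phi_{km},\mathcal Z_k$ for $V_j,\Phi_{jm},\mathcal Z_j$. Standard properties: $|\Phi_{km}|\lesssim\sqrt k$ uniformly with support in a set of Lebesgue measure $O(1/k)$; $V_k$ contains all polynomials of degree at most $S-1$. The projection kernel is $K_{V_k}(x,y)=\sum_{m\in\mathcal Z_k}\Phi_{km}(x)\Phi_{km}(y)$. Hölder ball. $H(\alpha,M)$ is the set of uniformly continuous $h:[0,1]^d\to\mathbb R$ with $2^{J_0(\alpha+d/2)}\max_m|\langle h,\Phi_{J_0m}\rangle|+\sup_{l\ge J_0,m\in\mathcal Z_l,\iota}2^{l(\alpha+d/2)}|\langle h,\Psi^\iota_{lm}\rangle|\le M$. Model. $\mathcal P_{(\alpha,\beta)}$ is the set of distributions $\mathbb P$ of $(X,A,Y)\in[0,1]^d\times\mathbb R\times\mathbb R$ with $X\sim\mathrm{Uniform}([0,1]^d)$, $A,Y\in[C_1,C_2]$ a.s., $p(x):=\mathbb E_{\mathbb P}[A\mid X=x]\in H(\alpha,M)$ and $b(x):=\mathbb E_{\mathbb P}[Y\mid X=x]\in H(\beta,M)$, where $C_1,C_2\in\mathbb R$, $\alpha,\beta,M>0$ are fixed known constants. The functional is $\psi(\mathbb P)=\mathbb E_{\mathbb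 P}[\mathrm{Cov}_{\mathbb P}(A,Y\mid X)]$. Estimators. Let $\mathcal D_1$ be a sample of $n$ i.i.d. observations from $\mathbb P$. Put $\hat p_k(x)=\frac1n\sum_{i\in\mathcal D_1}A_iK_{V_k}(X_i,x)$ and $\hat b_k(x)=\frac1n\sum_{i\in\mathcal D_1}Y_iK_{V_k}(X_i,x)$. Without sample splitting: $\hat\psi^{\mathrm{INT}}_{k_1,k_2}=\frac1n\sum_{i\in\mathcal D_1}A_iY_i-\int\hat p_{k_1}(x)\hat b_{k_2}(x)\,dx$; $\hat\psi^{\mathrm{MC}}_{k_1,k_2}=\frac1n\sum_{i\in\mathcal D_1}A_iY_i-\frac1n\sum_{i\in\mathcal D_1}\hat p_{k_1}(X_i)\hat b_{k_2}(X_i)$; $\hat\psi^{\mathrm{IF}}_{k_1,k_2}=\frac1n\sum_{i\in\mathcal D_1}(A_i-\hat p_{k_1}(X_i))(Y_i-\hat b_{k_2}(X_i))$.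
   Formalization: Added assumption on the constants: for α and for β, some function in the Hölder ball of radius M−e takes values in [C1+e, C2−e] for some e>0. It excludes C1=C2 and M too small for [C1,C2], where the model is empty or degenerate and the lower bounds on the bias fail. *)

(* Defs.v *)
From HB Require Import structures.
From mathcomp Require Import all_boot all_order all_algebra.
From mathcomp Require Import all_classical all_reals all_analysis.

Set Implicit Arguments.
Unset Strict Implicit.
Unset Printing Implicit Defensive.

Import Order.TTheory GRing.Theory Num.Theory.
Import numFieldNormedType.Exports.

Local Open Scope classical_set_scope.
Local Open Scope ring_scope.

Section tcons.
Context {dd} {T : measurableType dd} {n : nat}.

Definition tcons (x : T * n.-tuple T) : n.+1.-tuple T :=
  [the n.+1.-tuple T of x.1 :: x.2].

Let measurable_tcons : measurable_fun [set: T * n.-tuple T] tcons.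
Proof. exact: measurable_cons. Qed.

HB.instance Definition _ := isMeasurableFun.Build _ _ _ _ tcons measurable_tcons.
End tcons.

(* The law of [n] independent draws from [P], i.e. the [n]-fold product of [P]. *)
Fixpoint iid {dd} {T : measurableType dd} {R : realType}
    (P : probability T R) (n : nat) : probability (n.-tuple T) R :=
  match n with
  | 0%N => \d_([tuple] : 0.-tuple T)
  | n'.+1 => distribution (P \x iid P n')%E tcons
  end.

Section conditional.
Context {dd dd'} {Omega : measurableType dd} {T : measurableType dd'}
  {R : realType} (P : probability Omega R) (X : Omega -> T).

(* [g] is a version of the regression function x |-> E[f | X = x]. *)
Definition is_cond_exp (f : Omega -> R) (g : T -> R) : Prop :=
  [/\ measurable_fun [set: T] g,
      P.-integrable [set: Omega] (fun o => (g (X o))%:E) &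
      forall B : set T, measurable B ->
        (\int[P]_(o in X @^-1` B) (g (X o))%:E =
         \int[P]_(o in X @^-1` B) (f o)%:E)%E].

Definition cond_exp (f : Omega -> R) : T -> R :=
  xget (cst 0) [set g | is_cond_exp f g].

Definition cond_cov (f g : Omega -> R) : T -> R :=
  cond_exp (fun o => (f o - cond_exp f (X o)) * (g o - cond_exp g (X o))).

End conditional.

Definition class_C {R : realType} (S : nat) (f : R -> R) : Prop :=
  (forall i, (i < S)%N -> forall x, derivable (derive1n i f) x 1) /\
  continuous (derive1n S f).

(* A mother function with its edge functions.  An edge function is a function
   on the line whose restriction to the half-line is the actual one. *)
Record generators (R : realType) := Generators {
  inner : R -> R;
  left_edge : nat -> R -> R;
  right_edge : nat -> R -> R }.

(* The level-[j] family on [0, 1] at positions [m < 2 ^ j]: [N] functions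
   adapted to the left end, dyadic translates of the mother function, and [N]
   functions adapted to the right end. *)
Definition dilate {R : realType} (N : nat) (g : generators R) (j m : nat)
    (x : R) : R :=
  Num.sqrt (2 ^+ j) *
  (if (m < N)%N then left_edge g m (2 ^+ j * x)
   else if (m < 2 ^ j - N)%N then inner g (2 ^+ j * x - m%:R)
   else right_edge g (2 ^ j - 1 - m)%N (2 ^+ j * (x - 1))).

Definition inner01 {R : realType} (f g : R -> R) : R :=
  \int[lebesgue_measure]_(x in `[0, 1]) (f x * g x).

Definition in_V1 {R : realType} (N : nat) (phi : generators R) (j : nat)
    (f : R -> R) : Prop :=
  exists c : 'I_(2 ^ j) -> R, forall x, 0 <= x <= 1 ->
    f x = \sum_(m < 2 ^ j) c m * dilate N phi j m x.

(* An orthonormal CDV-type basis of L^2([0, 1]) of regularity [S] started at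
   level [J0]: the mother functions are supported in [1 - N, N], as in the usual
   normalisation, so that the N-th to (2 ^ j - N - 1)-th dyadic translates are
   supported in [0, 1]; [cdv_room] keeps the two groups of edge functions
   apart.  Regularity [S] means S times continuously differentiable functions
   and polynomials of degree at most [S - 1] in every V_j.  Since [phi] and
   [psi] at level [j] are orthonormal families of 2 ^ j elements of V_(j+1),
   they split V_(j+1) orthogonally. *)
Record cdv_basis (R : realType) (J0 S : nat) := CdvBasis {
  cdv_N : nat;
  cdv_phi : generators R;
  cdv_psi : generators R;
  cdv_room : (2 * cdv_N <= 2 ^ J0)%N;
  cdv_inner_smooth : forall g, g = cdv_phi \/ g = cdv_psi ->
    class_C S (inner g);
  cdv_edge_smooth : forall g, g = cdv_phi \/ g = cdv_psi ->
    forall k, (k < cdv_N)%N ->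
      class_C S (left_edge g k) /\ class_C S (right_edge g k);
  cdv_inner_support : forall g, g = cdv_phi \/ g = cdv_psi ->
    forall x : R, ~~ (1 - cdv_N%:R <= x <= cdv_N%:R) -> inner g x = 0;
  cdv_edge_support : forall g, g = cdv_phi \/ g = cdv_psi ->
    exists r : R, forall k x, (k < cdv_N)%N -> r < `|x| ->
      left_edge g k x = 0 /\ right_edge g k x = 0;
  cdv_orthonormal_phi : forall j (m m' : 'I_(2 ^ j)), (J0 <= j)%N ->
    inner01 (dilate cdv_N cdv_phi j m) (dilate cdv_N cdv_phi j m') =
      (m == m')%:R;
  cdv_orthonormal_psi : forall j (m m' : 'I_(2 ^ j)), (J0 <= j)%N ->
    inner01 (dilate cdv_N cdv_psi j m) (dilate cdv_N cdv_psi j m') =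
      (m == m')%:R;
  cdv_orthogonal : forall j (m m' : 'I_(2 ^ j)), (J0 <= j)%N ->
    inner01 (dilate cdv_N cdv_phi j m) (dilate cdv_N cdv_psi j m') = 0;
  cdv_nested : forall j (m : 'I_(2 ^ j)), (J0 <= j)%N ->
    in_V1 cdv_N cdv_phi j.+1 (dilate cdv_N cdv_phi j m);
  cdv_detail : forall j (m : 'I_(2 ^ j)), (J0 <= j)%N ->
    in_V1 cdv_N cdv_phi j.+1 (dilate cdv_N cdv_psi j m);
  cdv_polynomials : forall j r, (J0 <= j)%N -> (r < S)%N ->
    in_V1 cdv_N cdv_phi j (fun x => x ^+ r);
  cdv_complete : forall f : R -> R,
    measurable_fun (`[0, 1] : set R) f ->
    lebesgue_measure.-integrable (`[0, 1] : set R) (fun x => (f x ^+ 2)%:E) ->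
    (forall m : 'I_(2 ^ J0), inner01 f (dilate cdv_N cdv_phi J0 m) = 0) ->
    (forall l (m : 'I_(2 ^ l)), (J0 <= l)%N ->
       inner01 f (dilate cdv_N cdv_psi l m) = 0) ->
    {ae lebesgue_measure, forall x, 0 <= x <= 1 -> f x = 0} }.

Definition cube {R : realType} (d : nat) : set (d.-tuple R) :=
  [set x | forall i, 0 <= tnth x i <= 1].

(* [uniform_prob] lives on [measurableTypeR R], whose display differs from the
   one of [R]: the Borel sets are the same. *)
Definition of_measurableTypeR {R : realType} : measurableTypeR R -> R := idfun.

Lemma measurable_of_measurableTypeR {R : realType} :
  measurable_fun [set: measurableTypeR R] (@of_measurableTypeR R).
Proof. by move=> _ B mB; rewrite setTI. Qed.

HB.instance Definition _ (R : realType) :=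
  isMeasurableFun.Build _ _ _ _ (@of_measurableTypeR R)
    measurable_of_measurableTypeR.

(* Lebesgue measure on [0, 1]^d, carried by R^d. *)
Definition unif {R : realType} (d : nat) : probability (d.-tuple R) R :=
  iid (distribution (uniform_prob (@ltr01 R)) of_measurableTypeR) d.

(* The positions at level [j]: there are exactly 2 ^ (j * d) of them. *)
Definition Z (d j : nat) := {ffun 'I_d -> 'I_(2 ^ j)}.

(* The d-dimensional system is the tensor product of the one-dimensional one:
   [Phi] spans V_j, and [iota] tells the factors that are wavelets. *)
Section tensor.
Context {R : realType} {J0 S : nat} (w : cdv_basis R J0 S) {d : nat}.

Definition Psi (l : nat) (iota : {ffun 'I_d -> bool}) (m : Z d l)
    (x : d.-tuple R) : R :=
  \prod_(i < d)
    dilate (cdv_N w) (if iota i then cdv_psi w else cdv_phi w) l (m i)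
      (tnth x i).

Definition Phi (j : nat) (m : Z d j) (x : d.-tuple R) : R :=
  \prod_(i < d) dilate (cdv_N w) (cdv_phi w) j (m i) (tnth x i).

Definition K (j : nat) (x y : d.-tuple R) : R :=
  \sum_(m : Z d j) Phi m x * Phi m y.

Definition coef (h e : d.-tuple R -> R) : R :=
  \int[unif d]_(x in @cube R d) (h x * e x).

Definition unif_cont_cube (h : d.-tuple R -> R) : Prop :=
  forall e : R, 0 < e -> exists2 dl : R, 0 < dl &
    forall x y, cube x -> cube y ->
      (forall i, `|tnth x i - tnth y i| < dl) -> `|h x - h y| < e.

Definition holder_norm (a : R) (h : d.-tuple R -> R) : \bar R :=
  ((2 `^ (J0%:R * (a + d%:R / 2)) *
      \big[Num.max/0]_(m : Z d J0) `|coef h (Phi m)|)%:E +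
   ereal_sup [set y : \bar R | exists l (m : Z d l) (iota : {ffun 'I_d -> bool}),
     [/\ (J0 <= l)%N, exists i, iota i &
       y = (2 `^ (l%:R * (a + d%:R / 2)) * `|coef h (Psi iota m)|)%:E]])%E.

Definition holder_ball (a M : R) (h : d.-tuple R -> R) : Prop :=
  unif_cont_cube h /\ (holder_norm a h <= M%:E)%E.

End tensor.

Section model.
Context {R : realType} {J0 S : nat} (w : cdv_basis R J0 S) (d : nat).

Definition obs : Type := (d.-tuple R * R * R)%type.

Definition oX (o : obs) : d.-tuple R := o.1.1.
Definition oA (o : obs) : R := o.1.2.
Definition oY (o : obs) : R := o.2.

Definition model (alpha beta M C1 C2 : R) (P : probability obs R) : Prop :=
  [/\ forall B : set (d.-tuple R), measurable B -> P (oX @^-1` B) = unif d B,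
      {ae P, forall o, C1 <= oA o <= C2 /\ C1 <= oY o <= C2},
      exists2 p, holder_ball w alpha M p & is_cond_exp P oX oA p &
      exists2 b, holder_ball w beta M b & is_cond_exp P oX oY b].

(* Some function lies in the interior of the constraints put on a regression
   function.  When C1 < C2, C1 <= 0 <= C2 and M > 0, a constant does.  Without
   it the model may be empty or reduced to a point (take C1 large and M
   small). *)
Definition has_slack (a M C1 C2 : R) : Prop :=
  exists (h : d.-tuple R -> R) (e : R),
    [/\ 0 < e, holder_ball w a (M - e) h &
        forall x, cube x -> C1 + e <= h x <= C2 - e].

Definition psi (P : probability obs R) : R :=
  fine ('E_P[fun o => cond_cov P oX oA oY (oX o)])%E.

Section estimators.
Context {n : nat} (j1 j2 : nat) (s : n.-tuple obs).

(* A resolution k = 2 ^ (j * d) enters through its level [j], as V_k = V_j. *)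
Definition reg_hat (f : obs -> R) (j : nat) (x : d.-tuple R) : R :=
  n%:R^-1 * \sum_(i < n) f (tnth s i) * K w j (oX (tnth s i)) x.

Definition p_hat := reg_hat oA.
Definition b_hat := reg_hat oY.

Definition psi_INT : R :=
  n%:R^-1 * (\sum_(i < n) oA (tnth s i) * oY (tnth s i)) -
  \int[unif d]_(x in @cube R d) (p_hat j1 x * b_hat j2 x).

Definition psi_MC : R :=
  n%:R^-1 * (\sum_(i < n) oA (tnth s i) * oY (tnth s i)) -
  n%:R^-1 * (\sum_(i < n) p_hat j1 (oX (tnth s i)) * b_hat j2 (oX (tnth s i))).

Definition psi_IF : R :=
  n%:R^-1 * \sum_(i < n)
    (oA (tnth s i) - p_hat j1 (oX (tnth s i))) *
    (oY (tnth s i) - b_hat j2 (oX (tnth s i))).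

End estimators.
End model.

Definition estimator (R : realType) (d : nat) : Type :=
  forall n : nat, nat -> nat -> n.-tuple (obs (R := R) d) -> R.

Section risk.
Context {R : realType} {d : nat} (cls : set (probability (obs (R := R) d) R))
  (est : estimator R d).

Definition sup_bias (n j1 j2 : nat) : \bar R :=
  ereal_sup [set `|'E_(iid P n)[fun s => (est j1 j2 s - psi P)%R]|%E | P in cls].

Definition sup_var (n j1 j2 : nat) : \bar R :=
  ereal_sup [set 'V_(iid P n)[@est n j1 j2]%E | P in cls].

End risk.

Definition res (d j : nat) : nat := (2 ^ (j * d))%N.

Section asymptotics.
Context {R : realType}.

(* Quantities depend on the sample size and the two levels.  The constant is
   uniform over the admissible sequences of levels; the rank from which the
   inequality holds may depend on the sequences. *)
Definition lesssim (adm : (nat -> nat) -> (nat -> nat) -> Prop)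
    (a b : nat -> nat -> nat -> \bar R) : Prop :=
  exists2 C : R, 0 < C & forall j1 j2, adm j1 j2 ->
    \forall n \near \oo,
      (a n (j1 n) (j2 n) <= C%:E * b n (j1 n) (j2 n))%E.

Definition asymp_equiv adm a b := lesssim adm a b /\ lesssim adm b a.

Definition any_levels (J0 : nat) (j1 j2 : nat -> nat) : Prop :=
  forall n, (J0 <= j1 n)%N /\ (J0 <= j2 n)%N.

Definition small_levels (d J0 : nat) (j1 j2 : nat -> nat) : Prop :=
  [/\ any_levels J0 j1 j2,
      (fun n => (res d (j1 n))%:R / n%:R : R) @ \oo --> (0 : R) &
      (fun n => (res d (j2 n))%:R / n%:R : R) @ \oo --> (0 : R)].

End asymptotics.

(* Main.v *)
Require Import Defs.
From HB Require Import structures.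
From mathcomp Require Import all_boot all_order all_algebra.
From mathcomp Require Import all_classical all_reals all_analysis.
From mathcomp Require Import measurable_realfun ring lra zify.

Set Implicit Arguments.
Unset Strict Implicit.
Unset Printing Implicit Defensive.

Import Order.TTheory GRing.Theory Num.Theory.
Import numFieldNormedType.Exports.

Local Open Scope classical_set_scope.
Local Open Scope ring_scope.

(** Every estimator is a combination of V-statistics.  With U1 the sum of the A_i Y_i, U2
    the double sum of A_a Y_b K(X_a, X_b) and U3 the triple sum of
    A_a K1(X_a, X_i) Y_b K2(X_b, X_i), the integral estimator is U1/n - U2/n^2, the
    Monte Carlo one is U1/n - U3/n^3, and the influence function one is
    U1/n - U2/n^2 - U2'/n^2 + U3/n^3 ([psi_INTE], [psi_MCE], [psi_IFE]).  In the
    integral estimator the kernel is that of the smaller space, since composing the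
    projections on two nested spaces gives the projection on the smaller one
    ([K_K_min]).

    Bias.  Sorting the multiple sums by coincidences of the indices gives the means
    exactly ([bias_INT], [bias_MC], [bias_IF]).  Distinct indices contribute
    <p, P_k b> for the orthogonal projection P_k on V_k; coinciding ones contribute
    terms of order k/n, because K_k(x, x) has integral k.  What is left of <p, b> is
    <p, b> - <p, P_k b> with k the smaller resolution for INT and MC; for IF the
    projections on both spaces are subtracted and the one on the smaller space is
    added back, which leaves the larger resolution.  Telescoped over the levels above k
    this difference is a sum of products of wavelet coefficients of p and b, and the
    Hoelder norms make it a geometric series of ratio 2^-(alpha+beta)
    ([bias_proj_le]).

    Variance.  By the Efron-Stein inequality it suffices to bound the effect of
    removing one observation.  This effect is a sum of kernel values over the other
    observations, and its second moment follows from |K| <= c k and from the bound c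
    on the integrals of |K(x, .)| ([Ex_deg_sqr], [Ex_deg_deg]).

    Lower bounds.  Under a law where A = p(X) + e eta and Y = b(X) + s e eta for a
    common fair sign eta, the bias is <p, Op b> + s e^2 lam for a linear operator Op and
    a number lam attached to the estimator.  The slack in the constraints allows p, b
    and s to vary; opposite values of s isolate e^2 |lam|, and the second mixed
    difference over p +- D, b +- D' isolates |<D, Op D'>| ([two_lower_bounds]).  If D
    and D' are suitably normalised sums of all the wavelets of one level J,
    the projections up to level J kill them and <D, Op D'> is of order
    2^(-J(alpha+beta)), up to a fraction k/n of it; this gives the approximation term,
    with J the lower level for INT and MC and the higher one for IF.  The term in k/n
    comes from lam for INT and IF.  For MC, lam only sees the smaller resolution, and
    constant D and D' are used instead ([lower_INT], [lower_MC], [lower_IF]). *)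

(** * Expectations of bounded measurable functions *)

Section bounded_measurable.
Context {dd} {T : measurableType dd} {R : realType}.
Implicit Types f g : T -> R.

(** All random quantities below are bounded once A and Y are truncated.  For bounded
    measurable functions a real-valued expectation is linear and monotone without any
    integrability condition. *)
Definition bm f := measurable_fun [set: T] f /\ exists C, forall x, `|f x| <= C.

Lemma bm_meas f : bm f -> measurable_fun [set: T] f.
Proof. by case. Qed.

Lemma bm_bound f : bm f -> exists2 C, 0 <= C & forall x, `|f x| <= C.
Proof.
case=> _ [C hC]; exists (Num.max 0 C); first by rewrite le_max lexx.
by move=> x; rewrite le_max hC orbT.
Qed.

Lemma bm_cst (c : R) : bm (fun=> c).
Proof. by split; [exact: measurable_cst | exists `|c|]. Qed.

Lemma bmD f g : bm f -> bm g -> bm (fun x => f x + g x).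
Proof.
move=> [mf [Cf hf]] [mg [Cg hg]]; split; first exact: measurable_funD.
by exists (Cf + Cg) => x; rewrite (le_trans (ler_normD _ _))// lerD.
Qed.

Lemma bmM f g : bm f -> bm g -> bm (fun x => f x * g x).
Proof.
move=> [mf [Cf hf]] [mg [Cg hg]]; split; first exact: measurable_funM.
by exists (Cf * Cg) => x; rewrite normrM ler_pM.
Qed.

Lemma bmN f : bm f -> bm (fun x => - f x).
Proof.
move=> [mf [Cf hf]]; split; first exact: (measurableT_comp (@oppr_measurable _ _)).
by exists Cf => x; rewrite normrN.
Qed.

Lemma bmB f g : bm f -> bm g -> bm (fun x => f x - g x).
Proof. by move=> bf bg; apply: (bmD bf (bmN bg)). Qed.

Lemma bm_norm f : bm f -> bm (fun x => `|f x|).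
Proof.
move=> [mf [Cf hf]]; split; first exact: measurableT_comp.
by exists Cf => x; rewrite normr_id.
Qed.

Lemma bmX f k : bm f -> bm (fun x => f x ^+ k).
Proof.
move=> bf; elim: k => [|k IH]; first exact: bm_cst.
rewrite (_ : (fun x => _) = (fun x => f x * f x ^+ k)); first exact: bmM.
by apply/funext => x; rewrite exprS.
Qed.

Lemma bm_sum I (s : seq I) (p : pred I) (F : I -> T -> R) :
  (forall i, bm (F i)) -> bm (fun x => \sum_(i <- s | p i) F i x).
Proof.
move=> bF; elim: s => [|i s IH].
  by rewrite (_ : (fun x => _) = fun=> 0); [exact: bm_cst|apply/funext => x; rewrite big_nil].
rewrite (_ : (fun x => _) = fun x => (if p i then F i x else 0) +
  \sum_(i <- s | p i) F i x); last first.
  by apply/funext => x; rewrite big_cons; case: (p i); rewrite ?add0r.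
by apply: bmD IH; case: (p i); [exact: bF|exact: bm_cst].
Qed.

Lemma bm_prod I (s : seq I) (p : pred I) (F : I -> T -> R) :
  (forall i, bm (F i)) -> bm (fun x => \prod_(i <- s | p i) F i x).
Proof.
move=> bF; elim: s => [|i s IH].
  by rewrite (_ : (fun x => _) = fun=> 1); [exact: bm_cst|apply/funext => x; rewrite big_nil].
rewrite (_ : (fun x => _) = fun x => (if p i then F i x else 1) *
  \prod_(i <- s | p i) F i x); last first.
  by apply/funext => x; rewrite big_cons; case: (p i); rewrite ?mul1r.
by apply: bmM IH; case: (p i); [exact: bF|exact: bm_cst].
Qed.

Lemma bm_indic (A : set T) : measurable A -> bm (\1_A : T -> R).
Proof.
move=> mA; split; first exact: measurable_indic.
by exists 1 => x; rewrite indicE; case: (_ \in _); rewrite ?normr1 ?normr0.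
Qed.

End bounded_measurable.

Lemma bm_comp {d1 d2} {T1 : measurableType d1} {T2 : measurableType d2}
    {R : realType} (f : T2 -> R) (h : T1 -> T2) :
  bm f -> measurable_fun [set: T1] h -> bm (fun x => f (h x)).
Proof.
move=> [mf [C hC]] mh; split; last by exists C.
exact: measurableT_comp.
Qed.

(** Decides [bm] for polynomial expressions in functions known to be [bm]. *)
Ltac bmt := repeat first [assumption | match goal with H : _ |- bm _ => exact: H end | apply: bm_cst | apply: bmD | apply: bmN
  | apply: bmM | apply: bmX | apply: bm_norm | apply: bm_sum => ? | apply: bm_prod => ? ].

Section expectation.
Context {dd} {T : measurableType dd} {R : realType}.

Definition Ex (P : probability T R) (f : T -> R) : R := \int[P]_x f x.

Variable P : probability T R.
Implicit Types f g : T -> R.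

Lemma bm_integrable f : bm f -> P.-integrable [set: T] (EFin \o f).
Proof.
move=> [mf [C hC]].
apply: measurable_bounded_integrable => //=.
  by rewrite (le_lt_trans (probability_le1 _ _)) ?ltry.
exists C; split; first exact: num_real.
by move=> y Cy x _ /=; rewrite (le_trans (hC x))// ltW.
Qed.

Lemma EFin_Ex f : bm f -> (Ex P f)%:E = (\int[P]_x (f x)%:E)%E.
Proof.
by move=> bf; rewrite /Ex /Rintegral fineK//; apply: integrable_fin_num => //; exact: bm_integrable.
Qed.

Lemma eq_Ex f g : f =1 g -> Ex P f = Ex P g.
Proof. by move=> fg; rewrite (_ : f = g)//; exact/funext. Qed.

Lemma Ex_cst c : Ex P (fun=> c) = c.
Proof. by rewrite /Ex Rintegral_cst//= (@probability_setT _ _ _ P) mulr1. Qed.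

Lemma ExD f g : bm f -> bm g -> Ex P (fun x => f x + g x) = Ex P f + Ex P g.
Proof. by move=> bf bg; rewrite /Ex RintegralD//; exact: bm_integrable. Qed.

Lemma ExZl c f : bm f -> Ex P (fun x => c * f x) = c * Ex P f.
Proof. by move=> bf; rewrite /Ex RintegralZl//; exact: bm_integrable. Qed.

Lemma ExZr c f : bm f -> Ex P (fun x => f x * c) = Ex P f * c.
Proof. by move=> bf; rewrite /Ex RintegralZr//; exact: bm_integrable. Qed.

Lemma ExB f g : bm f -> bm g -> Ex P (fun x => f x - g x) = Ex P f - Ex P g.
Proof. by move=> bf bg; rewrite /Ex RintegralB//; exact: bm_integrable. Qed.

Lemma ExN f : bm f -> Ex P (fun x => - f x) = - Ex P f.
Proof.
move=> bf; rewrite -mulN1r -ExZl//; apply: eq_Ex => x; by rewrite mulN1r.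
Qed.

Lemma Ex_sum I (s : seq I) (p : pred I) (F : I -> T -> R) :
  (forall i, bm (F i)) ->
  Ex P (fun x => \sum_(i <- s | p i) F i x) = \sum_(i <- s | p i) Ex P (F i).
Proof.
move=> bF; elim: s => [|i s IH].
  rewrite big_nil (_ : (fun x => _) = fun=> 0); first exact: Ex_cst.
  by apply/funext => x; rewrite big_nil.
rewrite big_cons; case: (boolP (p i)) => pi; last first.
  rewrite -IH; apply: eq_Ex => x; by rewrite big_cons (negPf pi).
rewrite -IH -ExD//; last exact: bm_sum.
by apply: eq_Ex => x; rewrite big_cons pi.
Qed.

Lemma le_Ex f g : bm f -> bm g -> (forall x, f x <= g x) -> Ex P f <= Ex P g.
Proof. by move=> bf bg fg; apply: le_Rintegral => //; exact: bm_integrable. Qed.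

Lemma Ex_ge0 f : (forall x, 0 <= f x) -> 0 <= Ex P f.
Proof. by move=> f0; apply: Rintegral_ge0. Qed.

Lemma Ex_le_cst f c : bm f -> (forall x, f x <= c) -> Ex P f <= c.
Proof. by move=> bf fc; rewrite -(Ex_cst c); apply: le_Ex => //; exact: bm_cst. Qed.

Lemma norm_Ex f : bm f -> `|Ex P f| <= Ex P (fun x => `|f x|).
Proof. by move=> bf; apply: le_normr_Rintegral => //; exact: bm_integrable. Qed.

Lemma norm_Ex_le f c : bm f -> (forall x, `|f x| <= c) -> `|Ex P f| <= c.
Proof.
move=> bf fc; apply: (le_trans (norm_Ex bf)); apply: Ex_le_cst => //; exact: bm_norm.
Qed.

Lemma Ex_sqr_centered f c : bm f ->
  Ex P (fun x => (f x - c) ^+ 2) = Ex P (fun x => f x ^+ 2) - 2 * c * Ex P f + c ^+ 2.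
Proof.
move=> bf.
have b2 := bmX 2 bf; have b3 : bm (fun x => (2 * c) * f x).
  exact: bmM (bm_cst _) bf.
rewrite (_ : (fun x => _) = fun x => (f x ^+ 2 - (2 * c) * f x) + c ^+ 2); last first.
  by apply/funext => x; ring.
by rewrite ExD ?ExB ?ExZl ?Ex_cst//; bmt.
Qed.

Definition Var f := Ex P (fun x => f x ^+ 2) - Ex P f ^+ 2.

Lemma Var_centered f : bm f -> Var f = Ex P (fun x => (f x - Ex P f) ^+ 2).
Proof. by move=> bf; rewrite Ex_sqr_centered// /Var; ring. Qed.

(** The mean minimises the quadratic risk. *)
Lemma Var_le f c : bm f -> Var f <= Ex P (fun x => (f x - c) ^+ 2).
Proof.
move=> bf; rewrite Ex_sqr_centered// /Var -subr_ge0.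
by rewrite (_ : _ - _ = (Ex P f - c) ^+ 2) ?sqr_ge0//; ring.
Qed.

Lemma Ex_sqr_le f : bm f -> Ex P f ^+ 2 <= Ex P (fun x => f x ^+ 2).
Proof.
move=> bf; rewrite -subr_ge0 -/(Var f) Var_centered//.
by apply: Ex_ge0 => x; exact: sqr_ge0.
Qed.

(** Estimators are split into their V-statistics at the price of a constant: no
    covariance has to be computed. *)
Lemma VarD f g : bm f -> bm g -> Var (fun x => f x + g x) <= 2 * Var f + 2 * Var g.
Proof.
move=> bf bg; have bfg := bmD bf bg.
apply: (le_trans (Var_le (Ex P f + Ex P g) bfg)).
rewrite !Var_centered//; set u := Ex P f; set v := Ex P g.
have [c cE] : {c | c = u + v} by exists (u + v).
rewrite -cE -!ExZl; [|by bmt..].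
rewrite -ExD; [|by bmt..].
apply: le_Ex; [by bmt..|].
move=> x; rewrite cE.
rewrite -subr_ge0 (_ : _ - _ = ((f x - u) - (g x - v)) ^+ 2) ?sqr_ge0//; ring.
Qed.

Lemma VarN f : bm f -> Var (fun x => - f x) = Var f.
Proof.
move=> bf; rewrite /Var ExN// sqrrN; congr (_ - _).
by apply: eq_Ex => x; rewrite sqrrN.
Qed.

End expectation.

Arguments eq_Ex {dd T R P f} g.

(** * Samples: redrawing a point and the Efron-Stein inequality *)

Section two_factors.
Context {d1 d2} {T1 : measurableType d1} {T2 : measurableType d2} {R : realType}.
Variables (P : probability T1 R) (Q : probability T2 R).

Lemma bm_slice1 (f : T1 * T2 -> R) x : bm f -> bm (fun y => f (x, y)).
Proof. by move=> bf; apply: (bm_comp bf); exact: pair1_measurable. Qed.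

Lemma bm_slice2 (f : T1 * T2 -> R) y : bm f -> bm (fun x => f (x, y)).
Proof. by move=> bf; apply: (bm_comp bf); exact: pair2_measurable. Qed.

Lemma bm_Ex2 (f : T1 * T2 -> R) : bm f -> bm (fun x => Ex Q (fun y => f (x, y))).
Proof.
move=> bf; have [C C0 hC] := bm_bound bf.
have bfx x := bm_slice1 x bf.
split; last first.
  by exists C => x; apply: norm_Ex_le.
apply/measurable_EFinP.
rewrite (_ : _ \o _ = fubini_F Q (EFin \o f)); last first.
  by apply/funext => x /=; rewrite EFin_Ex.
apply: (@measurable_fubini_F _ _ _ _ _ P).
exact: (@bm_integrable _ _ _ (P \x Q)%E _ bf).
Qed.

Lemma bm_Ex1 (f : T1 * T2 -> R) : bm f -> bm (fun y => Ex P (fun x => f (x, y))).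
Proof.
move=> bf; have [C C0 hC] := bm_bound bf.
have bfx x := bm_slice2 x bf.
split; last first.
  by exists C => x; apply: norm_Ex_le.
apply/measurable_EFinP.
rewrite (_ : _ \o _ = fubini_G P (EFin \o f)); last first.
  by apply/funext => x /=; rewrite EFin_Ex.
apply: (@measurable_fubini_G _ _ _ _ _ P Q).
exact: (@bm_integrable _ _ _ (P \x Q)%E _ bf).
Qed.

Lemma Ex_prod (f : T1 * T2 -> R) : bm f ->
  Ex (P \x Q)%E f = Ex P (fun x => Ex Q (fun y => f (x, y))).
Proof.
move=> bf; apply: EFin_inj; rewrite !EFin_Ex//; last exact: bm_Ex2.
rewrite -integral12_prod_meas1//; last exact: (@bm_integrable _ _ _ (P \x Q)%E _ bf).
by apply: eq_integral => x _; rewrite EFin_Ex//; exact: bm_slice1.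
Qed.

Lemma Ex_swap (f : T1 * T2 -> R) : bm f ->
  Ex P (fun x => Ex Q (fun y => f (x, y))) = Ex Q (fun y => Ex P (fun x => f (x, y))).
Proof.
move=> bf; rewrite -Ex_prod//; apply: EFin_inj; rewrite !EFin_Ex//; last exact: bm_Ex1.
rewrite -integral21_prod_meas1//; last exact: (@bm_integrable _ _ _ (P \x Q)%E _ bf).
by apply: eq_integral => x _; rewrite EFin_Ex//; exact: bm_slice2.
Qed.

End two_factors.

Lemma Ex_distribution {d1 d2} {T1 : measurableType d1} {T2 : measurableType d2}
    {R : realType} (P : probability T1 R) (X : {mfun T1 >-> T2}) (f : T2 -> R) :
  bm f -> Ex (distribution P X) f = Ex P (fun x => f (X x)).
Proof.
move=> bf; have bfX : bm (fun x => f (X x)) by exact: (bm_comp bf).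
apply: EFin_inj; rewrite !EFin_Ex// integral_distribution//.
  exact/measurable_EFinP/bm_meas.
exact: bm_integrable.
Qed.

Section iid.
Context {dd} {T : measurableType dd} {R : realType} (P : probability T R).

(** Redrawing the i-th point is the only operation on samples that is needed: marginals,
    independence and the Efron-Stein inequality all come from [Ex_resample]. *)
Definition upd {n} (s : n.-tuple T) (i : 'I_n) (o : T) : n.-tuple T :=
  [tuple (if j == i then o else tnth s j) | j < n].

Lemma tnth_upd n (s : n.-tuple T) i o j :
  tnth (upd s i o) j = if j == i then o else tnth s j.
Proof. by rewrite tnth_mktuple. Qed.

Lemma tnth_upd_eq n (s : n.-tuple T) i o : tnth (upd s i o) i = o.
Proof. by rewrite tnth_upd eqxx. Qed.

Lemma tnth_upd_neq n (s : n.-tuple T) i o j : j != i ->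
  tnth (upd s i o) j = tnth s j.
Proof. by rewrite tnth_upd => /negPf ->. Qed.

Lemma tnth_tcons0 n x (s : n.-tuple T) : tnth (tcons (x, s)) ord0 = x.
Proof. by []. Qed.

Lemma tnth_tconsS n x (s : n.-tuple T) i : tnth (tcons (x, s)) (lift ord0 i) = tnth s i.
Proof. by rewrite (tnth_nth x) /= -tnth_nth. Qed.

Lemma upd_tcons0 n x (s : n.-tuple T) o : upd (tcons (x, s)) ord0 o = tcons (o, s).
Proof.
apply: eq_from_tnth => j; rewrite tnth_upd; case: (unliftP ord0 j) => [k ->|->].
  by rewrite eq_sym (negPf (neq_lift _ _)) !tnth_tconsS.
by rewrite eqxx.
Qed.

Lemma upd_tconsS n x (s : n.-tuple T) i o :
  upd (tcons (x, s)) (lift ord0 i) o = tcons (x, upd s i o).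
Proof.
apply: eq_from_tnth => j; rewrite tnth_upd; case: (unliftP ord0 j) => [k ->|->].
  by rewrite (inj_eq lift_inj) !tnth_tconsS tnth_upd.
by rewrite (negPf (neq_lift _ _)).
Qed.

Lemma measurable_updP n (i : 'I_n) :
  measurable_fun [set: n.-tuple T * T] (fun z => upd z.1 i z.2).
Proof.
apply/measurable_fun_tnthP => j.
rewrite (_ : _ \o _ = fun z => if j == i then z.2 else tnth z.1 j); last first.
  by apply/funext => z /=; rewrite tnth_upd.
case: (j == i); first exact: measurable_snd.
by apply: (@measurableT_comp _ _ _ _ _ _ (fun s => tnth s j)) => //; exact: measurable_tnth.
Qed.

Lemma bm_updP n (i : 'I_n) (f : n.-tuple T -> R) : bm f ->
  bm (fun z : n.-tuple T * T => f (upd z.1 i z.2)).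
Proof. by move=> bf; apply: (bm_comp bf); exact: measurable_updP. Qed.

Lemma bm_updr n (i : 'I_n) s (f : n.-tuple T -> R) : bm f ->
  bm (fun o => f (upd s i o)).
Proof. by move=> bf; exact: (bm_slice1 s (bm_updP i bf)). Qed.

Lemma bm_tnth n (i : 'I_n) (f : T -> R) : bm f -> bm (fun s : n.-tuple T => f (tnth s i)).
Proof. by move=> bf; apply: (bm_comp bf); exact: measurable_tnth. Qed.

Lemma bm_tnth2 n (i j : 'I_n) (f : T -> T -> R) : bm (fun z => f z.1 z.2) ->
  bm (fun s : n.-tuple T => f (tnth s i) (tnth s j)).
Proof.
move=> bf; apply: (@bm_comp _ _ _ _ _ _ (fun s => (tnth s i, tnth s j)) bf).
by apply: measurable_fun_pair; exact: measurable_tnth.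
Qed.

Lemma bm_tcons n (f : n.+1.-tuple T -> R) : bm f -> bm (fun z => f (tcons z)).
Proof. by move=> bf; exact: (bm_comp bf). Qed.

Lemma Ex_iid0 (f : 0.-tuple T -> R) : bm f -> Ex (iid P 0) f = f [tuple].
Proof.
move=> bf; rewrite (@eq_Ex _ _ _ _ f (fun=> f [tuple])) ?Ex_cst// => x.
by rewrite tuple0.
Qed.

Lemma Ex_iidS n (f : n.+1.-tuple T -> R) : bm f ->
  Ex (iid P n.+1) f = Ex P (fun x => Ex (iid P n) (fun s => f (tcons (x, s)))).
Proof.
move=> bf; rewrite [iid P n.+1]/= Ex_distribution//.
rewrite (@Ex_prod _ _ _ _ _ _ _ (fun z => f (tcons z)))//; exact: bm_tcons.
Qed.

Opaque iid.

(** Redrawing one point by an independent copy does not change the law of a sample.  The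
    induction peels off the first point, and uses Fubini when that point is the redrawn
    one. *)
Lemma Ex_resample n (i : 'I_n) (f : n.-tuple T -> R) : bm f ->
  Ex (iid P n) f = Ex (iid P n) (fun s => Ex P (fun o => f (upd s i o))).
Proof.
elim: n i f => [[]//|n IH] i f bf.
have bft := bm_tcons bf.
rewrite (Ex_iidS bf) (Ex_iidS (bm_Ex2 (iid P n.+1) P (bm_updP i bf))).
case: (unliftP ord0 i) => [j ->|->]; last first.
  rewrite (Ex_swap P (iid P n) bft) -[LHS](Ex_cst P); apply: eq_Ex => x /=.
  by apply: eq_Ex => s; apply: eq_Ex => o; rewrite upd_tcons0.
apply: eq_Ex => x; rewrite (IH j); last exact: (bm_slice1 x bft).
by apply: eq_Ex => s /=; apply: eq_Ex => o; rewrite upd_tconsS.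
Qed.

Definition indep {n} (i : 'I_n) (f : n.-tuple T -> R) :=
  forall s o, f (upd s i o) = f s.

(** Conditionally on the other points, g has mean at most C while F is fixed. *)
Lemma Ex_integrate_out n (i : 'I_n) (F g : n.-tuple T -> R) (C : R) :
  bm F -> bm g -> (forall s, 0 <= F s) -> indep i F ->
  (forall s, Ex P (fun o => g (upd s i o)) <= C) ->
  Ex (iid P n) (fun s => F s * g s) <= C * Ex (iid P n) F.
Proof.
move=> bF bg F0 iF gC; rewrite (Ex_resample i); last exact: bmM.
rewrite -ExZl//; apply: le_Ex.
- exact: (bm_Ex2 (iid P n) P (bm_updP i (bmM bF bg))).
- exact: bmM (bm_cst _) bF.
move=> s; rewrite (eq_Ex (fun o => F s * g (upd s i o))); last first.
  by move=> o; rewrite iF.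
rewrite (ExZl P (F s) (bm_updr i s bg)) mulrC.
by apply: ler_wpM2r; [exact: F0|exact: gC].
Qed.

Lemma Ex_coord1 n (i : 'I_n) (h : T -> R) : bm h ->
  Ex (iid P n) (fun s => h (tnth s i)) = Ex P h.
Proof.
move=> bh; rewrite (Ex_resample i); last exact: bm_tnth.
rewrite (eq_Ex (fun=> Ex P h)) ?Ex_cst// => s.
by apply: eq_Ex => o; rewrite tnth_upd_eq.
Qed.

Lemma Ex_coord2 n (i j : 'I_n) (h : T -> T -> R) : bm (fun z => h z.1 z.2) ->
  i != j ->
  Ex (iid P n) (fun s => h (tnth s i) (tnth s j)) = Ex P (fun x => Ex P (fun y => h x y)).
Proof.
move=> bh ij; rewrite (Ex_resample j); last exact: bm_tnth2.
rewrite -(Ex_coord1 i (bm_Ex2 P P bh)).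
by apply: eq_Ex => s /=; apply: eq_Ex => o; rewrite tnth_upd_eq tnth_upd_neq.
Qed.

Lemma bm_tnth3 n (i j k : 'I_n) (f : T -> T -> T -> R) :
  bm (fun z => f z.1.1 z.1.2 z.2) ->
  bm (fun s : n.-tuple T => f (tnth s i) (tnth s j) (tnth s k)).
Proof.
move=> bf; apply: (@bm_comp _ _ _ _ _ _ (fun s => (tnth s i, tnth s j, tnth s k)) bf).
by apply: measurable_fun_pair; [apply: measurable_fun_pair|]; exact: measurable_tnth.
Qed.

Lemma Ex_coord3 n (i j k : 'I_n) (h : T -> T -> T -> R) :
  bm (fun z => h z.1.1 z.1.2 z.2) -> i != j -> i != k -> j != k ->
  Ex (iid P n) (fun s => h (tnth s i) (tnth s j) (tnth s k)) =
  Ex P (fun x => Ex P (fun y => Ex P (fun z => h x y z))).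
Proof.
move=> bh ij ik jk; rewrite (Ex_resample k); last exact: bm_tnth3.
rewrite -(@Ex_coord2 n i j (fun x y => Ex P (fun z => h x y z)) (bm_Ex2 (P \x P)%E P bh) ij).
by apply: eq_Ex => s /=; apply: eq_Ex => o; rewrite tnth_upd_eq !tnth_upd_neq.
Qed.

(** Efron-Stein inequality, with an arbitrary approximation g i of f that ignores the
    i-th point.  The induction conditions on the first point: the variance is the mean of
    the conditional variances, to which the induction hypothesis applies, plus the
    variance of the conditional mean G.  As g 0 ignores the first point, its conditional
    mean is a constant c, and Jensen bounds the mean of (G - c)^2. *)
Lemma Efron_Stein n (f : n.-tuple T -> R) (g : 'I_n -> n.-tuple T -> R) :
  bm f -> (forall i, bm (g i)) -> (forall i, indep i (g i)) ->
  Var (iid P n) f <= \sum_(i < n) Ex (iid P n) (fun s => (f s - g i s) ^+ 2).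
Proof.
elim: n f g => [|n IH] f g bf bg ig.
  by rewrite /Var big_ord0 !Ex_iid0 ?subrr//; exact: bmX.
have bft := bm_tcons bf.
have bgt i := bm_tcons (bg i).
have bdt i : bm (fun z : T * n.-tuple T => (f (tcons z) - g i (tcons z)) ^+ 2).
  by bmt.
pose G x := Ex (iid P n) (fun s => f (tcons (x, s))).
have bG : bm G by exact: (bm_Ex2 P (iid P n) bft).
pose V x := Var (iid P n) (fun s => f (tcons (x, s))).
have bf2 : bm (fun x => Ex (iid P n) (fun s => f (tcons (x, s)) ^+ 2)).
  exact: (bm_Ex2 P (iid P n) (bmX 2 bft)).
have bV : bm V by apply: bmB => //; exact: bmX.
have -> : Var (iid P n.+1) f = Ex P V + Var P G.
  rewrite /Var !Ex_iidS//; last exact: bmX.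
  by rewrite /V /Var ExB//; [rewrite -/G; ring|exact: bmX].
have rhsE i : Ex (iid P n.+1) (fun s => (f s - g i s) ^+ 2) =
    Ex P (fun x => Ex (iid P n) (fun s => (f (tcons (x, s)) - g i (tcons (x, s))) ^+ 2)).
  by rewrite Ex_iidS//; bmt.
rewrite big_ord_recl addrC; apply: lerD.
  rewrite rhsE; pose c := Ex P (fun x => Ex (iid P n) (fun s => g ord0 (tcons (x, s)))).
  have cE x : c = Ex (iid P n) (fun s => g ord0 (tcons (x, s))).
    rewrite /c (eq_Ex (fun=> Ex (iid P n) (fun s => g ord0 (tcons (x, s))))) ?Ex_cst//.
    by move=> y; apply: eq_Ex => s; rewrite -(ig ord0 _ x) upd_tcons0.
  apply: (le_trans (Var_le P c bG)); apply: le_Ex.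
  - by apply: bmX; bmt.
  - exact: (bm_Ex2 P (iid P n) (bdt ord0)).
  - move=> x; rewrite /G (cE x) -ExB; [|exact: (bm_slice1 x bft)|exact: (bm_slice1 x (bgt ord0))].
    by apply: Ex_sqr_le; exact: (bm_slice1 x (bmB bft (bgt ord0))).
under eq_bigr do rewrite rhsE.
rewrite -(Ex_sum P); last first.
  by move=> i; exact: (bm_Ex2 P (iid P n) (bdt (lift ord0 i))).
apply: le_Ex => //.
  by apply: bm_sum => i; exact: (bm_Ex2 P (iid P n) (bdt (lift ord0 i))).
move=> x; apply: IH.
- exact: (bm_slice1 x bft).
- by move=> i; exact: (bm_slice1 x (bgt _)).
- by move=> i s o; rewrite -upd_tconsS ig.
Qed.

End iid.

(** * Moments of kernel sums over a sample *)

Section moments.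
Context {dd} {T : measurableType dd} {R : realType} (P : probability T R).
Variable c : R.
Hypothesis c_ge0 : 0 <= c.

(** The size of the absolute value of a projection kernel on a space of dimension k:
    bounded by k up to a constant, with bounded integrals. *)
Record pos_kernel (k : R) (ka : T -> T -> R) : Prop := PosKernel {
  pk_k : 0 <= k;
  pk_bm : bm (fun z => ka z.1 z.2);
  pk_sym : forall x y, ka x y = ka y x;
  pk_ge0 : forall x y, 0 <= ka x y;
  pk_sup : forall x y, ka x y <= c * k;
  pk_int : forall y, Ex P (fun x => ka x y) <= c }.

(** The degree of the point e in the complete graph on the sample weighted by ka. *)
Definition deg (ka : T -> T -> R) {n} (s : n.-tuple T) (e : 'I_n) : R :=
  \sum_(b < n) ka (tnth s b) (tnth s e).

Lemma bm_deg ka k n (e : 'I_n) : pos_kernel k ka -> bm (fun s => deg ka s e).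
Proof. by move=> hk; apply: bm_sum => b; exact: bm_tnth2 (pk_bm hk). Qed.

Lemma deg_ge0 ka k n (s : n.-tuple T) e : pos_kernel k ka -> 0 <= deg ka s e.
Proof. by move=> hk; apply: sumr_ge0 => b _; exact: pk_ge0 hk _ _. Qed.

(** The squared degree is averaged against a weight F that sees only the points of I.
    The at most three summands with index in I are bounded by c k each.  The others,
    except for coinciding pairs, can be integrated out one after the other, each for a
    factor c; a coinciding pair costs c k for one factor and c for the other. *)
Lemma Ex_deg_sqr ka k n (F : n.-tuple T -> R) (I : {set 'I_n}) e :
  pos_kernel k ka -> bm F -> (forall s, 0 <= F s) ->
  (forall b, b \notin I -> indep b F) -> e \in I -> (#|I| <= 3)%N ->
  Ex (iid P n) (fun s => F s * deg ka s e ^+ 2) <=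
  18 * c ^+ 2 * (n%:R ^+ 2 + n%:R * k + k ^+ 2) * Ex (iid P n) F.
Proof.
move=> hk bF F0 iF eI I3; have k0 := pk_k hk.
pose ka_ b (s : n.-tuple T) := ka (tnth s b) (tnth s e).
have bka b : bm (ka_ b) by exact: bm_tnth2 (pk_bm hk).
have ka0 b s : 0 <= ka_ b s by exact: pk_ge0 hk _ _.
have EF0 : 0 <= Ex (iid P n) F by exact: Ex_ge0.
pose u s := \sum_(b in I) ka_ b s.
pose v s := \sum_(b in ~: I) ka_ b s.
have bv : bm v by apply: bm_sum.
have degE s : deg ka s e = u s + v s.
  rewrite /deg (bigID (mem I)) /=; congr (_ + _).
  by apply: eq_bigl => b; rewrite inE.
have u0 s : 0 <= u s by apply: sumr_ge0.
have u_le s : u s <= 3 * (c * k).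
  apply: (@le_trans _ _ (\sum_(b in I) (c * k))).
    by apply: ler_sum => b _; exact: pk_sup hk _ _.
  rewrite sumr_const -[leLHS]mulr_natl ler_wpM2r ?mulr_ge0//.
  by rewrite ler_nat.
have one b : b \notin I -> Ex (iid P n) (fun s => F s * ka_ b s) <= c * Ex (iid P n) F.
  move=> bI; apply: (Ex_integrate_out (i := b)) => //; first exact: iF.
  move=> s; have eb : e != b by apply: contraNneq bI => <-.
  rewrite (eq_Ex (fun o => ka o (tnth s e))); first exact: pk_int hk _.
  by move=> o; rewrite /ka_ tnth_upd_eq tnth_upd_neq.
have two b b' : b \notin I -> b' \notin I ->
  Ex (iid P n) (fun s => F s * (ka_ b s * ka_ b' s)) <=
  c ^+ 2 * (1 + (b' == b)%:R * k) * Ex (iid P n) F.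
  move=> bI b'I; have [b'b|b'b] := eqVneq b' b.
    apply: (@le_trans _ _ (Ex (iid P n) (fun s => (c * k) * (F s * ka_ b s)))).
      apply: le_Ex; [by bmt..|] => s.
      rewrite b'b mulrA mulrC ler_wpM2r//; first exact: mulr_ge0.
      exact: pk_sup hk _ _.
    rewrite ExZl; last by bmt.
    apply: (@le_trans _ _ ((c * k) * (c * Ex (iid P n) F))).
      by rewrite ler_wpM2l ?mulr_ge0//; exact: one.
    rewrite mul1r -subr_ge0 (_ : _ - _ = c ^+ 2 * Ex (iid P n) F); last by ring.
    by rewrite mulr_ge0 ?sqr_ge0.
  rewrite mul0r addr0 mulr1 expr2 -mulrA.
  have -> : Ex (iid P n) (fun s => F s * (ka_ b s * ka_ b' s)) =
            Ex (iid P n) (fun s => (F s * ka_ b' s) * ka_ b s).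
    by apply: eq_Ex => s; ring.
  apply: (@le_trans _ _ (c * Ex (iid P n) (fun s => F s * ka_ b' s))); last first.
    by rewrite ler_wpM2l// one.
  have eb : e != b by apply: contraNneq bI => <-.
  apply: (Ex_integrate_out (i := b)) => //; first by bmt.
  - by move=> s; exact: mulr_ge0.
  - by move=> s o; rewrite /ka_ !tnth_upd_neq// iF.
  - move=> s.
    rewrite (eq_Ex (fun o => ka o (tnth s e))); first exact: pk_int hk _.
    by move=> o; rewrite /ka_ tnth_upd_eq tnth_upd_neq.
have Ev : Ex (iid P n) (fun s => F s * v s ^+ 2) <=
    c ^+ 2 * (n%:R ^+ 2 + n%:R * k) * Ex (iid P n) F.
  have -> : Ex (iid P n) (fun s => F s * v s ^+ 2) =
     \sum_(b in ~: I) \sum_(b' in ~: I) Ex (iid P n) (fun s => F s * (ka_ b s * ka_ b' s)).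
    rewrite (eq_Ex (fun s => \sum_(b in ~: I) \sum_(b' in ~: I) (F s * (ka_ b s * ka_ b' s)))).
      by rewrite Ex_sum; [apply: eq_bigr => b _; rewrite Ex_sum//|] => *; bmt.
    move=> s; rewrite expr2 /v mulr_suml mulr_sumr; apply: eq_bigr => b _.
    by rewrite !mulr_sumr.
  apply: (@le_trans _ _ (\sum_(b < n) \sum_(b' < n)
      c ^+ 2 * (1 + (b' == b)%:R * k) * Ex (iid P n) F)).
    have nn b b' : 0 <= c ^+ 2 * (1 + (b' == b :> 'I_n)%:R * k) * Ex (iid P n) F.
      by rewrite !mulr_ge0 ?sqr_ge0// addr_ge0// mulr_ge0.
    rewrite [leRHS](bigID (mem (~: I))) /= -[leLHS]addr0; apply: lerD; last first.
      by apply: sumr_ge0 => b _; apply: sumr_ge0.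
    apply: ler_sum => b; rewrite inE => bI.
    rewrite [leRHS](bigID (mem (~: I))) /= -[leLHS]addr0; apply: lerD; last first.
      exact: sumr_ge0.
    by apply: ler_sum => b'; rewrite inE => b'I; exact: two.
  rewrite (eq_bigr (fun=> c ^+ 2 * (n%:R + k) * Ex (iid P n) F)).
    rewrite sumr_const card_ord -mulr_natl le_eqVlt; apply/orP; left; apply/eqP; ring.
  move=> b _; rewrite -mulr_suml -mulr_sumr big_split /= sumr_const card_ord.
  rewrite -mulr_suml (bigD1 b)//= eqxx big1 ?addr0 ?mul1r//.
  by move=> i /negPf ->.
apply: (@le_trans _ _ (Ex (iid P n) (fun s => (2 * (3 * (c * k)) ^+ 2) * F s +
    2 * (F s * v s ^+ 2)))).
  apply: le_Ex.
  - by apply: bmM => //; apply: bmX; exact: bm_deg hk.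
  - by bmt.
  move=> s; rewrite degE.
  have h1 : u s ^+ 2 <= (3 * (c * k)) ^+ 2 by rewrite lerXn2r ?nnegrE// !mulr_ge0.
  have h2 : (u s + v s) ^+ 2 <= 2 * u s ^+ 2 + 2 * v s ^+ 2.
    rewrite -subr_ge0 (_ : _ - _ = (u s - v s) ^+ 2); [exact: sqr_ge0|ring].
  apply: (@le_trans _ _ (F s * (2 * u s ^+ 2 + 2 * v s ^+ 2))).
    by rewrite ler_wpM2l.
  rewrite [leRHS](_ : _ = F s * (2 * (3 * (c * k)) ^+ 2 + 2 * v s ^+ 2)); last by ring.
  by rewrite ler_wpM2l// lerD2r ler_wpM2l.
rewrite ExD; [|by bmt..]; rewrite !ExZl; [|by bmt..].
have h0 : 0 <= c ^+ 2 * (n%:R ^+ 2 + n%:R * k) * Ex (iid P n) F.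
  by rewrite !mulr_ge0 ?sqr_ge0// addr_ge0 ?sqr_ge0// mulr_ge0.
apply: (@le_trans _ _ (2 * (3 * (c * k)) ^+ 2 * Ex (iid P n) F +
   18 * (c ^+ 2 * (n%:R ^+ 2 + n%:R * k) * Ex (iid P n) F))).
  by rewrite lerD2l; lra.
by rewrite le_eqVlt; apply/orP; left; apply/eqP; ring.
Qed.

(** A sum of n terms of mean O(1) and size O(k) has a second moment of order n^2, to
    which the squares of the terms add n k; k^2 comes from the at most three
    terms that cannot be averaged. *)
Definition mom_bound n (k : R) : R := 18 * c ^+ 2 * (n%:R ^+ 2 + n%:R * k + k ^+ 2).

Lemma mom_bound_ge0 n k : 0 <= k -> 0 <= mom_bound n k.
Proof.
by move=> k0; rewrite /mom_bound !mulr_ge0 ?sqr_ge0// !addr_ge0 ?sqr_ge0// mulr_ge0.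
Qed.

Lemma Ex_deg2 ka k n e : pos_kernel k ka ->
  Ex (iid P n) (fun s => deg ka s e ^+ 2) <= mom_bound n k.
Proof.
move=> hk; have := @Ex_deg_sqr ka k n (fun=> 1) [set e] e hk (bm_cst _).
rewrite Ex_cst mulr1 => h; apply: le_trans (h _ _ _ _) => //.
- by rewrite le_eqVlt; apply/orP; left; apply/eqP/eq_Ex => s; rewrite mul1r.
- by rewrite inE.
- by rewrite cards1.
Qed.

(** The squares of the effects of one point t on U3: [b] tells whether the degree for
    the second kernel is taken at t itself or at the centre i.  Both degrees are handled
    by [Ex_deg_sqr], first with the set of indices t, i, i', then with t alone. *)
Lemma Ex_deg_deg ka1 ka2 k1 k2 n t (b : bool) : pos_kernel k1 ka1 -> pos_kernel k2 ka2 ->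
  Ex (iid P n) (fun s => \sum_(i < n) \sum_(i' < n)
    ka1 (tnth s i) (tnth s t) * ka1 (tnth s i') (tnth s t) *
      deg ka2 s (if b then i else t) ^+ 2) <= mom_bound n k1 * mom_bound n k2.
Proof.
move=> hk1 hk2.
have b1 i : bm (fun s : n.-tuple T => ka1 (tnth s i) (tnth s t)).
  exact: bm_tnth2 (pk_bm hk1).
have b2 e : bm (fun s : n.-tuple T => deg ka2 s e) by exact: bm_deg hk2.
rewrite Ex_sum; last by move=> i; bmt.
apply: (@le_trans _ _ (\sum_(i < n) \sum_(i' < n) mom_bound n k2 *
  Ex (iid P n) (fun s => ka1 (tnth s i) (tnth s t) * ka1 (tnth s i') (tnth s t)))).
  apply: ler_sum => i _; rewrite Ex_sum; last by move=> i'; bmt.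
  apply: ler_sum => i' _.
  apply: (@Ex_deg_sqr _ _ _ _ [set t; i; i'] _ hk2).
  - by bmt.
  - by move=> s; rewrite mulr_ge0//; exact: pk_ge0 hk1 _ _.
  - move=> j; rewrite !inE !negb_or => /andP[/andP[jt ji] ji'] s o.
    by rewrite !tnth_upd_neq// eq_sym.
  - by case: b; rewrite !inE eqxx ?orbT.
  - apply: (leq_trans (leq_card_setU _ _)); rewrite cards1 addn1 ltnS.
    by rewrite cards2; case: (_ != _).
rewrite (eq_bigr (fun i => mom_bound n k2 * \sum_(i' < n) Ex (iid P n) (fun s =>
    ka1 (tnth s i) (tnth s t) * ka1 (tnth s i') (tnth s t)))); last first.
  by move=> i _; rewrite mulr_sumr.
rewrite -mulr_sumr mulrC ler_wpM2r//; first exact/mom_bound_ge0/(pk_k hk2).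
apply: le_trans (Ex_deg2 t hk1).
rewrite (eq_bigr (fun i => Ex (iid P n) (fun s =>
   \sum_(i' < n) ka1 (tnth s i) (tnth s t) * ka1 (tnth s i') (tnth s t)))); last first.
  by move=> i _; rewrite Ex_sum// => i'; bmt.
rewrite -Ex_sum; last by move=> i; bmt.
rewrite le_eqVlt; apply/orP; left; apply/eqP/eq_Ex => s.
rewrite expr2 /deg mulr_suml; apply: eq_bigr => i _; by rewrite mulr_sumr.
Qed.

End moments.

(** * Variances of the V-statistics *)

Section vstat_variance.
Context {dd} {T : measurableType dd} {R : realType} (P : probability T R).
Variables (A Y : T -> R) (B c : R).
Hypotheses (bA : bm A) (bY : bm Y).
Hypotheses (AB : forall x, `|A x| <= B) (YB : forall x, `|Y x| <= B).
Hypotheses (c_ge0 : 0 <= c) (B_ge0 : 0 <= B).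

Lemma VarZ (f : T -> R) (a : R) : bm f -> Var P (fun s => a * f s) = a ^+ 2 * Var P f.
Proof.
move=> bf; rewrite /Var ExZl// (eq_Ex (fun s => a ^+ 2 * f s ^+ 2)); last first.
  by move=> s; rewrite exprMn.
by rewrite ExZl; [ring|bmt].
Qed.

Definition kernel_of_size (k : R) (K : T -> T -> R) :=
  [/\ bm (fun z => K z.1 z.2), (forall x y, K x y = K y x) &
      pos_kernel P c k (fun x y => `|K x y|)].

(** The V-statistics of degree one, two and three out of which the estimators are made;
    in [U3] the index i is the centre at which both kernels are evaluated. *)
Definition U1 {n} (s : n.-tuple T) : R := \sum_(i < n) A (tnth s i) * Y (tnth s i).

Definition U2 (K : T -> T -> R) {n} (s : n.-tuple T) : R :=
  \sum_(a < n) \sum_(b < n) A (tnth s a) * Y (tnth s b) * K (tnth s a) (tnth s b).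

Definition U3 (K1 K2 : T -> T -> R) {n} (s : n.-tuple T) : R :=
  \sum_(i < n) \sum_(a < n) \sum_(b < n)
    A (tnth s a) * K1 (tnth s a) (tnth s i) * (Y (tnth s b) * K2 (tnth s b) (tnth s i)).

Lemma bm_U1 n : bm (@U1 n).
Proof. by apply: bm_sum => i; apply: bmM; exact: bm_tnth. Qed.

Lemma bm_U2 k K n : kernel_of_size k K -> bm (@U2 K n).
Proof.
case=> bK _ _; do 2 apply: bm_sum => ?.
by apply: bmM; [apply: bmM; exact: bm_tnth|exact: bm_tnth2].
Qed.

Lemma bm_U3 k1 k2 K1 K2 n : kernel_of_size k1 K1 -> kernel_of_size k2 K2 ->
  bm (@U3 K1 K2 n).
Proof.
case=> bK1 _ _ [bK2 _ _]; do 3 apply: bm_sum => ?.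
by apply: bmM; apply: bmM; (exact: bm_tnth || exact: bm_tnth2).
Qed.

Lemma Var_U1 n : Var (iid P n) U1 <= n%:R * B ^+ 4.
Proof.
have b1 (i : 'I_n) : bm (fun s : n.-tuple T => A (tnth s i) * Y (tnth s i)).
  by apply: bmM; exact: bm_tnth.
pose g (i : 'I_n) (s : n.-tuple T) := \sum_(j < n | j != i) A (tnth s j) * Y (tnth s j).
apply: (@le_trans _ _ (\sum_(i < n) Ex (iid P n) (fun s => (U1 s - g i s) ^+ 2))).
  apply: Efron_Stein; first exact: bm_U1.
  - by move=> i; exact: bm_sum.
  - by move=> i s o; apply: eq_bigr => j ji; rewrite !tnth_upd_neq.
apply: (@le_trans _ _ (\sum_(i < n) B ^+ 4)); last first.
  by rewrite sumr_const card_ord -[leLHS]mulr_natl.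
apply: ler_sum => i _; apply: Ex_le_cst.
  by apply: bmX; apply: bmB; [exact: bm_U1|exact: bm_sum].
move=> s; rewrite /U1 (bigD1 i)//= addrK -real_normK ?num_real//.
rewrite (_ : B ^+ 4 = (B * B) ^+ 2); last by ring.
rewrite lerXn2r ?nnegrE ?mulr_ge0// normrM.
by apply: ler_pM.
Qed.

Lemma sum2_norm n (f g : 'I_n -> R) (M : R) :
  0 <= M -> (forall b, `|f b| <= M * g b) -> `|\sum_(b < n) f b| <= M * \sum_(b < n) g b.
Proof.
move=> M0 fg; apply: (le_trans (ler_norm_sum _ _ _)); rewrite mulr_sumr.
exact: ler_sum.
Qed.

Lemma AY_le x y : `|A x * Y y| <= B ^+ 2.
Proof. by rewrite normrM expr2 ler_pM. Qed.

(** The summands of U2 that involve a point i are bounded by 2 B^2 times the degree of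
    i. *)
Lemma Var_U2 k K n : kernel_of_size k K ->
  Var (iid P n) (U2 K) <= n%:R * (4 * B ^+ 4 * mom_bound c n k).
Proof.
move=> hK; have [bK sK pK] := hK.
have b1 (a b : 'I_n) : bm (fun s : n.-tuple T =>
    A (tnth s a) * Y (tnth s b) * K (tnth s a) (tnth s b)).
  by apply: bmM; [apply: bmM; exact: bm_tnth|exact: bm_tnth2].
pose ka x y := `|K x y|.
have bd (i : 'I_n) : bm (fun s : n.-tuple T => deg ka s i) by exact: bm_deg pK.
pose g (i : 'I_n) (s : n.-tuple T) := \sum_(a < n | a != i) \sum_(b < n | b != i)
   A (tnth s a) * Y (tnth s b) * K (tnth s a) (tnth s b).
have bg i : bm (g i) by apply: bm_sum => ?; exact: bm_sum.
have bU := bm_U2 n hK.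
apply: (@le_trans _ _ (\sum_(i < n) Ex (iid P n) (fun s => (U2 K s - g i s) ^+ 2))).
  apply: Efron_Stein => //.
  move=> i s o; apply: eq_bigr => a ai; apply: eq_bigr => b bi.
  by rewrite !tnth_upd_neq.
apply: (@le_trans _ _ (\sum_(i < n) 4 * B ^+ 4 * mom_bound c n k)); last first.
  by rewrite sumr_const card_ord -[leLHS]mulr_natl.
apply: ler_sum => i _.
apply: (@le_trans _ _ (Ex (iid P n) (fun s => (4 * B ^+ 4) * deg ka s i ^+ 2))); last first.
  rewrite ExZl; last by bmt.
  by rewrite ler_wpM2l ?mulr_ge0 ?exprn_ge0//; exact: Ex_deg2 pK.
apply: le_Ex; [by bmt..|] => s.
rewrite -real_normK ?num_real//.
rewrite (_ : 4 * B ^+ 4 * _ = (2 * (B ^+ 2 * deg ka s i)) ^+ 2); last by ring.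
have d0 : 0 <= deg ka s i by exact: deg_ge0 pK.
rewrite lerXn2r ?nnegrE ?mulr_ge0//.
have -> : U2 K s - g i s =
  \sum_(b < n) A (tnth s i) * Y (tnth s b) * K (tnth s i) (tnth s b) +
  \sum_(a < n | a != i) A (tnth s a) * Y (tnth s i) * K (tnth s a) (tnth s i).
  rewrite /U2 (bigD1 i)//= -addrA; congr (_ + _).
  rewrite -sumrB; apply: eq_bigr => a ai.
  by rewrite (bigD1 i)//= addrK.
apply: (le_trans (ler_normD _ _)); rewrite [leRHS]mulr_natl mulr2n; apply: lerD.
  apply: sum2_norm; first exact: sqr_ge0.
  move=> b; rewrite /ka normrM (sK (tnth s b)) ler_wpM2r//; exact: AY_le.
rewrite big_mkcond; apply: sum2_norm; first exact: sqr_ge0.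
move=> a; case: ifP => _; last by rewrite normr0 mulr_ge0 ?sqr_ge0 ?normr_ge0.
rewrite /ka normrM ler_wpM2r//; exact: AY_le.
Qed.

(** The Cauchy-Schwarz inequality for the weights w, with the sum of the weights left
    inside as the sum over i', since it is random below. *)
Lemma CS_sum n (w v : 'I_n -> R) : (forall i, 0 <= w i) ->
  (\sum_(i < n) w i * v i) ^+ 2 <= \sum_(i < n) \sum_(i' < n) w i * w i' * v i ^+ 2.
Proof.
move=> w0.
have e1 : (\sum_(i < n) w i * v i) ^+ 2 =
   \sum_(i < n) \sum_(i' < n) w i * w i' * (v i * v i').
  rewrite expr2 mulr_suml; apply: eq_bigr => i _; rewrite mulr_sumr.
  by apply: eq_bigr => i' _; ring.
have e2 : \sum_(i < n) \sum_(i' < n) w i * w i' * v i ^+ 2 =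
          \sum_(i < n) \sum_(i' < n) w i * w i' * v i' ^+ 2.
  rewrite exchange_big; apply: eq_bigr => i _; apply: eq_bigr => i' _; ring.
suff : 2 * (\sum_(i < n) w i * v i) ^+ 2 <=
   2 * \sum_(i < n) \sum_(i' < n) w i * w i' * v i ^+ 2 by rewrite ler_pM2l.
rewrite [leRHS]mulr_natl mulr2n [X in _ <= _ + X]e2 -big_split e1 mulr_sumr /=.
apply: ler_sum => i _; rewrite -big_split mulr_sumr; apply: ler_sum => i' _ /=.
rewrite -subr_ge0 (_ : _ - _ = w i * w i' * (v i - v i') ^+ 2); last by ring.
by apply: mulr_ge0; [exact: mulr_ge0|exact: sqr_ge0].
Qed.

Lemma norm_trilin (K1 K2 : T -> T -> R) x y z :
  `|A x * K1 x z * (Y y * K2 y z)| <= B ^+ 2 * (`|K1 x z| * `|K2 y z|).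
Proof.
rewrite !normrM (_ : `|A x| * _ * _ = (`|A x| * `|Y y|) * (`|K1 x z| * `|K2 y z|)); last by ring.
by rewrite -normrM ler_wpM2r ?mulr_ge0 ?normr_ge0//; exact: AY_le.
Qed.

(** A point t enters U3 as the centre, or as an argument of the first or of the second
    kernel; x1, x2 and x3 are the corresponding sums of absolute values, and [CS_sum]
    brings their squares in the form of [Ex_deg_deg]. *)
Lemma Var_U3 k1 k2 K1 K2 n : kernel_of_size k1 K1 -> kernel_of_size k2 K2 ->
  Var (iid P n) (U3 K1 K2) <= n%:R * (9 * B ^+ 4 * (mom_bound c n k1 * mom_bound c n k2)).
Proof.
move=> hK1 hK2; have [bK1 sK1 pK1] := hK1; have [bK2 sK2 pK2] := hK2.
have b1 (i a b : 'I_n) : bm (fun s : n.-tuple T =>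
   A (tnth s a) * K1 (tnth s a) (tnth s i) * (Y (tnth s b) * K2 (tnth s b) (tnth s i))).
  by apply: bmM; apply: bmM; (exact: bm_tnth || exact: bm_tnth2).
pose ka1 x y := `|K1 x y|; pose ka2 x y := `|K2 x y|.
have bk1 (i j : 'I_n) : bm (fun s : n.-tuple T => ka1 (tnth s i) (tnth s j)).
  exact: bm_tnth2 (pk_bm pK1).
have bk2 (i j : 'I_n) : bm (fun s : n.-tuple T => ka2 (tnth s i) (tnth s j)).
  exact: bm_tnth2 (pk_bm pK2).
have bd1 (i : 'I_n) : bm (fun s : n.-tuple T => deg ka1 s i) by exact: bm_deg pK1.
have bd2 (i : 'I_n) : bm (fun s : n.-tuple T => deg ka2 s i) by exact: bm_deg pK2.
pose g (t : 'I_n) (s : n.-tuple T) := \sum_(i < n | i != t) \sum_(a < n | a != t)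
  \sum_(b < n | b != t)
   A (tnth s a) * K1 (tnth s a) (tnth s i) * (Y (tnth s b) * K2 (tnth s b) (tnth s i)).
have bg i : bm (g i) by do 2 apply: bm_sum => ?; exact: bm_sum.
have bU := bm_U3 n hK1 hK2.
apply: (@le_trans _ _ (\sum_(t < n) Ex (iid P n) (fun s => (U3 K1 K2 s - g t s) ^+ 2))).
  apply: Efron_Stein => //.
  move=> t s o; apply: eq_bigr => i it; apply: eq_bigr => a at_; apply: eq_bigr => b bt.
  by rewrite !tnth_upd_neq.
set M := mom_bound c n k1 * mom_bound c n k2.
apply: (@le_trans _ _ (\sum_(t < n) 9 * B ^+ 4 * M)); last first.
  by rewrite sumr_const card_ord -[leLHS]mulr_natl.
apply: ler_sum => t _.
pose W (ka ka' : T -> T -> R) (b : bool) (s : n.-tuple T) := \sum_(i < n) \sum_(i' < n)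
    ka (tnth s i) (tnth s t) * ka (tnth s i') (tnth s t) *
      deg ka' s (if b then i else t) ^+ 2.
have bW12 b : bm (W ka1 ka2 b) by do 2 apply: bm_sum => ?; bmt.
have bW21 b : bm (W ka2 ka1 b) by do 2 apply: bm_sum => ?; bmt.
apply: (@le_trans _ _ (Ex (iid P n) (fun s =>
   (3 * B ^+ 4) * (W ka1 ka2 false s + W ka1 ka2 true s + W ka2 ka1 true s)))); last first.
  rewrite ExZl; last by bmt.
  rewrite ExD; [|by bmt..]; rewrite ExD; [|by bmt..].
  have h1 : Ex (iid P n) (W ka1 ka2 false) <= M := @Ex_deg_deg _ _ _ P c c_ge0 _ _ _ _ n t false pK1 pK2.
  have h2 : Ex (iid P n) (W ka1 ka2 true) <= M := @Ex_deg_deg _ _ _ P c c_ge0 _ _ _ _ n t true pK1 pK2.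
  have h3 : Ex (iid P n) (W ka2 ka1 true) <= M.
    rewrite /M mulrC; exact: (@Ex_deg_deg _ _ _ P c c_ge0 _ _ _ _ n t true pK2 pK1).
  rewrite (_ : 9 * B ^+ 4 * M = 3 * B ^+ 4 * (M + M + M)); last by ring.
  by rewrite ler_wpM2l ?mulr_ge0 ?exprn_ge0// !lerD.
apply: le_Ex; [by bmt..|] => s.
have d1 i : 0 <= deg ka1 s i by exact: deg_ge0 pK1.
have d2 i : 0 <= deg ka2 s i by exact: deg_ge0 pK2.
pose x1 := deg ka1 s t * deg ka2 s t.
pose x2 := \sum_(i < n) ka1 (tnth s i) (tnth s t) * deg ka2 s i.
pose x3 := \sum_(i < n) ka2 (tnth s i) (tnth s t) * deg ka1 s i.
have x10 : 0 <= x1 by rewrite mulr_ge0.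
have x20 : 0 <= x2 by apply: sumr_ge0 => i _; rewrite mulr_ge0 ?normr_ge0.
have x30 : 0 <= x3 by apply: sumr_ge0 => i _; rewrite mulr_ge0 ?normr_ge0.
have h1 : x1 ^+ 2 <= W ka1 ka2 false s.
  rewrite /x1 /deg mulr_suml.
  apply: CS_sum => i; exact: normr_ge0.
have h2 : x2 ^+ 2 <= W ka1 ka2 true s by apply: CS_sum => i; exact: normr_ge0.
have h3 : x3 ^+ 2 <= W ka2 ka1 true s by apply: CS_sum => i; exact: normr_ge0.
have key : `|U3 K1 K2 s - g t s| <= B ^+ 2 * (x1 + x2 + x3).
  have -> : U3 K1 K2 s - g t s =
    \sum_(a < n) \sum_(b < n) A (tnth s a) * K1 (tnth s a) (tnth s t) *
       (Y (tnth s b) * K2 (tnth s b) (tnth s t)) +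
    \sum_(i < n | i != t) (\sum_(b < n) A (tnth s t) * K1 (tnth s t) (tnth s i) *
         (Y (tnth s b) * K2 (tnth s b) (tnth s i)) +
      \sum_(a < n | a != t) A (tnth s a) * K1 (tnth s a) (tnth s i) *
         (Y (tnth s t) * K2 (tnth s t) (tnth s i))).
    rewrite /U3 (bigD1 t)//= -addrA; congr (_ + _).
    rewrite -sumrB; apply: eq_bigr => i it.
    rewrite (bigD1 t)//= -addrA; congr (_ + _); rewrite -sumrB.
    by apply: eq_bigr => a at_; rewrite (bigD1 t)//= addrK.
  rewrite mulrDr mulrDr -addrA; apply: (le_trans (ler_normD _ _)); apply: lerD.
    rewrite /x1 {1}/deg mulr_suml; apply: sum2_norm; first exact: sqr_ge0.
    move=> a; rewrite /deg mulr_sumr; apply: sum2_norm; first exact: sqr_ge0.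
    by move=> b; exact: norm_trilin.
  rewrite big_split /=; apply: (le_trans (ler_normD _ _)); apply: lerD.
    rewrite big_mkcond; apply: sum2_norm; first exact: sqr_ge0.
    move=> i; case: ifP => _; last by rewrite normr0 !mulr_ge0 ?sqr_ge0 ?normr_ge0.
    rewrite /deg mulr_sumr; apply: sum2_norm; first exact: sqr_ge0.
    by move=> b; rewrite /ka1 (sK1 (tnth s i)); exact: norm_trilin.
  rewrite big_mkcond; apply: sum2_norm; first exact: sqr_ge0.
  move=> i; case: ifP => _; last by rewrite normr0 !mulr_ge0 ?sqr_ge0 ?normr_ge0.
  rewrite /deg mulr_sumr big_mkcond; apply: sum2_norm; first exact: sqr_ge0.
  move=> a; case: ifP => _; last by rewrite normr0 !mulr_ge0 ?sqr_ge0 ?normr_ge0.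
  by rewrite /ka2 (sK2 (tnth s i)) [X in _ <= _ * X]mulrC; exact: norm_trilin.
apply: (@le_trans _ _ ((B ^+ 2 * (x1 + x2 + x3)) ^+ 2)).
  by rewrite -real_normK ?num_real// lerXn2r ?nnegrE// !mulr_ge0 ?sqr_ge0 ?addr_ge0.
apply: (@le_trans _ _ (3 * B ^+ 4 * (x1 ^+ 2 + x2 ^+ 2 + x3 ^+ 2))); last first.
  by rewrite ler_wpM2l ?mulr_ge0 ?exprn_ge0// !lerD.
rewrite -subr_ge0 (_ : _ - _ = B ^+ 4 * ((x1 - x2) ^+ 2 + (x2 - x3) ^+ 2 + (x1 - x3) ^+ 2)).
  by rewrite mulr_ge0 ?exprn_ge0// !addr_ge0 ?sqr_ge0.
ring.
Qed.

End vstat_variance.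

(** * Means of the V-statistics *)

Section vstat_mean.
Context {dd} {T : measurableType dd} {R : realType} (P : probability T R).
Variables (A Y : T -> R).
Hypotheses (bA : bm A) (bY : bm Y).

Lemma sum_delta n (i : 'I_n) (x y : R) :
  \sum_(b < n) (if b == i then x else y) = n%:R * y + (x - y).
Proof.
rewrite (eq_bigr (fun b => y + (if b == i then x - y else 0))); last first.
  by move=> b _; case: (b == i); ring.
by rewrite big_split /= sumr_const card_ord mulr_natl -big_mkcond big_pred1_eq.
Qed.

Lemma sum_delta2 n (i a : 'I_n) (x y z : R) : a != i ->
  \sum_(b < n) (if b == i then x else if b == a then y else z) =
  n%:R * z + (x - z) + (y - z).
Proof.
move=> ai.
rewrite (eq_bigr (fun b => (if b == i then x - z else 0) + (if b == a then y else z))).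
  by rewrite big_split /= !sum_delta; ring.
move=> b _; have [->|] := eqVneq b i; last by rewrite add0r.
by rewrite eq_sym (negPf ai); ring.
Qed.

Lemma Ex_U1 n : Ex (iid P n) (U1 A Y) = n%:R * Ex P (fun o => A o * Y o).
Proof.
rewrite /U1 Ex_sum; last by move=> i; apply: bmM; exact: bm_tnth.
rewrite (eq_bigr (fun=> Ex P (fun o => A o * Y o))); last first.
  by move=> i _; exact: (Ex_coord1 P i (bmM bA bY)).
by rewrite sumr_const card_ord mulr_natl.
Qed.

Lemma Ex_U2 (K : T -> T -> R) n : bm (fun z => K z.1 z.2) ->
  Ex (iid P n) (U2 A Y K) =
  n%:R * (n%:R - 1) * Ex P (fun x => Ex P (fun y => A x * Y y * K x y)) +
  n%:R * Ex P (fun x => A x * Y x * K x x).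
Proof.
move=> bK.
have bf : bm (fun z => A z.1 * Y z.2 * K z.1 z.2).
  by apply: bmM => //; apply: bmM; [exact: (bm_comp bA)|exact: (bm_comp bY)].
have b1 (a b : 'I_n) : bm (fun s : n.-tuple T =>
    A (tnth s a) * Y (tnth s b) * K (tnth s a) (tnth s b)).
  exact: (@bm_tnth2 _ _ _ _ a b (fun x y => A x * Y y * K x y) bf).
have bd : bm (fun x => A x * Y x * K x x).
  apply: (@bm_comp _ _ _ _ _ _ (fun x => (x, x)) bf); exact: measurable_fun_pair.
rewrite /U2 Ex_sum; last by move=> i; exact: bm_sum.
set e1 := Ex P (fun x => Ex P _); set e2 := Ex P (fun x => _ * K x x).
rewrite (eq_bigr (fun=> n%:R * e1 + (e2 - e1))); last first.
  move=> a _; rewrite Ex_sum// -(sum_delta a); apply: eq_bigr => b _.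
  have [->|ba] := eqVneq b a; first exact: (Ex_coord1 P a bd).
  by apply: (@Ex_coord2 _ _ _ P n a b (fun x y => A x * Y y * K x y)) => //; rewrite eq_sym.
rewrite sumr_const card_ord -[LHS]mulr_natl; ring.
Qed.

(** The five patterns of coincidence of three indices, in the order: all distinct, the
    two arguments equal, the first or the second argument equal to the centre, all
    equal. *)
Lemma Ex_U3 (K1 K2 : T -> T -> R) n : bm (fun z => K1 z.1 z.2) -> bm (fun z => K2 z.1 z.2) ->
  Ex (iid P n) (U3 A Y K1 K2) =
  n%:R * (n%:R - 1) * (n%:R - 2) *
    Ex P (fun z => Ex P (fun x => Ex P (fun y => A x * K1 x z * (Y y * K2 y z)))) +
  n%:R * (n%:R - 1) *
   (Ex P (fun x => Ex P (fun z => A x * K1 x z * (Y x * K2 x z))) +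
    Ex P (fun x => Ex P (fun y => A x * K1 x x * (Y y * K2 y x))) +
    Ex P (fun y => Ex P (fun x => A x * K1 x y * (Y y * K2 y y)))) +
  n%:R * Ex P (fun x => A x * K1 x x * (Y x * K2 x x)).
Proof.
move=> bK1 bK2.
pose f x y z := A x * K1 x z * (Y y * K2 y z).
have bf : bm (fun w => f w.1.2 w.2 w.1.1).
  apply: bmM; apply: bmM.
  - apply: (bm_comp bA); exact: measurableT_comp.
  - apply: (@bm_comp _ _ _ _ _ _ (fun w => (w.1.2, w.1.1)) bK1).
    by apply: measurable_fun_pair; exact: measurableT_comp.
  - exact: (bm_comp bY).
  - apply: (@bm_comp _ _ _ _ _ _ (fun w => (w.2, w.1.1)) bK2).
    by apply: measurable_fun_pair => //; exact: measurableT_comp.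
have bft (i a b : 'I_n) : bm (fun s : n.-tuple T =>
    f (tnth s a) (tnth s b) (tnth s i)).
  exact: (@bm_tnth3 _ _ _ _ i a b (fun z x y => f x y z) bf).
have bsel (h : T * T -> T * T * T) : measurable_fun setT h ->
    bm (fun w => f (h w).1.2 (h w).2 (h w).1.1).
  by move=> mh; exact: (bm_comp bf).
have bxxz : bm (fun w => f w.1 w.1 w.2).
  apply: (bsel (fun w => (w.2, w.1, w.1))).
  by do 2 apply: measurable_fun_pair => //.
have bxyx : bm (fun w => f w.1 w.2 w.1).
  apply: (bsel (fun w => (w.1, w.1, w.2))).
  by do 2 apply: measurable_fun_pair => //.
have bxyy : bm (fun w => f w.2 w.1 w.1).
  apply: (bsel (fun w => (w.1, w.2, w.1))).
  by do 2 apply: measurable_fun_pair => //.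
have bxxx : bm (fun x => f x x x).
  apply: (@bm_comp _ _ _ _ _ _ (fun x => (x, x, x)) bf).
  by do 2 apply: measurable_fun_pair => //.
have {}bft2 (i a : 'I_n) : bm (fun s : n.-tuple T =>
   \sum_(b < n) f (tnth s a) (tnth s b) (tnth s i)) by exact: bm_sum.
rewrite /U3 Ex_sum; last by move=> i; apply: bm_sum => a; exact: bft2.
set e1 := Ex P (fun z => Ex P (fun x => Ex P (fun y => _))).
set e2 := Ex P (fun x => Ex P (fun z => A x * K1 x z * (Y x * K2 x z))).
set e3 := Ex P (fun x => Ex P (fun y => A x * K1 x x * (Y y * K2 y x))).
set e4 := Ex P (fun y => Ex P (fun x => A x * K1 x y * (Y y * K2 y y))).
set e5 := Ex P (fun x => A x * K1 x x * (Y x * K2 x x)).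
pose x1 := n%:R * e3 + (e5 - e3); pose x2 := n%:R * e1 + (e4 - e1) + (e2 - e1).
rewrite (eq_bigr (fun=> n%:R * x2 + (x1 - x2))); last first.
  move=> i _; rewrite Ex_sum; last by move=> a; exact: bft2.
  rewrite -(sum_delta i); apply: eq_bigr => a _.
  rewrite Ex_sum; last by move=> b; exact: bft.
  have [->|ai] := eqVneq a i.
    rewrite /x1 -(sum_delta i); apply: eq_bigr => b _.
    have [->|bi] := eqVneq b i; first exact: (Ex_coord1 P i bxxx).
    by apply: (@Ex_coord2 _ _ _ P n i b (fun x y => f x y x)) => //; rewrite eq_sym.
  rewrite /x2 -(sum_delta2 _ _ _ ai); apply: eq_bigr => b _.
  have [->|bi] := eqVneq b i.
    by apply: (@Ex_coord2 _ _ _ P n i a (fun y x => f x y y)) => //; rewrite eq_sym.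
  have [->|ba] := eqVneq b a.
    by apply: (@Ex_coord2 _ _ _ P n a i (fun x z => f x x z)).
  by apply: (@Ex_coord3 _ _ _ P n i a b (fun z x y => f x y z)) => //; rewrite eq_sym.
rewrite sumr_const card_ord -[LHS]mulr_natl /x1 /x2; ring.
Qed.

End vstat_mean.

(** * The uniform law on the unit interval *)

Section unif1.
Context {R : realType}.

Definition unif1 : probability R R :=
  distribution (uniform_prob (@ltr01 R)) of_measurableTypeR.

Lemma bm_integrable01 (f : R -> R) : bm f ->
  lebesgue_measure.-integrable `[0, 1] (EFin \o f).
Proof.
move=> [mf [C hC]]; apply: measurable_bounded_integrable => //=.
- by rewrite lebesgue_measure_itv /= lte01 sube0 ltry.
- exact: measurable_funTS.
- exists C; split; first exact: num_real.
  by move=> y Cy x _ /=; rewrite (le_trans (hC x))// ltW.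
Qed.

Lemma Ex_unif1 (f : R -> R) : bm f ->
  Ex unif1 f = \int[lebesgue_measure]_(x in `[0, 1]) f x.
Proof.
have ge0 (g : R -> R) : bm g -> (forall x, 0 <= g x) ->
    Ex unif1 g = \int[lebesgue_measure]_(x in `[0, 1]) g x.
  move=> bg g0; rewrite /unif1 Ex_distribution// /Ex /Rintegral.
  rewrite (integral_uniform (@ltr01 R) (f := EFin \o g)).
  - by rewrite subr0 invr1 mul1e.
  - apply/measurable_EFinP.
    exact: (measurableT_comp (bm_meas bg) measurable_of_measurableTypeR).
  - by move=> x; rewrite lee_fin.
move=> bf; have [C C0 hC] := bm_bound bf.
have bfC : bm (fun x => f x + C) by bmt.
have := ge0 _ bfC; rewrite ExD//; last exact: bm_cst.
rewrite Ex_cst RintegralD//; last 2 first.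
- exact: bm_integrable01.
- exact: (@bm_integrable01 (fun=> C) (bm_cst _)).
rewrite Rintegral_cst//= lebesgue_measure_itv /= lte01 sube0 /= mulr1.
move=> h; apply: (addIr C); apply: h => x.
by have := hC x; rewrite ler_norml => /andP[? _]; lra.
Qed.

Lemma eq_Ex_unif1 (f g : R -> R) : bm f -> bm g ->
  (forall x, 0 <= x <= 1 -> f x = g x) -> Ex unif1 f = Ex unif1 g.
Proof.
move=> bf bg fg; rewrite !Ex_unif1//; apply: eq_Rintegral => x.
by rewrite inE/= in_itv/= => /fg.
Qed.

Lemma bm_near (x t : R) : bm (fun y : R => (`|x - y| <= t)%R%:R : R).
Proof.
rewrite (_ : (fun y => _) = \1_(`[x - t, x + t] : set R)).
  by apply: bm_indic; exact: measurable_itv.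
by apply/funext => y; rewrite indicE mem_setE in_itv /= ler_distlC.
Qed.

Lemma Ex_unif1_near (x t : R) : 0 <= t ->
  Ex unif1 (fun y : R => (`|x - y| <= t)%R%:R) <= 2 * t.
Proof.
move=> t0; rewrite Ex_unif1; last exact: bm_near.
pose D : set R := `[x - t, x + t]%classic; pose I : set R := `[0, 1]%classic.
have mD : measurable D by exact: measurable_itv.
have mI : measurable I by exact: measurable_itv.
rewrite (_ : (fun y => _) = \1_D); last first.
  by apply/funext => y; rewrite indicE mem_setE in_itv /= ler_distlC.
rewrite /Rintegral integral_indic//.
have le1 : (lebesgue_measure (D `&` I) <= lebesgue_measure D)%E.
  by apply: le_measure; rewrite ?inE//; exact: measurableI.
have e : lebesgue_measure D = (2 * t)%:E.
  rewrite lebesgue_measure_itv /= lte_fin; case: ifP => h.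
    by rewrite -EFinB; congr EFin; ring.
  by congr EFin; move: h; lra.
rewrite e in le1; rewrite -[leRHS]/(fine (2 * t)%:E) fine_le//.
by rewrite ge0_fin_numE// (le_lt_trans le1)// ltry.
Qed.

End unif1.

(** * Dilates of compactly supported functions *)

Section generators.
Context {R : realType}.
Implicit Types (g : generators R) (G : R -> R).

Definition cbump (C : R) (r : nat) G :=
  [/\ continuous G, (forall x, `|G x| <= C) & (forall x, r%:R < `|x| -> G x = 0)].

Lemma bump_of_support G (r : R) : continuous G -> (forall x, r < `|x| -> G x = 0) ->
  exists C r', 0 <= C /\ cbump C r' G.
Proof.
move=> cG sG; pose r' := (Num.trunc `|r|).+1.
have rr' : r <= r'%:R by rewrite (le_trans (ler_norm r))// ltW// truncnS_gt.
have r'0 : - r'%:R <= r'%:R :> R by rewrite ge0_cp.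
have cn : continuous (fun x => `|G x|) by move=> x; apply: cvg_norm; exact: cG.
have [c _ hc] := @EVT_max R (fun x => `|G x|) (- r'%:R) r'%:R r'0 (continuous_subspaceT cn).
exists `|G c|, r'; split => //; split => //.
  move=> x; have [xr|xr] := ltP r `|x|; first by rewrite sG// normr0.
  by apply: hc; rewrite in_itv/= -ler_norml (le_trans xr).
by move=> x xr; apply: sG; exact: le_lt_trans xr.
Qed.

Lemma bumpW C r G C' r' : C <= C' -> (r <= r')%N -> cbump C r G -> cbump C' r' G.
Proof.
move=> CC rr [cG bG sG]; split => // x; first exact: le_trans CC.
by move=> xr; apply: sG; apply: le_lt_trans xr; rewrite ler_nat.
Qed.

Lemma bump_bm C r G : cbump C r G -> bm G.
Proof. by move=> [cG bG _]; split; [exact: continuous_measurable_fun|exists C]. Qed.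

Lemma bump_family (N : nat) (F : nat -> R -> R) :
  (forall k, (k < N)%N -> exists C r, 0 <= C /\ cbump C r (F k)) ->
  exists C r, 0 <= C /\ forall k, (k < N)%N -> cbump C r (F k).
Proof.
elim: N => [_|N IH h]; first by exists 0, 0%N.
have [|C [r [C0 hC]]] := IH; first by move=> k kN; apply: h; exact: leqW.
have [C' [r' [C'0 hC']]] := h N (ltnSn N).
exists (C + C'), (r + r')%N; split; first exact: addr_ge0.
move=> k; rewrite ltnS leq_eqVlt => /orP[/eqP->|kN].
  by apply: bumpW hC'; rewrite ?lerDr ?leq_addl.
by apply: bumpW (hC k kN); rewrite ?lerDl ?leq_addr.
Qed.

(** Common bounds for the finitely many functions generating the basis. *)
Definition good_gen N C r g :=
  [/\ cbump C r (inner g), (forall k, (k < N)%N -> cbump C r (left_edge g k)) &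
      (forall k, (k < N)%N -> cbump C r (right_edge g k))].

(** Edge functions are attached to the end points 0 and 2^j of the rescaled interval,
    inner ones to their translation parameter; this treats the three kinds alike. *)
Definition centre N j m : nat :=
  if (m < N)%N then 0%N else if (m < 2 ^ j - N)%N then m else (2 ^ j)%N.

Lemma dilateE N C r g j m : good_gen N C r g -> (m < 2 ^ j)%N ->
  exists2 G, cbump C r G &
  forall x, dilate N g j m x = Num.sqrt (2 ^+ j) * G (2 ^+ j * x - (centre N j m)%:R).
Proof.
move=> [hi hl hr] m2; rewrite /dilate /centre.
case: ifPn => mN; first by exists (left_edge g m) => [|x]; [exact: hl|rewrite subr0].
case: ifPn => mi; first by exists (inner g).
exists (right_edge g (2 ^ j - 1 - m)%N) => [|x]; first by apply: hr; lia.
by rewrite mulrBr mulr1 natrX.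
Qed.

Lemma dilate_bm N C r g j m : good_gen N C r g -> (m < 2 ^ j)%N -> bm (dilate N g j m).
Proof.
move=> hg m2; have [G hG GE] := dilateE hg m2; rewrite (funext GE).
apply: bmM; first exact: bm_cst.
apply: (bm_comp (bump_bm hG)).
by apply: measurable_funB => //; exact: measurable_funM.
Qed.

Lemma dilate_le N C r g j m x : good_gen N C r g -> (m < 2 ^ j)%N ->
  `|dilate N g j m x| <= Num.sqrt (2 ^+ j) * C *
     (`|2 ^+ j * x - (centre N j m)%:R| <= r%:R)%R%:R.
Proof.
move=> hg m2; have [G [cG bG sG] ->] := dilateE hg m2.
rewrite normrM ger0_norm ?sqrtr_ge0// -mulrA ler_wpM2l ?sqrtr_ge0//.
by case: (leP `|2 ^+ j * x - (centre N j m)%:R| r%:R) => h; [rewrite mulr1; exact: bG|rewrite sG// normr0 mulr0].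
Qed.

Lemma dilate_continuous N C r g j m : good_gen N C r g -> (m < 2 ^ j)%N ->
  continuous (dilate N g j m).
Proof.
move=> hg m2; have [G [cG _ _] GE] := dilateE hg m2; rewrite (funext GE).
move=> x; apply: cvgMr.
apply: continuous_cvg; first exact: cG.
by apply: cvgB; [apply: cvgMr; exact: cvg_id|exact: cvg_cst].
Qed.

Lemma count_ge (M t : nat) : (\sum_(m < M) (t <= m) = M - t)%N.
Proof.
elim: M => [|M IH]; first by rewrite big_ord0 sub0n.
by rewrite big_ord_recr /= IH; case: leqP => h /=; lia.
Qed.

Lemma count_lt (M t : nat) : (\sum_(m < M) (m < t) <= t)%N.
Proof.
suff -> : (\sum_(m < M) (m < t) = minn M t)%N by exact: geq_minr.
elim: M => [|M IH]; first by rewrite big_ord0 min0n.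
by rewrite big_ord_recr /= IH; case: ltnP => h /=; lia.
Qed.

Lemma count_near (M r : nat) (y : R) :
  (\sum_(m < M) (`|y - m%:R| <= r%:R)%R <= 2 * r + 1)%N.
Proof.
elim: M => [|M IH]; first by rewrite big_ord0.
rewrite big_ord_recr /=; have [h|h] := leP `|y - M%:R| r%:R; last by rewrite addn0.
apply: (@leq_trans (\sum_(m < M) (M - 2 * r <= m)%N + 1)); last first.
  by rewrite count_ge; lia.
rewrite leq_add2r; apply: leq_sum => m _.
have [h'|//] := leP `|y - m%:R| r%:R.
suff -> : (M - 2 * r <= m)%N by [].
rewrite leq_subLR -(ler_nat R) natrD natrM.
by move: h h'; rewrite !ler_norml => /andP[? ?] /andP[? ?]; lra.
Qed.

(** At most 2 N edge functions and 2 r + 1 inner ones live near a given point. *)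
Lemma count_centre N j r (y : R) :
  \sum_(m < 2 ^ j) (`|y - (centre N j m)%:R| <= r%:R)%R%:R <= (2 * N + 2 * r + 1)%:R :> R.
Proof.
rewrite -natr_sum ler_nat.
apply: (@leq_trans (\sum_(m < 2 ^ j) ((m < N) + (2 ^ j - N <= m) +
   (`|y - m%:R| <= r%:R)%R))%N).
  apply: leq_sum => m _; rewrite /centre.
  case: ltnP => _ /=; first by apply: (leq_trans (leq_b1 _)); rewrite -addnA leq_addr.
  case: ltnP => _ /=; first by rewrite leq_addl.
  by apply: (leq_trans (leq_b1 _)); rewrite addnAC leq_addl.
rewrite !big_split /= count_ge.
apply: (leq_trans (leq_add (leq_add (count_lt _ N) (leqnn _)) (count_near _ r y))).
by have := leq_subr N (2 ^ j); lia.
Qed.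

Lemma dilate_sum N C r g j x : 0 <= C -> good_gen N C r g ->
  \sum_(m < 2 ^ j) `|dilate N g j m x| <=
  C * (2 * N + 2 * r + 1)%:R * Num.sqrt (2 ^+ j).
Proof.
move=> C0 hg.
apply: (@le_trans _ _ (\sum_(m < 2 ^ j) Num.sqrt (2 ^+ j) * C *
     (`|2 ^+ j * x - (centre N j m)%:R| <= r%:R)%R%:R)).
  by apply: ler_sum => m _; exact: dilate_le.
rewrite -mulr_sumr [leRHS](_ : _ = Num.sqrt (2 ^+ j) * C * (2 * N + 2 * r + 1)%:R).
  by rewrite ler_wpM2l ?mulr_ge0 ?sqrtr_ge0//; exact: count_centre.
ring.
Qed.

(** The integral kernel of the projection on the span of an orthonormal level-j
    family. *)
Definition ker1 N g j (x y : R) : R := \sum_(m < 2 ^ j) dilate N g j m x * dilate N g j m y.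

Lemma ker1_le N C r g j x y : 0 <= C -> good_gen N C r g ->
  `|ker1 N g j x y| <= C ^+ 2 * (2 * N + 2 * r + 1)%:R * 2 ^+ j.
Proof.
move=> C0 hg.
apply: (le_trans (ler_norm_sum _ _ _)).
apply: (@le_trans _ _ (\sum_(m < 2 ^ j) `|dilate N g j m x| * (Num.sqrt (2 ^+ j) * C))).
  apply: ler_sum => m _; rewrite normrM ler_wpM2l//.
  apply: (le_trans (dilate_le y hg (ltn_ord m))).
  by rewrite -[leRHS]mulr1 ler_wpM2l ?mulr_ge0 ?sqrtr_ge0// lern1 leq_b1.
rewrite -mulr_suml.
apply: (@le_trans _ _ (C * (2 * N + 2 * r + 1)%:R * Num.sqrt (2 ^+ j) *
   (Num.sqrt (2 ^+ j) * C))).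
  by rewrite ler_wpM2r ?mulr_ge0 ?sqrtr_ge0//; exact: dilate_sum.
rewrite le_eqVlt; apply/orP; left; apply/eqP.
rewrite -[in RHS](@sqr_sqrtr _ (2 ^+ j)) ?exprn_ge0//; ring.
Qed.

Lemma ker1_near N C r g j x y : good_gen N C r g ->
  (2 * r)%:R / 2 ^+ j < `|x - y| -> ker1 N g j x y = 0.
Proof.
move=> hg; rewrite ltr_pdivrMr ?exprn_gt0// => h.
rewrite /ker1 big1// => m _.
have [h1|h1] := leP `|2 ^+ j * x - (centre N j m)%:R| r%:R; last first.
  have := dilate_le x hg (ltn_ord m); rewrite (lt_geF h1) mulr0 normr_le0 => /eqP ->.
  by rewrite mul0r.
have [h2|h2] := leP `|2 ^+ j * y - (centre N j m)%:R| r%:R; last first.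
  have := dilate_le y hg (ltn_ord m); rewrite (lt_geF h2) mulr0 normr_le0 => /eqP ->.
  by rewrite mulr0.
exfalso; move: h; rewrite ltNge => /negP; apply.
rewrite -[X in _ * X](@ger0_norm _ (2 ^+ j)) ?exprn_ge0// -normrM natrM.
move: h1 h2; rewrite !ler_norml => /andP[? ?] /andP[? ?]; apply/andP; split; lra.
Qed.

Lemma ker1_sym N g j x y : ker1 N g j x y = ker1 N g j y x.
Proof. by apply: eq_bigr => m _; rewrite mulrC. Qed.

End generators.

(** * The one-dimensional wavelet basis *)

Section wavelets1.
Context {R : realType} {J0 S : nat} (w : cdv_basis R J0 S).
Hypothesis S_ge1 : (1 <= S)%N.
Local Notation N := (cdv_N w).
Local Notation phi := (cdv_phi w).
Local Notation psi := (cdv_psi w).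
Local Notation kphi := (ker1 N phi).
Local Notation kpsi := (ker1 N psi).

Lemma class_C_continuous (f : R -> R) : class_C S f -> continuous f.
Proof.
move=> [df _] x; have := df 0%N S_ge1 x => /= dfx.
by apply: differentiable_continuous; exact/derivable1_diffP.
Qed.

(** Regularity at least one gives continuity, and with compact supports boundedness. *)
Lemma gens_good : exists (C : R) (r : nat), [/\ 0 <= C, good_gen N C r phi & good_gen N C r psi].
Proof.
have one g : g = phi \/ g = psi -> exists (C : R) (r : nat), 0 <= C /\ good_gen N C r g.
  move=> hg; have [rho hrho] := cdv_edge_support hg.
  have [C1 [r1 [C10 h1]]] : exists (C : R) (r : nat), 0 <= C /\ cbump C r (inner g).
    apply: (@bump_of_support _ _ N%:R).
      exact/class_C_continuous/(cdv_inner_smooth hg).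
    move=> x Nx; apply: (cdv_inner_support hg).
    apply: contraTN Nx => /andP[h1 h2]; rewrite -leNgt ler_norml h2 andbT.
    by apply: le_trans h1; lra.
  have [C2 [r2 [C20 h2]]] : exists (C : R) (r : nat), 0 <= C /\ forall k, (k < N)%N -> cbump C r (left_edge g k).
    apply: bump_family => k kN; apply: (@bump_of_support _ _ rho).
      exact/class_C_continuous/(cdv_edge_smooth hg kN).1.
    by move=> x /(hrho k x kN)[].
  have [C3 [r3 [C30 h3]]] : exists (C : R) (r : nat), 0 <= C /\ forall k, (k < N)%N -> cbump C r (right_edge g k).
    apply: bump_family => k kN; apply: (@bump_of_support _ _ rho).
      exact/class_C_continuous/(cdv_edge_smooth hg kN).2.
    by move=> x /(hrho k x kN)[].
  exists (C1 + C2 + C3), (r1 + r2 + r3)%N; split; first by rewrite !addr_ge0.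
  split=> [|k kN|k kN].
  - by apply: bumpW h1; [lra|lia].
  - by apply: bumpW (h2 k kN); [lra|lia].
  - by apply: bumpW (h3 k kN); [lra|lia].
have [C [r [C0 [h1 h2 h3]]]] := one phi (or_introl erefl).
have [C' [r' [C'0 [h1' h2' h3']]]] := one psi (or_intror erefl).
exists (C + C'), (r + r')%N; split; first exact: addr_ge0.
- split=> [|k kN|k kN].
  + by apply: bumpW h1; [lra|lia].
  + by apply: bumpW (h2 k kN); [lra|lia].
  + by apply: bumpW (h3 k kN); [lra|lia].
- split=> [|k kN|k kN].
  + by apply: bumpW h1'; [lra|lia].
  + by apply: bumpW (h2' k kN); [lra|lia].
  + by apply: bumpW (h3' k kN); [lra|lia].
Qed.

Definition is_gen g := g = phi \/ g = psi.

Lemma bm_dil g j (m : 'I_(2 ^ j)) : is_gen g -> bm (dilate N g j m).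
Proof.
have [C [r [_ hphi hpsi]]] := gens_good.
by case=> ->; [exact: dilate_bm hphi _|exact: dilate_bm hpsi _].
Qed.

Lemma bm_phi j (m : 'I_(2 ^ j)) : bm (dilate N phi j m).
Proof. by apply: bm_dil; left. Qed.

Lemma bm_psi j (m : 'I_(2 ^ j)) : bm (dilate N psi j m).
Proof. by apply: bm_dil; right. Qed.

Lemma inner01E (f g : R -> R) : bm f -> bm g -> inner01 f g = Ex unif1 (fun x => f x * g x).
Proof. by move=> bf bg; rewrite Ex_unif1//; exact: bmM. Qed.

Lemma orth_phi j (m m' : 'I_(2 ^ j)) : (J0 <= j)%N ->
  Ex unif1 (fun x => dilate N phi j m x * dilate N phi j m' x) = (m == m')%:R.
Proof. by move=> jJ; rewrite -inner01E ?cdv_orthonormal_phi//; exact: bm_phi. Qed.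

Lemma orth_psi j (m m' : 'I_(2 ^ j)) : (J0 <= j)%N ->
  Ex unif1 (fun x => dilate N psi j m x * dilate N psi j m' x) = (m == m')%:R.
Proof. by move=> jJ; rewrite -inner01E ?cdv_orthonormal_psi//; exact: bm_psi. Qed.

Lemma orth_phi_psi j (m m' : 'I_(2 ^ j)) : (J0 <= j)%N ->
  Ex unif1 (fun x => dilate N phi j m x * dilate N psi j m' x) = 0.
Proof.
move=> jJ; rewrite -inner01E ?cdv_orthogonal//; [exact: bm_phi|exact: bm_psi].
Qed.

Lemma Ex_coords j (c c' : 'I_(2 ^ j) -> R) (f f' : R -> R) : (J0 <= j)%N ->
  bm f -> bm f' ->
  (forall x, 0 <= x <= 1 -> f x = \sum_m c m * dilate N phi j m x) ->
  (forall x, 0 <= x <= 1 -> f' x = \sum_m c' m * dilate N phi j m x) ->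
  Ex unif1 (fun x => f x * f' x) = \sum_m c m * c' m.
Proof.
move=> jJ bf bf' fE f'E; have bp := @bm_phi j.
rewrite (@eq_Ex_unif1 _ _ (fun x => \sum_m \sum_m' (c m * c' m') *
   (dilate N phi j m x * dilate N phi j m' x))); last 3 first.
- by bmt.
- by do 2 apply: bm_sum => ?; bmt.
- move=> x x01; rewrite fE// f'E// mulr_suml; apply: eq_bigr => m _.
  by rewrite mulr_sumr; apply: eq_bigr => m' _; ring.
rewrite Ex_sum; last by move=> m; bmt.
apply: eq_bigr => m _; rewrite Ex_sum; last by move=> m'; bmt.
rewrite (bigD1 m)//= big1 ?addr0.
  by rewrite ExZl ?orth_phi ?eqxx ?mulr1//; bmt.
move=> m' mm'; rewrite ExZl ?orth_phi//; last by bmt.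
by rewrite eq_sym (negPf mm') mulr0.
Qed.

Lemma orthogonal_square (m n : nat) (A : 'M[R]_(m, n)) : m = n ->
  A *m A^T = 1%:M -> A^T *m A = 1%:M.
Proof. by move=> mn; subst n; exact: mulmx1C. Qed.

(** In coordinates on V_(j+1), the level-j scaling functions and wavelets are the rows
    of a matrix A with A A^T = 1.  There are 2^(j+1) of them, so A is square and
    A^T A = 1: together they are an orthonormal basis of V_(j+1), and the kernels add
    up. *)
Lemma ker1_split j x y : (J0 <= j)%N -> 0 <= x <= 1 -> 0 <= y <= 1 ->
  kphi j.+1 x y = kphi j x y + kpsi j x y.
Proof.
move=> jJ x01 y01; have jJ1 : (J0 <= j.+1)%N by exact: leqW.
have [a aE] := choice (fun m : 'I_(2 ^ j) => cdv_nested w m jJ).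
have [b bE] := choice (fun m : 'I_(2 ^ j) => cdv_detail w m jJ).
pose A : 'M[R]_(2 ^ j + 2 ^ j, 2 ^ j.+1) :=
  col_mx (\matrix_(m, k) a m k) (\matrix_(m, k) b m k).
have dim : (2 ^ j + 2 ^ j = 2 ^ j.+1)%N by rewrite expnS mul2n addnn.
have AAT : A *m A^T = 1%:M.
  rewrite tr_col_mx mul_col_row scalar_mx_block; congr block_mx.
  - apply/matrixP => m m'; rewrite !mxE -orth_phi//.
    rewrite (@Ex_coords _ _ _ _ _ jJ1 (bm_phi m) (bm_phi m') (aE m) (aE m')).
    by apply: eq_bigr => k _; rewrite !mxE.
  - apply/matrixP => m m'; rewrite !mxE -[RHS](orth_phi_psi m m' jJ).
    rewrite (@Ex_coords _ _ _ _ _ jJ1 (bm_phi m) (bm_psi m') (aE m) (bE m')).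
    by apply: eq_bigr => k _; rewrite !mxE.
  - apply/matrixP => m m'; rewrite !mxE -[RHS](orth_phi_psi m' m jJ).
    rewrite (@Ex_coords _ _ _ _ _ jJ1 (bm_phi m') (bm_psi m) (aE m') (bE m)).
    by apply: eq_bigr => k _; rewrite !mxE mulrC.
  - apply/matrixP => m m'; rewrite !mxE -orth_psi//.
    rewrite (@Ex_coords _ _ _ _ _ jJ1 (bm_psi m) (bm_psi m') (bE m) (bE m')).
    by apply: eq_bigr => k _; rewrite !mxE.
have := orthogonal_square dim AAT.
rewrite tr_col_mx mul_row_col => /matrixP ATA.
have abE k k' : \sum_m a m k * a m k' + \sum_m b m k * b m k' = (k == k')%:R.
  have := ATA k k'; rewrite !mxE => <-; congr (_ + _);
    by apply: eq_bigr => m _; rewrite !mxE.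
have expand (c : 'I_(2 ^ j) -> 'I_(2 ^ j.+1) -> R) :
  \sum_m (\sum_k c m k * dilate N phi j.+1 k x) * (\sum_k c m k * dilate N phi j.+1 k y) =
  \sum_k \sum_k' (\sum_m c m k * c m k') * (dilate N phi j.+1 k x * dilate N phi j.+1 k' y).
  under eq_bigr do rewrite mulr_suml.
  rewrite exchange_big; apply: eq_bigr => k _.
  under eq_bigr do rewrite mulr_sumr.
  rewrite exchange_big; apply: eq_bigr => k' _; rewrite mulr_suml.
  by apply: eq_bigr => m _; ring.
rewrite /ker1 [X in _ = X + _](eq_bigr (fun m => (\sum_k a m k * dilate N phi j.+1 k x) *
   (\sum_k a m k * dilate N phi j.+1 k y))); last first.
  by move=> m _; rewrite -aE// -aE.
rewrite expand.
rewrite [X in _ = _ + X](eq_bigr (fun m => (\sum_k b m k * dilate N phi j.+1 k x) *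
   (\sum_k b m k * dilate N phi j.+1 k y))); last first.
  by move=> m _; rewrite -bE// -bE.
rewrite expand -big_split; apply: eq_bigr => k _ /=.
rewrite -big_split /= (bigD1 k)//= -mulrDl abE eqxx mul1r big1 ?addr0//.
by move=> k' kk'; rewrite -mulrDl abE eq_sym (negPf kk') mul0r.
Qed.

Lemma in_V1_mono j j' f : (J0 <= j)%N -> (j <= j')%N -> in_V1 N phi j f -> in_V1 N phi j' f.
Proof.
move=> jJ; elim: j' => [|j' IH]; first by rewrite leqn0 => /eqP ->.
rewrite leq_eqVlt => /orP[/eqP<-//|]; rewrite ltnS => jj' /(IH jj')[c fE].
have [a aE] := choice (fun m : 'I_(2 ^ j') => cdv_nested w m (leq_trans jJ jj')).
exists (fun k => \sum_m c m * a m k) => x x01; rewrite fE//.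
under eq_bigr do rewrite aE// mulr_sumr.
rewrite exchange_big; apply: eq_bigr => k _; rewrite mulr_suml.
by apply: eq_bigr => m _; rewrite mulrA.
Qed.

Lemma in_V1_phi j (m : 'I_(2 ^ j)) : in_V1 N phi j (dilate N phi j m).
Proof.
exists (fun m' => (m' == m)%:R) => x _; rewrite (bigD1 m)//= eqxx mul1r big1 ?addr0//.
by move=> m' /negPf ->; rewrite mul0r.
Qed.

Lemma bm_kphi j x : bm (fun y => kphi j x y).
Proof. by have bp := @bm_phi j; apply: bm_sum => m; bmt. Qed.

Lemma ker1_repro_V1 j f x : (J0 <= j)%N -> bm f -> in_V1 N phi j f -> 0 <= x <= 1 ->
  Ex unif1 (fun u => kphi j x u * f u) = f x.
Proof.
move=> jJ bf [c fE] x01; have bp := @bm_phi j.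
rewrite (@Ex_coords j (fun m => dilate N phi j m x) c)//.
- by rewrite fE//; apply: eq_bigr => m _; rewrite mulrC.
- exact: bm_kphi.
Qed.

Lemma ker1_repro j1 j2 x y : (J0 <= j1)%N -> (j1 <= j2)%N -> 0 <= x <= 1 ->
  Ex unif1 (fun u => kphi j2 x u * kphi j1 u y) = kphi j1 x y.
Proof.
move=> j1J j12 x01; have j2J := leq_trans j1J j12.
have bp := @bm_phi j1; have bk := @bm_kphi j2.
rewrite (eq_Ex (fun u => \sum_(m < 2 ^ j1)
   (kphi j2 x u * dilate N phi j1 m u) * dilate N phi j1 m y)); last first.
  by move=> u; rewrite /ker1 mulr_sumr; apply: eq_bigr => m _; ring.
rewrite Ex_sum; last by move=> m; bmt.
apply: eq_bigr => m _; rewrite ExZr; last by bmt.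
rewrite ker1_repro_V1//; apply: in_V1_mono j12 _ => //; exact: in_V1_phi.
Qed.

(** Constants belong to V_j, by polynomial reproduction. *)
Lemma ker1_mass j x : (J0 <= j)%N -> 0 <= x <= 1 -> Ex unif1 (fun u => kphi j x u) = 1.
Proof.
move=> jJ x01; rewrite (eq_Ex (fun u => kphi j x u * 1)); last by move=> u; rewrite mulr1.
apply: (@ker1_repro_V1 j (fun=> 1)) => //; first exact: bm_cst.
have [c cE] := cdv_polynomials w jJ S_ge1.
by exists c => y y01; rewrite -cE.
Qed.

Lemma ker1_trace j : (J0 <= j)%N -> Ex unif1 (fun u => kphi j u u) = 2 ^+ j.
Proof.
move=> jJ; have bp := @bm_phi j; rewrite Ex_sum; last by move=> m; bmt.
rewrite (eq_bigr (fun=> 1)); last by move=> m _; rewrite orth_phi// eqxx.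
by rewrite sumr_const card_ord natrX.
Qed.

Lemma psi_orth_V1 j l (m : 'I_(2 ^ l)) f : (J0 <= j)%N -> (j <= l)%N -> bm f ->
  in_V1 N phi j f -> Ex unif1 (fun x => f x * dilate N psi l m x) = 0.
Proof.
move=> jJ jl bf /(in_V1_mono jJ jl)[c fE]; have lJ := leq_trans jJ jl.
have bp := @bm_phi l; have bq := @bm_psi l.
rewrite (@eq_Ex_unif1 _ _ (fun x => \sum_m' c m' *
   (dilate N phi l m' x * dilate N psi l m x))); last 3 first.
- by bmt.
- by apply: bm_sum => ?; bmt.
- by move=> x x01; rewrite fE// mulr_suml; apply: eq_bigr => m' _; rewrite mulrA.
rewrite Ex_sum; last by move=> ?; bmt.
rewrite big1// => m' _; rewrite ExZl; last by bmt.
by rewrite orth_phi_psi// mulr0.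
Qed.

Lemma psi_orth_lower g l l' (m : 'I_(2 ^ l)) (m' : 'I_(2 ^ l')) : is_gen g ->
  (J0 <= l)%N -> (l < l')%N ->
  Ex unif1 (fun x => dilate N g l m x * dilate N psi l' m' x) = 0.
Proof.
move=> hg lJ ll'; apply: (@psi_orth_V1 l.+1) => //; first exact: leqW.
  exact: bm_dil.
by case: hg => ->; [exact: cdv_nested|exact: cdv_detail].
Qed.

(** Without edge functions, the inner generator would be supported in the empty interval
    [1, 0], and could not be normalised. *)
Lemma cdv_N_gt0 : (0 < N)%N.
Proof.
rewrite lt0n; apply/eqP => N0.
have m0 : (0 < 2 ^ J0)%N by rewrite expn_gt0.
have := orth_phi (Ordinal m0) (Ordinal m0) (leqnn _); rewrite eqxx.
rewrite (eq_Ex (fun=> 0)); first by rewrite Ex_cst => /eqP; rewrite eq_sym oner_eq0.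
move=> x; rewrite /dilate N0 ltn0 subn0 ltn_ord.
rewrite (cdv_inner_support (c := w) (or_introl erefl)) ?mulr0 ?mul0r//.
rewrite N0 subr0; apply/negP => /andP[h1 h2].
by have := le_trans h1 h2; rewrite leNgt ltr01.
Qed.

(** In positive dimension the resolutions are thus at least 2, on which the lower bound for
    the Monte Carlo estimator depends. *)
Lemma J0_gt0 : (0 < J0)%N.
Proof.
have := cdv_room w; have := cdv_N_gt0; move: (N) => n.
by case: (J0) => //; rewrite expn0; lia.
Qed.

End wavelets1.

(** * The tensor-product basis of the cube *)

Section unif_cube.
Context {R : realType}.

Lemma unifE d : unif d = iid (@unif1 R) d.
Proof. by []. Qed.

Lemma Ex_unif_prod d (f : 'I_d -> R -> R) : (forall i, bm (f i)) ->
  Ex (unif d) (fun x => \prod_(i < d) f i (tnth x i)) = \prod_(i < d) Ex unif1 (f i).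
Proof.
rewrite unifE; elim: d f => [|d IH] f bf.
  rewrite Ex_iid0 ?big_ord0//.
  by apply: bm_prod => -[].
rewrite Ex_iidS; last by apply: bm_prod => i; exact: bm_tnth.
rewrite big_ord_recl -IH// -ExZr//; apply: eq_Ex => x.
rewrite -ExZl; last by apply: bm_prod => i; exact: bm_tnth.
apply: eq_Ex => s; rewrite big_ord_recl tnth_tcons0; congr (_ * _).
by apply: eq_bigr => i _; rewrite tnth_tconsS.
Qed.

Lemma eq_Ex_cube d (f g : d.-tuple R -> R) : bm f -> bm g ->
  (forall x, cube x -> f x = g x) -> Ex (unif d) f = Ex (unif d) g.
Proof.
rewrite unifE; elim: d f g => [|d IH] f g bf bg fg.
  by rewrite !Ex_iid0//; apply: fg => -[].
have bft := bm_tcons bf; have bgt := bm_tcons bg.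
rewrite (Ex_iidS _ bf) (Ex_iidS _ bg); apply: eq_Ex_unif1.
- exact: (bm_Ex2 unif1 (iid unif1 d) bft).
- exact: (bm_Ex2 unif1 (iid unif1 d) bgt).
move=> x x01; apply: IH; [exact: (bm_slice1 x bft)|exact: (bm_slice1 x bgt)|].
move=> s cs; apply: fg => i; case: (unliftP ord0 i) => [j ->|->].
  by rewrite tnth_tconsS; exact: cs.
by rewrite tnth_tcons0.
Qed.

Lemma measurable_cube d : measurable (@cube R d).
Proof.
rewrite (_ : @cube R d =
    \bigcap_(i in [set: 'I_d]) ((fun x : d.-tuple R => tnth x i) @^-1` `[0, 1]%classic)).
  apply: fin_bigcap_measurable => // i _; rewrite -[X in measurable X]setTI.
  by apply: measurable_tnth => //; exact: measurable_itv.
apply/seteqP; split => x /=.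
  by move=> cx i _ /=; rewrite in_itv/=; exact: cx.
by move=> cx i; have := cx i I; rewrite /= in_itv.
Qed.

Lemma Rintegral_cube d (f : d.-tuple R -> R) : bm f ->
  \int[unif d]_(x in @cube R d) f x = Ex (unif d) f.
Proof.
move=> bf; rewrite Rintegral_mkcond.
rewrite [LHS](@eq_Ex_cube _ (f \_ (@cube R d)) f)//; last first.
  by move=> x cx; rewrite patchE mem_set.
rewrite (_ : _ \_ _ = fun x => f x * \1_(@cube R d) x); last first.
  by apply/funext => x; rewrite patchE indicE; case: ifP => _; rewrite ?mulr1 ?mulr0.
by apply: bmM => //; apply: bm_indic; exact: measurable_cube.
Qed.

End unif_cube.

Section tensor_wavelets.
Context {R : realType} {J0 S : nat} (w : cdv_basis R J0 S).
Hypothesis S_ge1 : (1 <= S)%N.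
Local Notation N := (cdv_N w).
Local Notation kphi := (ker1 N (cdv_phi w)).
Local Notation gen iota i := (if iota i then cdv_psi w else cdv_phi w).

(** The sup bound and the localisation of the kernel give its L1 bound: it vanishes
    outside an interval of length O(2^-j). *)
Lemma kernel_consts : exists2 c : R, 1 <= c & forall j,
  [/\ forall x y, `|kphi j x y| <= c * 2 ^+ j,
      forall x, Ex unif1 (fun y => `|kphi j x y|) <= c,
      forall x y, c / 2 ^+ j < `|x - y| -> kphi j x y = 0 &
      forall g x, is_gen w g ->
        \sum_(m < 2 ^ j) `|dilate N g j m x| <= c * Num.sqrt (2 ^+ j)].
Proof.
have [C [r [C0 hphi hpsi]]] := gens_good w S_ge1.
pose D : R := (2 * N + 2 * r + 1)%:R; have D0 : 0 <= D by [].
pose C1 := C ^+ 2 * D; have C10 : 0 <= C1 by rewrite mulr_ge0 ?sqr_ge0.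
have r0 : 0 <= r%:R :> R by [].
pose c := 1 + C1 + 4 * r%:R * C1 + (2 * r)%:R + C * D.
have CD0 : 0 <= C * D by rewrite mulr_ge0.
have rC0 : 0 <= r%:R * C1 by rewrite mulr_ge0.
have r20 : 0 <= (2 * r)%:R :> R by [].
exists c; first by rewrite /c; lra.
move=> j; have p0 : 0 < 2 ^+ j :> R by rewrite exprn_gt0.
have p0' := ltW p0.
have le1 x y : `|kphi j x y| <= C1 * 2 ^+ j by exact: ker1_le.
split => [x y|x|x y xy|g x hg].
- by apply: (le_trans (le1 x y)); rewrite ler_wpM2r// /c; lra.
- have t0 : 0 <= (2 * r)%:R / 2 ^+ j :> R by rewrite divr_ge0.
  apply: (@le_trans _ _ (Ex unif1 (fun y => (C1 * 2 ^+ j) *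
     (`|x - y| <= (2 * r)%:R / 2 ^+ j)%R%:R))).
    apply: le_Ex.
    + by apply: bm_norm; exact: bm_kphi.
    + by apply: bmM; [exact: bm_cst|exact: bm_near].
    move=> y; case: (leP `|x - y| ((2 * r)%:R / 2 ^+ j)) => h.
      by rewrite mulr1; exact: le1.
    by rewrite (ker1_near hphi h) normr0 mulr0.
  rewrite ExZl; last exact: bm_near.
  apply: (@le_trans _ _ ((C1 * 2 ^+ j) * (2 * ((2 * r)%:R / 2 ^+ j)))).
    by rewrite ler_wpM2l ?mulr_ge0//; exact: Ex_unif1_near.
  rewrite [leLHS](_ : _ = 4 * r%:R * C1); first by rewrite /c; lra.
  by rewrite natrM; field; rewrite gt_eqF.
- apply: (ker1_near hphi); apply: le_lt_trans xy.
  by rewrite ler_wpM2r ?invr_ge0// /c; lra.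
- have hgg : good_gen N C r g by case: hg => ->.
  apply: (le_trans (dilate_sum _ _ C0 hgg)); rewrite ler_wpM2r ?sqrtr_ge0//.
  by rewrite /c /D in CD0 *; lra.
Qed.

Lemma sqrt_exprn (a : R) n : 0 <= a -> Num.sqrt (a ^+ n) = Num.sqrt a ^+ n.
Proof.
by move=> a0; elim: n => [|n IH]; [rewrite !expr0 sqrtr1|rewrite !exprS sqrtrM// IH].
Qed.

Section dim_d.
Context {d : nat}.
Implicit Types (x y u : d.-tuple R).

(** The kernel of the projection on the span of the Psi of type iota: the sum over the
    multi-index factorises. *)
Definition ker_iota (iota : {ffun 'I_d -> bool}) j x y : R :=
  \prod_(i < d) ker1 N (gen iota i) j (tnth x i) (tnth y i).

Lemma sum_Psi (iota : {ffun 'I_d -> bool}) j x y :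
  \sum_(m : Z d j) Psi w iota m x * Psi w iota m y = ker_iota iota j x y.
Proof.
rewrite /ker_iota /ker1 bigA_distr_bigA /=; apply: eq_bigr => m _.
by rewrite -big_split.
Qed.

Lemma PhiE j (m : Z d j) x : Phi w m x = Psi w [ffun=> false] m x.
Proof. by apply: eq_bigr => i _; rewrite ffunE. Qed.

Lemma KE j x y : K w j x y = \prod_(i < d) kphi j (tnth x i) (tnth y i).
Proof.
rewrite /K; under eq_bigr do rewrite !PhiE.
by rewrite sum_Psi; apply: eq_bigr => i _; rewrite ffunE.
Qed.

Lemma K_sym j x y : K w j x y = K w j y x.
Proof. by rewrite !KE; apply: eq_bigr => i _; exact: ker1_sym. Qed.

Lemma gen_is (b : bool) : is_gen w (if b then cdv_psi w else cdv_phi w).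
Proof. by case: b; [right|left]. Qed.

Lemma bm_Psi (iota : {ffun 'I_d -> bool}) j (m : Z d j) : bm (Psi w iota m).
Proof. by apply: bm_prod => i; apply: bm_tnth; apply: bm_dil => //; exact: gen_is. Qed.

Lemma bm_Phi j (m : Z d j) : bm (Phi w m).
Proof. rewrite (_ : Phi w m = Psi w [ffun=> false] m); [exact: bm_Psi|exact/funext/PhiE]. Qed.

Lemma bm_K2 j : bm (fun z : d.-tuple R * d.-tuple R => K w j z.1 z.2).
Proof.
apply: bm_sum => m; apply: bmM.
- exact: (bm_comp (bm_Phi m)).
- exact: (bm_comp (bm_Phi m)).
Qed.

Lemma bm_K j x : bm (fun y => K w j x y).
Proof. exact: (bm_slice1 x (bm_K2 j)). Qed.

Lemma bm_Kdiag j : bm (fun x => K w j x x).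
Proof. by apply: bm_sum => m; apply: bmM; exact: bm_Phi. Qed.

(** Expanding the product over the coordinates of the one-dimensional kernels of V_(j+1),
    each the sum of a scaling part and of a wavelet part. *)
Lemma K_split j x y : (J0 <= j)%N -> cube x -> cube y ->
  K w j.+1 x y = K w j x y + \sum_(iota : {ffun 'I_d -> bool} | [exists i, iota i])
    \sum_(m : Z d j) Psi w iota m x * Psi w iota m y.
Proof.
move=> jJ cx cy; rewrite (KE j.+1).
rewrite (eq_bigr (fun i => \sum_(b : bool)
   ker1 N (if b then cdv_psi w else cdv_phi w) j (tnth x i) (tnth y i))); last first.
  by move=> i _; rewrite (ker1_split w S_ge1 jJ (cx i) (cy i)) big_bool /= addrC.
rewrite bigA_distr_bigA /= (bigD1 [ffun=> false]) //=; congr (_ + _).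
  by rewrite KE; apply: eq_bigr => i _; rewrite ffunE.
apply: eq_big => [iota|iota _]; last by rewrite sum_Psi.
apply/idP/existsP => [nf|[i ii]].
  apply: contrapT => h; move/eqP: nf; apply; apply/ffunP => i; rewrite ffunE.
  by apply/negbTE/negP => ii; apply: h; exists i.
by apply: contraTneq ii => ->; rewrite ffunE.
Qed.

Lemma K_repro j1 j2 x y : (J0 <= j1)%N -> (j1 <= j2)%N -> cube x ->
  Ex (unif d) (fun u => K w j2 x u * K w j1 u y) = K w j1 x y.
Proof.
move=> j1J j12 cx.
rewrite (eq_Ex (fun u => \prod_(i < d)
   (fun v => kphi j2 (tnth x i) v * kphi j1 v (tnth y i)) (tnth u i))); last first.
  by move=> u; rewrite !KE -big_split.
rewrite (Ex_unif_prod (f := fun i v => kphi j2 (tnth x i) v * kphi j1 v (tnth y i))); last first.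
  move=> i; apply: bmM; first exact: bm_kphi.
  rewrite (_ : (fun v => _) = fun v => kphi j1 (tnth y i) v); first exact: bm_kphi.
  by apply/funext => v; exact: ker1_sym.
by rewrite KE; apply: eq_bigr => i _; exact: ker1_repro.
Qed.

Lemma K_mass j x : (J0 <= j)%N -> cube x -> Ex (unif d) (fun u => K w j x u) = 1.
Proof.
move=> jJ cx; rewrite (eq_Ex (fun u => \prod_(i < d) kphi j (tnth x i) (tnth u i))); last first.
  by move=> u; rewrite KE.
rewrite (Ex_unif_prod (f := fun i => kphi j (tnth x i))); last by move=> i; exact: bm_kphi.
by rewrite big1// => i _; exact: ker1_mass.
Qed.

Lemma bm_kdiag j : bm (fun v => kphi j v v).
Proof. by apply: bm_sum => m; apply: bmM; exact: bm_phi. Qed.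

(** The source of all the bias terms in k/n. *)
Lemma K_trace j : (J0 <= j)%N -> Ex (unif d) (fun u => K w j u u) = (res d j)%:R.
Proof.
move=> jJ; rewrite (eq_Ex (fun u => \prod_(i < d) (fun v => kphi j v v) (tnth u i))); last first.
  by move=> u; rewrite KE.
rewrite (Ex_unif_prod (f := fun i v => kphi j v v)); last by move=> i; exact: bm_kdiag.
rewrite (eq_bigr (fun=> 2 ^+ j)); last by move=> i _; exact: ker1_trace.
by rewrite prodr_const card_ord -exprM /res natrX.
Qed.

(** The size estimates behind all the bounds; the last one controls the sup norm of sums
    of wavelets of one level. *)
Lemma K_consts : exists2 c : R, 1 <= c & forall j,
  [/\ forall x y, `|K w j x y| <= c * (res d j)%:R,
      forall x, Ex (unif d) (fun y => `|K w j x y|) <= c,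
      forall x y, (exists i, c / 2 ^+ j < `|tnth x i - tnth y i|) -> K w j x y = 0 &
      forall (iota : {ffun 'I_d -> bool}) x,
        \sum_(m : Z d j) `|Psi w iota m x| <= c * Num.sqrt (res d j)%:R].
Proof.
have [c c1 hc] := kernel_consts; have c0 : 0 <= c by exact: le_trans c1.
exists (c ^+ d.+1) => [|j]; first by rewrite exprn_ege1.
have [h1 h2 h3 h4] := hc j.
have cd0 : 0 <= c ^+ d by rewrite exprn_ge0.
have cd1 : c ^+ d <= c ^+ d.+1 by rewrite exprS ler_peMl.
have cc1 : c <= c ^+ d.+1 by rewrite exprS ler_peMr// exprn_ege1.
have resE : (res d j)%:R = (2 ^+ j) ^+ d :> R by rewrite -exprM /res natrX.
have prod_le (F : 'I_d -> R) M : (forall i, 0 <= F i <= M) -> \prod_(i < d) F i <= M ^+ d.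
  move=> FM; apply: (@le_trans _ _ (\prod_(i < d) M)); first exact: ler_prod.
  by rewrite prodr_const card_ord.
split.
- move=> x y; rewrite KE normr_prod.
  apply: (@le_trans _ _ ((c * 2 ^+ j) ^+ d)); first by apply: prod_le => i; rewrite normr_ge0 /=.
  by rewrite exprMn -resE ler_wpM2r.
- move=> x; rewrite (eq_Ex (fun u => \prod_(i < d) (fun v => `|kphi j (tnth x i) v|) (tnth u i))).
    rewrite (Ex_unif_prod (f := fun i v => `|kphi j (tnth x i) v|)); last first.
      by move=> i; apply: bm_norm; exact: bm_kphi.
    apply: le_trans cd1; apply: prod_le => i; rewrite h2 andbT.
    by apply: Ex_ge0 => v; exact: normr_ge0.
  by move=> u; rewrite KE normr_prod.
- move=> x y [i hi]; rewrite KE (bigD1 i)//= h3 ?mul0r//.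
  apply: le_lt_trans hi; rewrite ler_wpM2r// invr_ge0 exprn_ge0//.
- move=> iota x.
  have -> : \sum_(m : Z d j) `|Psi w iota m x| =
     \prod_(i < d) \sum_(m < 2 ^ j) `|dilate N (gen iota i) j m (tnth x i)|.
    rewrite bigA_distr_bigA /=; apply: eq_bigr => m _.
    by rewrite /Psi normr_prod.
  apply: (@le_trans _ _ ((c * Num.sqrt (2 ^+ j)) ^+ d)).
    apply: prod_le => i; rewrite h4 ?andbT; last exact: gen_is.
    by apply: sumr_ge0.
  by rewrite exprMn resE sqrt_exprn ?exprn_ge0// ler_wpM2r// exprn_ge0// sqrtr_ge0.
Qed.

Lemma Ex_Psi_Psi (iota iota' : {ffun 'I_d -> bool}) j j' (m : Z d j) (m' : Z d j') :
  Ex (unif d) (fun x => Psi w iota m x * Psi w iota' m' x) =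
  \prod_(i < d) Ex unif1 (fun v => dilate N (gen iota i) j (m i) v *
                                   dilate N (gen iota' i) j' (m' i) v).
Proof.
rewrite -(Ex_unif_prod (f := fun i v => dilate N (gen iota i) j (m i) v *
                                   dilate N (gen iota' i) j' (m' i) v)).
  by apply: eq_Ex => x; rewrite /Psi -big_split.
by move=> i; apply: bmM; apply: bm_dil => //; exact: gen_is.
Qed.

Lemma orth_Psi (iota iota' : {ffun 'I_d -> bool}) j (m m' : Z d j) : (J0 <= j)%N ->
  Ex (unif d) (fun x => Psi w iota m x * Psi w iota' m' x) =
  ((iota == iota') && (m == m'))%:R.
Proof.
move=> jJ; rewrite Ex_Psi_Psi.
have one (b b' : bool) (k k' : 'I_(2 ^ j)) :
    Ex unif1 (fun v => dilate N (if b then cdv_psi w else cdv_phi w) j k v *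
        dilate N (if b' then cdv_psi w else cdv_phi w) j k' v) = ((b == b') && (k == k'))%:R.
  case: b; case: b' => /=; rewrite ?orth_psi ?orth_phi ?orth_phi_psi//.
  by rewrite -[RHS](orth_phi_psi w S_ge1 k' k jJ); apply: eq_Ex => v; rewrite mulrC.
have [/andP[/eqP-> /eqP->]|] := boolP ((iota == iota') && (m == m')).
  by rewrite big1// => i _; rewrite one !eqxx.
rewrite negb_and => /orP h.
have [i hi] : exists i, ~~ ((iota i == iota' i) && (m i == m' i)).
  apply: contrapT => hn; have {}hn i : (iota i == iota' i) && (m i == m' i).
    by apply: contrapT => /negP hi; apply: hn; exists i.
  case: h => /eqP; apply; apply/ffunP => i; by have /andP[/eqP ? /eqP ?] := hn i.
by rewrite (bigD1 i)//= one (negPf hi) mul0r.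
Qed.

Lemma orth_Psi_lower (iota iota' : {ffun 'I_d -> bool}) j j' (m : Z d j) (m' : Z d j') i :
  (J0 <= j)%N -> (j < j')%N -> iota' i ->
  Ex (unif d) (fun x => Psi w iota m x * Psi w iota' m' x) = 0.
Proof.
move=> jJ jj' ii; rewrite Ex_Psi_Psi (bigD1 i)//= ii psi_orth_lower ?mul0r//.
exact: gen_is.
Qed.

End dim_d.
End tensor_wavelets.

(** * Projections, and approximation by them *)

Section projections.
Context {R : realType} {J0 S : nat} (w : cdv_basis R J0 S) {d : nat}.
Hypothesis S_ge1 : (1 <= S)%N.
Implicit Types (f g h p b : d.-tuple R -> R).

Lemma le_Ex_cube f g : bm f -> bm g -> (forall x, cube x -> f x <= g x) ->
  Ex (unif d) f <= Ex (unif d) g.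
Proof.
move=> bf bg fg; have b1 : bm (\1_(@cube R d) : d.-tuple R -> R).
  by apply: bm_indic; exact: measurable_cube.
rewrite (eq_Ex_cube (g := fun x => f x * \1_(@cube R d) x))//; last 2 first.
- by bmt.
- by move=> x cx; rewrite indicE mem_set// mulr1.
rewrite [leRHS](eq_Ex_cube (g := fun x => g x * \1_(@cube R d) x))//; last 2 first.
- by bmt.
- by move=> x cx; rewrite indicE mem_set// mulr1.
apply: le_Ex; [by bmt..|] => x; rewrite indicE.
by case: (boolP (x \in _)) => [/set_mem/fg|]; rewrite ?mulr1 ?mulr0.
Qed.

Definition ip f g : R := Ex (unif d) (fun x => f x * g x).

(** The orthogonal projection on V_j of L^2 of the cube.  Off the cube its values depend on
    the basis functions there; identities between projections hold on the cube, which has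
    full measure. *)
Definition vproj j h x : R := Ex (unif d) (fun u => K w j x u * h u).

Lemma ipC f g : ip f g = ip g f.
Proof. by apply: eq_Ex => x; rewrite mulrC. Qed.

Lemma bm_Kf j h : bm h -> bm (fun z => K w j z.1 z.2 * h z.2).
Proof. by move=> bh; apply: bmM; [exact: bm_K2|exact: (bm_comp bh)]. Qed.

Lemma bm_proj j h : bm h -> bm (vproj j h).
Proof. by move=> bh; exact: (bm_Ex2 (unif d) (unif d) (bm_Kf j bh)). Qed.

Lemma eq_ip_cube f f' g g' : bm f -> bm f' -> bm g -> bm g' ->
  (forall x, cube x -> f x = f' x) -> (forall x, cube x -> g x = g' x) ->
  ip f g = ip f' g'.
Proof.
move=> bf bf' bg bg' ff gg; apply: eq_Ex_cube; [by bmt..|] => x cx.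
by rewrite ff// gg.
Qed.

Lemma proj_adj j f g : bm f -> bm g -> ip (vproj j f) g = ip f (vproj j g).
Proof.
move=> bf bg.
have bK := @bm_K2 _ _ _ w S_ge1 d j.
have bfz : bm (fun z : d.-tuple R * d.-tuple R => g z.1 * (K w j z.1 z.2 * f z.2)).
  by apply: bmM; [exact: (bm_comp bg)|exact: bm_Kf].
rewrite ipC /ip (eq_Ex (fun x => Ex (unif d) (fun u => g x * (K w j x u * f u)))); last first.
  by move=> x; rewrite /vproj ExZl//; exact: (bm_slice1 x (bm_Kf j bf)).
rewrite (Ex_swap (unif d) (unif d) bfz); apply: eq_Ex => u /=.
rewrite /vproj -ExZl; last exact: (bm_slice1 u (bm_Kf j bg)).
by apply: eq_Ex => x; rewrite (K_sym w j x u); ring.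
Qed.

(** V_j1 is contained in V_j2, on the cube. *)
Lemma proj_proj j1 j2 h x : (J0 <= j1)%N -> (j1 <= j2)%N -> bm h -> cube x ->
  vproj j2 (vproj j1 h) x = vproj j1 h x.
Proof.
move=> j1J j12 bh cx.
have bfz : bm (fun z : d.-tuple R * d.-tuple R => K w j2 x z.1 * (K w j1 z.1 z.2 * h z.2)).
  by apply: bmM; [exact: (bm_comp (bm_K w S_ge1 j2 x))|exact: bm_Kf].
rewrite [LHS](eq_Ex (fun u => Ex (unif d) (fun v => K w j2 x u * (K w j1 u v * h v)))); last first.
  by move=> u; rewrite /vproj ExZl//; exact: (bm_slice1 u (bm_Kf j1 bh)).
rewrite (Ex_swap (unif d) (unif d) bfz); apply: eq_Ex => v /=.
rewrite -(K_repro w S_ge1 v j1J j12 cx) -ExZr; last first.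
  by apply: bmM; [exact: bm_K|exact: (bm_slice2 v (bm_K2 w S_ge1 j1))].
by apply: eq_Ex => u; rewrite mulrA.
Qed.

Lemma ip_proj_proj j1 j2 p b : (J0 <= j1)%N -> (J0 <= j2)%N -> bm p -> bm b ->
  ip (vproj j1 p) (vproj j2 b) = ip p (vproj (minn j1 j2) b).
Proof.
move=> j1J j2J bp bb.
have [b1 b2] := (bm_proj j1 bp, bm_proj j2 bb).
have [j12|/ltnW j21] := leqP j1 j2.
  rewrite -(proj_adj j2 b1 bb) -(proj_adj j1 bp bb).
  apply: eq_ip_cube => //; first exact: bm_proj.
  by move=> x cx; exact: proj_proj.
rewrite (proj_adj j1 bp b2); apply: eq_ip_cube => //; first exact: bm_proj.
by move=> x cx; exact: proj_proj.
Qed.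

(** The integral estimator depends on the two resolutions only through this kernel. *)
Lemma K_K_min j1 j2 x y : (J0 <= j1)%N -> (J0 <= j2)%N -> cube x -> cube y ->
  Ex (unif d) (fun u => K w j1 x u * K w j2 y u) = K w (minn j1 j2) x y.
Proof.
move=> j1J j2J cx cy; have [j12|/ltnW j21] := leqP j1 j2.
  rewrite (K_sym w j1 x y) -(K_repro w S_ge1 x j1J j12 cy).
  by apply: eq_Ex => u; rewrite (K_sym w j1 u x) mulrC.
rewrite -(K_repro w S_ge1 y j2J j21 cx).
by apply: eq_Ex => u; rewrite (K_sym w j2 u y).
Qed.

Lemma proj_le j c h B : (forall x, Ex (unif d) (fun y => `|K w j x y|) <= c) ->
  bm h -> 0 <= B -> (forall x, `|h x| <= B) -> forall x, `|vproj j h x| <= c * B.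
Proof.
move=> hc bh B0 hB x; have bK := bm_K w S_ge1 j x.
apply: (le_trans (norm_Ex _ _)); first by bmt.
apply: (@le_trans _ _ (Ex (unif d) (fun u => `|K w j x u| * B))).
  by apply: le_Ex; [by bmt..|] => u; rewrite normrM ler_wpM2l.
by rewrite ExZr; [rewrite ler_wpM2r|bmt].
Qed.

Lemma ip_le B B' f g : bm f -> bm g -> (forall x, cube x -> `|f x| <= B) ->
  (forall x, cube x -> `|g x| <= B') -> `|ip f g| <= B * B'.
Proof.
move=> bf bg fB gB; apply: (le_trans (norm_Ex _ _)); first by bmt.
rewrite -(Ex_cst (unif d) (B * B')); apply: le_Ex_cube; [by bmt..|] => x cx.
by rewrite normrM; apply: ler_pM => //; [exact: fB|exact: gB].
Qed.

Lemma ipDl f f' g : bm f -> bm f' -> bm g -> ip (fun x => f x + f' x) g = ip f g + ip f' g.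
Proof.
move=> bf bf' bg; rewrite /ip -ExD; [|by bmt..].
by apply: eq_Ex => x; rewrite mulrDl.
Qed.

Lemma ipBr f g g' : bm f -> bm g -> bm g' -> ip f (fun x => g x - g' x) = ip f g - ip f g'.
Proof.
move=> bf bg bg'; rewrite /ip -ExB; [|by bmt..].
by apply: eq_Ex => x; rewrite mulrBr.
Qed.

(** The kernel has mass one, bounded L1 norm, and is supported near the diagonal, so it
    is an approximation of the identity. *)
Lemma proj_approx b : bm b -> unif_cont_cube b -> forall e, 0 < e ->
  exists j0, forall j x, (j0 <= j)%N -> (J0 <= j)%N -> cube x -> `|vproj j b x - b x| <= e.
Proof.
move=> bb ub e e0; have [c c1 hc] := @K_consts _ _ _ w S_ge1 d.
have c0 : 0 < c by exact: lt_le_trans c1.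
have [dl dl0 hdl] := ub _ (divr_gt0 e0 c0).
have [j0 hj0] : exists j0 : nat, c / dl < j0%:R.
  by exists (Num.trunc (c / dl)).+1; rewrite truncnS_gt.
exists j0 => j x jj0 jJ cx; have [h1 h2 h3 _] := hc j.
have small : c / 2 ^+ j < dl.
  rewrite ltr_pdivrMr ?exprn_gt0// mulrC -ltr_pdivrMr//; apply: (lt_le_trans hj0).
  by rewrite -natrX ler_nat (leq_trans jj0)// ltnW// ltn_expl.
have bK := bm_K w S_ge1 j x.
have -> : vproj j b x - b x = Ex (unif d) (fun u => K w j x u * (b u - b x)).
  rewrite (eq_Ex (fun u => K w j x u * b u - K w j x u * b x)); last by move=> u; rewrite mulrBr.
  by rewrite ExB; [|by bmt..]; rewrite ExZr// K_mass// mul1r.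
apply: (le_trans (norm_Ex _ _)); first by bmt.
apply: (@le_trans _ _ (Ex (unif d) (fun u => `|K w j x u| * (e / c)))).
  apply: le_Ex_cube; [by bmt..|] => u cu; rewrite normrM.
  have [near|] := pselect (forall i, `|tnth x i - tnth u i| < dl).
    rewrite ler_wpM2l// distrC ltW//; exact: hdl.
  move=> /existsNP[i /negP]; rewrite -leNgt => hi.
  rewrite h3 ?normr0 ?mul0r//; exists i; exact: lt_le_trans hi.
rewrite ExZr; last by bmt.
by rewrite -ler_pdivlMr ?divr_gt0// invf_div mulrCA divff ?gt_eqF// mulr1.
Qed.

Lemma ip_proj_approx p b : bm p -> bm b -> unif_cont_cube b -> forall e, 0 < e ->
  exists j0, forall j, (j0 <= j)%N -> (J0 <= j)%N -> `|ip p b - ip p (vproj j b)| <= e.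
Proof.
move=> bp bb ub e e0; have [B B0 hB] := bm_bound bp.
have B1 : 0 < B + 1 by lra.
have [j0 hj0] := proj_approx bb ub (divr_gt0 e0 B1).
exists j0 => j jj0 jJ; have bpr := bm_proj j bb.
rewrite -ipBr//.
rewrite (_ : e = (B + 1) * (e / (B + 1))); last by field; rewrite gt_eqF.
apply: ip_le; [by bmt..| |].
- by move=> x _; apply: (le_trans (hB x)); lra.
- by move=> x cx; rewrite distrC; exact: hj0.
Qed.

(** The increment of the projection from V_j to V_(j+1) is the projection on the level-j
    wavelets. *)
Lemma ip_proj_step j p b : (J0 <= j)%N -> bm p -> bm b ->
  ip p (vproj j.+1 b) - ip p (vproj j b) =
  \sum_(iota : {ffun 'I_d -> bool} | [exists i, iota i])
    \sum_(m : Z d j) ip p (Psi w iota m) * ip b (Psi w iota m).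
Proof.
move=> jJ bp bb; rewrite -ipBr//; [|exact: bm_proj..].
have bP iota (m : Z d j) : bm (Psi w iota m) by exact: bm_Psi.
have prE x : cube x -> vproj j.+1 b x - vproj j b x =
   \sum_(iota : {ffun 'I_d -> bool} | [exists i, iota i])
    \sum_(m : Z d j) ip b (Psi w iota m) * Psi w iota m x.
  move=> cx; have bK l := bm_K w S_ge1 l x.
  rewrite /vproj -ExB; [|by bmt..].
  rewrite (eq_Ex_cube (g := fun u =>
    \sum_(iota : {ffun 'I_d -> bool} | [exists i, iota i])
    \sum_(m : Z d j) (b u * Psi w iota m u) * Psi w iota m x)).
  - rewrite Ex_sum; last by move=> iota; apply: bm_sum => m; bmt.
    apply: eq_bigr => iota _; rewrite Ex_sum; last by move=> m; bmt.
    by apply: eq_bigr => m _; rewrite ExZr//; bmt.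
  - by bmt.
  - by do 2 apply: bm_sum => ?; bmt.
  - move=> u cu; rewrite K_split// -mulrBl addrAC subrr add0r mulr_suml.
    apply: eq_bigr => iota _; rewrite mulr_suml; apply: eq_bigr => m _; ring.
rewrite (eq_ip_cube (g' := fun x => \sum_(iota : {ffun 'I_d -> bool} | [exists i, iota i])
    \sum_(m : Z d j) ip b (Psi w iota m) * Psi w iota m x) bp bp); last 4 first.
- by apply: bmB; exact: bm_proj.
- by do 2 apply: bm_sum => ?; bmt.
- by [].
- exact: prE.
rewrite /ip (eq_Ex (fun x => \sum_(iota : {ffun 'I_d -> bool} | [exists i, iota i])
    \sum_(m : Z d j) ip b (Psi w iota m) * (p x * Psi w iota m x))); last first.
  move=> x; rewrite mulr_sumr; apply: eq_bigr => iota _; rewrite mulr_sumr.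
  by apply: eq_bigr => m _; rewrite mulrCA.
rewrite Ex_sum; last by move=> iota; apply: bm_sum => m; bmt.
apply: eq_bigr => iota _; rewrite Ex_sum; last by move=> m; bmt.
by apply: eq_bigr => m _; rewrite ExZl; [rewrite mulrC|bmt].
Qed.

Lemma coef_ip h e : bm h -> bm e -> coef h e = ip h e.
Proof. by move=> bh be; rewrite /coef Rintegral_cube//; exact: bmM. Qed.

(** The part of the Hoelder norm that governs the approximation error; unlike the norm
    it is a statement on all coefficients, without suprema. *)
Definition decay (a M : R) h := forall l (m : Z d l) (iota : {ffun 'I_d -> bool}),
  (J0 <= l)%N -> (exists i, iota i) ->
  `|coef h (Psi w iota m)| <= M * 2 `^ (- (l%:R * (a + d%:R / 2))).

Lemma holder_decay a M h : holder_ball w a M h -> decay a M h.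
Proof.
move=> [_]; rewrite /holder_norm => hM l m iota lJ ii.
set F := (X in (X%:E + _ <= _)%E) in hM.
have F0 : 0 <= F.
  rewrite mulr_ge0 ?powR_ge0//; elim/big_ind: _ => // x y x0 y0.
  by rewrite le_max x0.
set E := ereal_sup _ in hM.
have yE : ((2 `^ (l%:R * (a + d%:R / 2)) * `|coef h (Psi w iota m)|)%:E <= E)%E.
  by apply: ereal_sup_ubound; exists l, m, iota; split.
have : ((2 `^ (l%:R * (a + d%:R / 2)) * `|coef h (Psi w iota m)|)%:E <= M%:E)%E.
  by apply: (le_trans yE); apply: le_trans hM; rewrite leeDr// lee_fin.
rewrite lee_fin powRN => h1.
by rewrite ler_pdivlMr ?powR_gt0// mulrC.
Qed.

Lemma powR2_natmul (j : nat) (t : R) : 2 `^ (- (j%:R * t)) = (2 `^ (- t)) ^+ j.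
Proof. by rewrite -powR_mulrn ?powR_ge0// -powRrM; congr (_ `^ _); ring. Qed.

(** A level has at most 2^d 2^(jd) coefficients, and the factor 2^(jd) compensates the
    normalisation d/2 + d/2 in the two decay rates. *)
Lemma detail_le a a' M M' j p b : (J0 <= j)%N -> 0 <= M -> 0 <= M' ->
  bm p -> bm b -> decay a M p -> decay a' M' b ->
  `|ip p (vproj j.+1 b) - ip p (vproj j b)| <=
  2 ^+ d * (M * M') * (2 `^ (- (a + a'))) ^+ j.
Proof.
move=> jJ M0 M'0 bp bb dp db; rewrite ip_proj_step//.
have bP (iota : {ffun 'I_d -> bool}) (m : Z d j) : bm (Psi w iota m) by exact: bm_Psi.
pose B := (M * M') * (2 `^ (- (a + a')) ^+ j * 2 `^ (- (j * d)%:R)).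
have one (iota : {ffun 'I_d -> bool}) (m : Z d j) : [exists i, iota i] ->
    `|ip p (Psi w iota m) * ip b (Psi w iota m)| <= B.
  move=> /existsP ii; rewrite normrM -!coef_ip//.
  apply: (le_trans (ler_pM (normr_ge0 _) (normr_ge0 _) (dp _ m _ jJ ii) (db _ m _ jJ ii))).
  rewrite mulrACA ler_wpM2l ?mulr_ge0// -powR2_natmul -!powRD ?pnatr_eq0 ?implybT//.
  rewrite le_eqVlt; apply/orP; left; apply/eqP; congr (_ `^ _).
  by rewrite natrM; lra.
have B0 : 0 <= B by rewrite !mulr_ge0 ?exprn_ge0 ?powR_ge0.
apply: (le_trans (ler_norm_sum _ _ _)).
apply: (@le_trans _ _ (\sum_(iota : {ffun 'I_d -> bool}) \sum_(m : Z d j) B)).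
  rewrite [leRHS](bigID (fun iota : {ffun 'I_d -> bool} => [exists i, iota i])) /=.
  rewrite -[leLHS]addr0; apply: lerD; last by apply: sumr_ge0 => ? _; apply: sumr_ge0.
  apply: ler_sum => iota ii; apply: (le_trans (ler_norm_sum _ _ _)).
  by apply: ler_sum => m _; exact: one.
rewrite !sumr_const /Z !card_ffun card_bool !card_ord.
rewrite -[leLHS]mulr_natl -[X in _ * X]mulr_natl /B.
have -> : ((2 ^ j) ^ d)%:R * (M * M' * (2 `^ (- (a + a')) ^+ j * 2 `^ (- (j * d)%:R))) =
    M * M' * 2 `^ (- (a + a')) ^+ j :> R.
  rewrite -expnM natrX (powRN 2 (j * d)%:R) powR_mulrn//; field.
  by rewrite expf_neq0// pnatr_eq0.
by rewrite mulrA natrX.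
Qed.

(** A geometric series over the levels above j.  Its sum is identified through the
    uniform convergence of the projections of b. *)
Lemma bias_proj_le a a' M M' j p b : 0 < a + a' -> (J0 <= j)%N -> 0 <= M -> 0 <= M' ->
  bm p -> bm b -> unif_cont_cube b -> decay a M p -> decay a' M' b ->
  `|ip p b - ip p (vproj j b)| <=
  2 ^+ d * (M * M') / (1 - 2 `^ (- (a + a'))) * (2 `^ (- (a + a'))) ^+ j.
Proof.
move=> aa0 jJ M0 M'0 bp bb ub dp db.
set q := 2 `^ (- (a + a')); set D := _ * (M * M').
have q0 : 0 <= q by exact: powR_ge0.
have q1 : q < 1.
  rewrite /q powRN invf_lt1 ?powR_gt0//.
  have := gt0_ltr_powR aa0 (x := 1) (y := 2); rewrite powR1; apply; rewrite ?nnegrE//.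
  by rewrite ltr1n.
have q1' : 0 < 1 - q by rewrite subr_gt0.
have D0 : 0 <= D by rewrite !mulr_ge0 ?exprn_ge0.
have tele n : `|ip p (vproj (j + n) b) - ip p (vproj j b)| <=
    D / (1 - q) * (q ^+ j - q ^+ (j + n)).
  elim: n => [|n IH]; first by rewrite addn0 !subrr normr0 mulr0.
  rewrite addnS.
  apply: (le_trans (ler_distD (ip p (vproj (j + n) b)) _ _)).
  have jn : (J0 <= j + n)%N by rewrite (leq_trans jJ)// leq_addr.
  apply: (le_trans (lerD (detail_le jn M0 M'0 bp bb dp db) IH)).
  rewrite -/q -/D le_eqVlt; apply/orP; left; apply/eqP; rewrite exprS; field.
  by rewrite gt_eqF.
have lim n : `|ip p (vproj (j + n) b) - ip p (vproj j b)| <= D / (1 - q) * q ^+ j.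
  apply: (le_trans (tele n)); rewrite ler_wpM2l ?divr_ge0// ?(ltW q1')//.
  by rewrite gerBl exprn_ge0.
apply/ler_addgt0Pr => e e0.
have [j0 hj0] := ip_proj_approx bp bb ub e0.
have := hj0 (j + j0)%N (leq_addl _ _) (leq_trans jJ (leq_addr _ _)).
have := lim j0; move=> h1 h2.
apply: (le_trans (ler_distD (ip p (vproj (j + j0) b)) _ _)).
by rewrite [leRHS]addrC; exact: lerD.
Qed.

End projections.

(** * Regression functions *)

Section cond_exp_bm.
Context {dd dd'} {O : measurableType dd} {T : measurableType dd'} {R : realType}.
Variables (P : probability O R) (X : {mfun O >-> T}).

(** Slicing the range of g in steps of length e. *)
Lemma simple_approx (g : T -> R) (e : R) : bm g -> (forall x, 0 <= g x) -> 0 < e ->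
  exists (K : nat) (D : nat -> set T), (forall k, measurable (D k)) /\
    forall x, `|g x - \sum_(k < K) e * k%:R * \1_(D k) x| <= e.
Proof.
move=> bg g0 e0; have [C C0 hC] := bm_bound bg.
pose D (k : nat) := g @^-1` [set` `[e * k%:R, e * k.+1%:R[ ].
exists (Num.trunc (C / e)).+1, D; split.
  move=> k; rewrite -[X in measurable X]setTI; apply: (bm_meas bg) => //.
move=> x; pose k := Num.trunc (g x / e).
have gx0 : 0 <= g x / e by rewrite divr_ge0// ltW.
have /andP[k1 k2] : k%:R <= g x / e < k.+1%:R by exact: trunc_itv.
have kC : (k < (Num.trunc (C / e)).+1)%N.
  rewrite -(ltr_nat R); apply: (le_lt_trans k1); apply: le_lt_trans (truncnS_gt _).
  by rewrite ler_pM2r ?invr_gt0// (le_trans (ler_norm _)).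
rewrite (bigD1 (Ordinal kC))//= big1 ?addr0.
  rewrite indicE mem_set; last first.
    rewrite /D /= in_itv /= -ler_pdivlMl// -ltr_pdivrMl//.
    by rewrite ![e^-1 * _]mulrC k1.
  rewrite mulr1 ler_norml; move: k1 k2; rewrite ler_pdivlMr// ltr_pdivrMr// -natr1.
  by move=> ? ?; apply/andP; split; nra.
move=> i /eqP ik; rewrite indicE memNset ?mulr0// /D /= in_itv /= => /andP[h1 h2].
apply: ik; apply/val_inj => /=; apply/eqP; rewrite eqn_leq.
move: h1 h2; rewrite -ler_pdivlMl// -ltr_pdivrMl// ![e^-1 * _]mulrC => h1 h2.
have := le_lt_trans h1 k2; have := le_lt_trans k1 h2.
by rewrite !ltr_nat !ltnS => -> ->.
Qed.

(** Turns the defining property of a conditional expectation, which is about sets, into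
    one about all bounded measurable functions of X. *)
Lemma Ex_indic_ext (F : O -> R) : bm F ->
  (forall D : set T, measurable D -> Ex P (fun o => F o * \1_D (X o)) = 0) ->
  forall g : T -> R, bm g -> Ex P (fun o => F o * g (X o)) = 0.
Proof.
move=> bF h g bg.
have bX (f : T -> R) : bm f -> bm (fun o => f (X o)) by move=> bf; exact: (bm_comp bf).
have [B B0 hB] := bm_bound bF.
have ge0 (f : T -> R) : bm f -> (forall x, 0 <= f x) -> Ex P (fun o => F o * f (X o)) = 0.
  move=> bf f0; have bfX := bX _ bf.
  apply/eqP; rewrite -normr_eq0 eq_le normr_ge0 andbT; apply/ler_addgt0Pr => e e0.
  rewrite add0r.
  have B1 : 0 < B + 1 by lra.
  have [K [D [mD hD]]] := simple_approx bf f0 (divr_gt0 e0 B1).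
  pose e' := e / (B + 1).
  have b1 k : bm (fun o => \1_(D k) (X o) : R) by apply: bX; exact: bm_indic.
  have -> : Ex P (fun o => F o * f (X o)) =
     Ex P (fun o => F o * (f (X o) - \sum_(k < K) e' * k%:R * \1_(D k) (X o))).
    rewrite [RHS](eq_Ex (fun o => F o * f (X o) -
       \sum_(k < K) (e' * k%:R) * (F o * \1_(D k) (X o)))); last first.
      move=> o; rewrite mulrBr mulr_sumr; congr (_ - _); apply: eq_bigr => k _; ring.
    rewrite ExB; [|by bmt|by apply: bm_sum => k; bmt].
    rewrite Ex_sum; last by move=> k; bmt.
    rewrite big1 ?subr0// => k _; rewrite ExZl; last by bmt.
    by rewrite h// mulr0.
  apply: norm_Ex_le.
    by apply: bmM => //; apply: bmB => //; apply: bm_sum => k; bmt.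
  move=> o; rewrite normrM (_ : e = (B + 1) * e'); last by rewrite /e'; field; lra.
  by apply: ler_pM => //; apply: (le_trans (hB o)); lra.
have [C C0 hC] := bm_bound bg.
have := ge0 (fun x => g x + C); rewrite (eq_Ex (fun o => F o * g (X o) + C * F o)); last first.
  by move=> o; ring.
have bgX := bX _ bg.
rewrite ExD; [|by bmt..]; rewrite ExZl//.
have -> : Ex P F = 0.
  rewrite -(h setT)//; apply: eq_Ex => o; by rewrite indicE in_setT mulr1.
rewrite mulr0 addr0; apply.
  by bmt.
by move=> x; have := hC x; rewrite ler_norml => /andP[? _]; lra.
Qed.

Lemma Ex_indic (F : O -> R) (D : set T) : bm F -> measurable D ->
  (Ex P (fun o => F o * \1_D (X o)))%:E = (\int[P]_(o in X @^-1` D) (F o)%:E)%E.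
Proof.
move=> bF mD; rewrite EFin_Ex; last first.
  by apply: bmM => //; apply: (@bm_comp _ _ _ _ _ (\1_D)) => //; exact: bm_indic.
rewrite [RHS]integral_mkcond; apply: eq_integral => o _; rewrite patchE indicE.
have -> : (o \in X @^-1` D) = (X o \in D).
  by apply/idP/idP => [/set_mem/mem_set//|/set_mem h]; apply: mem_set.
by case: ifP; rewrite ?mulr1 ?mulr0.
Qed.

(** The Radon-Nikodym derivative, with respect to the law of X, of the image by X of the
    signed measure of density F. *)
Lemma cond_exp_exists (F : O -> R) : bm F -> exists g, is_cond_exp P X F g.
Proof.
move=> bF; have iF := bm_integrable P bF.
have mX : measurable_fun [set: O] X by [].
pose PX : probability T R := distribution P X.
have [nu nuE] : exists nu : {charge set T -> \bar R},
    (nu : set T -> \bar R) = pushforward (induced_charge iF) X.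
  by exists (measure_function_pushforward__canonical__charge_Charge (induced_charge iF) mX).
have nuPX : nu `<< PX.
  apply/null_content_dominatesP => A mA A0.
  rewrite nuE /pushforward /induced_charge; apply: null_set_integral => //.
  - by rewrite -[X in measurable X]setTI; exact: mX.
  - exact/measurable_funTS/measurable_EFinP/bm_meas.
pose r := Radon_Nikodym nu PX.
have rfin x : r x \is a fin_num by exact: Radon_Nikodym_fin_num.
have mr : measurable_fun setT r by exact: measurable_int (Radon_Nikodym_integrable nuPX).
pose g x := fine (r x).
have gE x : (g x)%:E = r x by rewrite /g fineK.
have mg : measurable_fun setT g.
  by apply/measurable_EFinP; rewrite (_ : EFin \o g = r)//; exact/funext.
have irX : P.-integrable setT (r \o X).
  apply/integrableP; split; first exact: measurableT_comp.
  have /integrableP[_] := Radon_Nikodym_integrable nuPX.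
  by rewrite (ge0_integral_distribution X (f := fun x => `|r x|%E))//; exact: measurableT_comp.
exists g; split => //.
  by rewrite (_ : (fun o => _) = r \o X)//; apply/funext => o; rewrite gE.
move=> B mB.
rewrite (eq_integral (r \o X)); last by move=> o _; rewrite gE.
have mXB : measurable (X @^-1` B) by rewrite -[X in measurable X]setTI; exact: mX.
rewrite -(integral_pushforward mX mr (integrableS _ _ _ irX))//.
transitivity (nu B); last by rewrite nuE.
by rewrite (Radon_Nikodym_integral nuPX mB).
Qed.

End cond_exp_bm.

(** * The estimators as V-statistics *)

Section ae_transfer.
Context {dd} {T : measurableType dd} {R : realType} (P : probability T R).

Lemma Ex_ae (f g : T -> R) : bm f -> bm g -> {ae P, forall o, f o = g o} -> Ex P f = Ex P g.
Proof.
move=> bf bg fg; apply: EFin_inj; rewrite !EFin_Ex//; apply: ae_eq_integral => //.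
- exact/measurable_EFinP/bm_meas.
- exact/measurable_EFinP/bm_meas.
- by apply: filterS fg => o /= ->.
Qed.

Lemma expectation_ae (f g : T -> R) : measurable_fun setT f -> bm g ->
  {ae P, forall o, f o = g o} -> 'E_P[f]%E = (Ex P g)%:E.
Proof.
move=> mf bg fg; rewrite unlock EFin_Ex//; apply: ae_eq_integral => //.
- exact/measurable_EFinP.
- exact/measurable_EFinP/bm_meas.
- by apply: filterS fg => o /= ->.
Qed.

Lemma variance_ae (f g : T -> R) : measurable_fun setT f -> bm g ->
  {ae P, forall o, f o = g o} -> 'V_P[f]%E = (Var P g)%:E.
Proof.
move=> mf bg fg; rewrite /variance unlock (expectation_ae mf bg fg) Var_centered//=.
apply: expectation_ae.
- by apply: measurable_funM; apply: measurable_funB => //; exact: measurable_cst.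
- by bmt.
- by apply: filterS fg => o /= fgo; rewrite !fctE /= fgo expr2.
Qed.

(** A union bound over the points of the sample. *)
Lemma iid_ae (good : set T) n : {ae P, forall o, good o} ->
  {ae iid P n, forall s, forall i : 'I_n, good (tnth s i)}.
Proof.
move=> [N [mN N0 subN]].
have mNi (i : 'I_n) : measurable ((fun s : n.-tuple T => tnth s i) @^-1` N).
  by rewrite -[X in measurable X]setTI; exact: measurable_tnth.
have bNi := @bm_tnth _ T R n.
have mU : measurable (\bigcup_(i in [set: 'I_n]) ((fun s : n.-tuple T => tnth s i) @^-1` N)).
  by apply: fin_bigcup_measurable => // i _; exact: mNi.
exists (\bigcup_(i in [set: 'I_n]) ((fun s : n.-tuple T => tnth s i) @^-1` N)); split.
- exact: mU.
- have mE (T' : measurableType _) (Q : probability T' R) (D : set T') : measurable D ->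
      Q D = (Ex Q (\1_D : T' -> R))%:E.
    by move=> mD; rewrite EFin_Ex; [rewrite integral_indic// setIT|exact: bm_indic].
  rewrite mE//; congr EFin; apply/eqP; rewrite eq_le; apply/andP; split; last first.
    by apply: Ex_ge0 => s; rewrite indicE.
  apply: (@le_trans _ _ (Ex (iid P n) (fun s => \sum_(i < n) \1_N (tnth s i)))).
    apply: le_Ex; [exact: bm_indic|by apply: bm_sum => i; apply: bNi; exact: bm_indic|].
    move=> s; rewrite [leLHS]indicE; case: (boolP (s \in _)) => [/set_mem[i _ Ni]|_]; last first.
      by apply: sumr_ge0 => i _; rewrite indicE.
    rewrite (bigD1 i)//= indicE mem_set//= lerDl.
    by apply: sumr_ge0 => k _; rewrite indicE.
  rewrite Ex_sum; last by move=> i; apply: bNi; exact: bm_indic.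
  rewrite big1// => i _; rewrite (Ex_coord1 P i (bm_indic mN)).
  by apply: EFin_inj; rewrite -mE.
- move=> s /= /existsNP[i hi]; exists i => //; exact: subN.
Qed.

End ae_transfer.

Section estimators.
Context {R : realType} {J0 S : nat} (w : cdv_basis R J0 S) {d : nat}.
Hypothesis S_ge1 : (1 <= S)%N.
Local Notation obsd := (obs (R := R) d).

Lemma measurable_oX : measurable_fun [set: obsd] (@oX R d).
Proof. by apply: measurableT_comp. Qed.

Lemma measurable_oA : measurable_fun [set: obsd] (@oA R d).
Proof. by apply: measurableT_comp. Qed.

Lemma measurable_oY : measurable_fun [set: obsd] (@oY R d).
Proof. exact: measurable_snd. Qed.

Definition Kobs j (o o' : obsd) : R := K w j (oX o) (oX o').

(** The kernel of the integral estimator.  It equals [K] at the lower level for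
    observations in the cube, but not elsewhere. *)
Definition KKobs j1 j2 (o o' : obsd) : R :=
  Ex (unif d) (fun u => K w j1 (oX o) u * K w j2 (oX o') u).

Lemma bm_obs2 (F : d.-tuple R -> d.-tuple R -> R) : bm (fun z => F z.1 z.2) ->
  bm (fun z : obsd * obsd => F (oX z.1) (oX z.2)).
Proof.
move=> bF; apply: (@bm_comp _ _ _ _ _ _ (fun z : obsd * obsd => (oX z.1, oX z.2)) bF).
by apply: measurable_fun_pair; apply: (measurableT_comp measurable_oX).
Qed.

Lemma bm_Kobs j : bm (fun z => Kobs j z.1 z.2).
Proof. exact: (bm_obs2 (bm_K2 w S_ge1 j)). Qed.

Lemma bm_KK2 j1 j2 : bm (fun z : d.-tuple R * d.-tuple R =>
  Ex (unif d) (fun u => K w j1 z.1 u * K w j2 z.2 u)).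
Proof.
apply: (@bm_Ex2 _ _ _ _ _ (unif d \x unif d)%E (unif d)
  (fun v => K w j1 v.1.1 v.2 * K w j2 v.1.2 v.2)).
apply: bmM.
- apply: (@bm_comp _ _ _ _ _ _ (fun v => (v.1.1, v.2)) (bm_K2 w S_ge1 j1)).
  by apply: measurable_fun_pair => //; exact: measurableT_comp.
- apply: (@bm_comp _ _ _ _ _ _ (fun v => (v.1.2, v.2)) (bm_K2 w S_ge1 j2)).
  by apply: measurable_fun_pair => //; exact: measurableT_comp.
Qed.

Lemma bm_KKobs j1 j2 : bm (fun z => KKobs j1 j2 z.1 z.2).
Proof.
exact: (@bm_obs2 (fun x y => Ex (unif d) (fun u => K w j1 x u * K w j2 y u)) (bm_KK2 j1 j2)).
Qed.

Section measurable_vstat.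
Variables (A Y : obsd -> R).
Hypotheses (mA : measurable_fun setT A) (mY : measurable_fun setT Y).

Lemma measurable_coord (f : obsd -> R) n (i : 'I_n) : measurable_fun setT f ->
  measurable_fun setT (fun s : n.-tuple obsd => f (tnth s i)).
Proof. by move=> mf; apply: measurableT_comp => //; exact: measurable_tnth. Qed.

Lemma measurable_U1 n : measurable_fun setT (fun s : n.-tuple obsd => U1 A Y s).
Proof.
by apply: measurable_sum => i; apply: measurable_funM; exact: measurable_coord.
Qed.

Lemma measurable_U2 n (Ko : obsd -> obsd -> R) : bm (fun z => Ko z.1 z.2) ->
  measurable_fun setT (fun s : n.-tuple obsd => U2 A Y Ko s).
Proof.
move=> bK; do 2 apply: measurable_sum => ?.
apply: measurable_funM; last exact/bm_meas/(bm_tnth2 _ _ bK).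
by apply: measurable_funM; exact: measurable_coord.
Qed.

Lemma measurable_U3 n (Ko Ko' : obsd -> obsd -> R) :
  bm (fun z => Ko z.1 z.2) -> bm (fun z => Ko' z.1 z.2) ->
  measurable_fun setT (fun s : n.-tuple obsd => U3 A Y Ko Ko' s).
Proof.
move=> bK bK'; do 3 apply: measurable_sum => ?.
apply: measurable_funM; apply: measurable_funM.
- exact: measurable_coord.
- exact/bm_meas/(bm_tnth2 _ _ bK).
- exact: measurable_coord.
- exact/bm_meas/(bm_tnth2 _ _ bK').
Qed.

End measurable_vstat.

Lemma psi_INTE n j1 j2 (s : n.-tuple obsd) :
  psi_INT w j1 j2 s = n%:R^-1 * U1 (@oA R d) (@oY R d) s -
    n%:R^-1 ^+ 2 * U2 (@oA R d) (@oY R d) (KKobs j1 j2) s.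
Proof.
rewrite /psi_INT; congr (_ - _).
have bk j x := bm_K w S_ge1 j x.
have bh f j : bm (reg_hat w s f j).
  by apply: bmM; [exact: bm_cst|apply: bm_sum => i; bmt].
rewrite Rintegral_cube; last exact: bmM (bh _ _) (bh _ _).
rewrite (eq_Ex (fun u => \sum_(a < n) \sum_(b < n)
   (n%:R^-1 ^+ 2 * (oA (tnth s a) * oY (tnth s b))) *
   (K w j1 (oX (tnth s a)) u * K w j2 (oX (tnth s b)) u))); last first.
  move=> u; rewrite /p_hat /b_hat /reg_hat mulrACA big_distrlr /= mulr_sumr.
  apply: eq_bigr => a _; rewrite mulr_sumr; apply: eq_bigr => b _; ring.
rewrite Ex_sum; last by move=> a; apply: bm_sum => b; bmt.
rewrite /U2 mulr_sumr; apply: eq_bigr => a _.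
rewrite Ex_sum; last by move=> b; bmt.
rewrite mulr_sumr; apply: eq_bigr => b _; rewrite ExZl; last by bmt.
by rewrite -!mulrA.
Qed.

Lemma psi_MCE n j1 j2 (s : n.-tuple obsd) :
  psi_MC w j1 j2 s = n%:R^-1 * U1 (@oA R d) (@oY R d) s -
    n%:R^-1 ^+ 3 * U3 (@oA R d) (@oY R d) (Kobs j1) (Kobs j2) s.
Proof.
rewrite /psi_MC; congr (_ - _).
rewrite /U3 !mulr_sumr; apply: eq_bigr => i _; rewrite /p_hat /b_hat /reg_hat.
rewrite [n%:R^-1 * _ * _]mulrACA big_distrlr /= mulrA; congr (_ * _).
Qed.

(** Expanding the product, the two cross terms are U2 at either level, and the product of
    the two fits is the U3 of [psi_MCE]. *)
Lemma psi_IFE n j1 j2 (s : n.-tuple obsd) :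
  psi_IF w j1 j2 s = n%:R^-1 * U1 (@oA R d) (@oY R d) s -
    n%:R^-1 ^+ 2 * U2 (@oA R d) (@oY R d) (Kobs j1) s -
    n%:R^-1 ^+ 2 * U2 (@oA R d) (@oY R d) (Kobs j2) s +
    n%:R^-1 ^+ 3 * U3 (@oA R d) (@oY R d) (Kobs j1) (Kobs j2) s.
Proof.
have h2 j : n%:R^-1 ^+ 2 * U2 (@oA R d) (@oY R d) (Kobs j) s =
  n%:R^-1 * \sum_(i < n) oA (tnth s i) * b_hat w s j (oX (tnth s i)).
  rewrite /U2 !mulr_sumr; apply: eq_bigr => a _; rewrite /b_hat /reg_hat mulr_sumr.
  rewrite !mulr_sumr; apply: eq_bigr => b _.
  by rewrite /Kobs (K_sym w j (oX (tnth s a))); ring.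
have h1 j : n%:R^-1 ^+ 2 * U2 (@oA R d) (@oY R d) (Kobs j) s =
  n%:R^-1 * \sum_(i < n) p_hat w s j (oX (tnth s i)) * oY (tnth s i).
  rewrite /U2 exchange_big !mulr_sumr; apply: eq_bigr => b _.
  rewrite /p_hat /reg_hat mulr_sumr mulr_sumr mulr_suml mulr_sumr.
  by apply: eq_bigr => a _; rewrite /Kobs; ring.
have := psi_MCE j1 j2 s; rewrite /psi_MC => /addrI/oppr_inj h3.
rewrite h1 h2 -h3 /psi_IF /U1 -!mulrN -!mulrDr -!sumrN -!big_split /=; congr (_ * _).
by apply: eq_bigr => i _; ring.
Qed.

End estimators.

(** * What the upper and lower bounds use of a law *)

Section clamp.
Context {R : realType} {d : nat}.
Local Notation obsd := (obs (R := R) d).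

(** Walking from 0 to x in K steps shorter than the modulus of continuity for 1. *)
Lemma unif_cont_bounded (h : d.-tuple R -> R) : unif_cont_cube h ->
  exists C, forall x, cube x -> `|h x| <= C.
Proof.
move=> uh; have [dl dl0 hdl] := uh 1 ltr01.
pose K := (Num.trunc dl^-1).+1.
have K0 : 0 < K%:R :> R by [].
have Kdl : K%:R^-1 < dl.
  by rewrite -[dl]invrK ltf_pV2 ?posrE ?invr_gt0// truncnS_gt.
pose z : d.-tuple R := [tuple 0 | i < d].
exists (`|h z| + K%:R) => x cx.
pose y (k : nat) : d.-tuple R := [tuple (k%:R / K%:R) * tnth x i | i < d].
have cy k : (k <= K)%N -> cube (y k).
  move=> kK i; rewrite tnth_mktuple; have /andP[x0 x1] := cx i.
  have k0 : 0 <= k%:R / K%:R :> R by rewrite divr_ge0.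
  have k1 : k%:R / K%:R <= 1 :> R by rewrite ler_pdivrMr// mul1r ler_nat.
  by rewrite mulr_ge0//= mulr_ile1.
have step k : (k <= K)%N -> `|h (y k)| <= `|h z| + k%:R.
  elim: k => [|k IH] kK.
    rewrite addr0 (_ : y 0%N = z)//; apply: eq_from_tnth => i.
    by rewrite !tnth_mktuple mul0r mul0r.
  have h1 : `|h (y k.+1) - h (y k)| < 1.
    apply: hdl; [exact: cy|apply: cy; exact: ltnW|] => i.
    rewrite !tnth_mktuple -mulrBl -mulrBl -natrB// subSnn mul1r normrM.
    have /andP[x0 x1] := cx i.
    rewrite gtr0_norm ?invr_gt0// ger0_norm//; apply: le_lt_trans Kdl.
    by rewrite ler_piMr// invr_ge0 ltW.
  have := IH (ltnW kK); have := ler_distD 0 (h (y k.+1)) (h (y k)).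
  have := ler_normB (h (y k.+1) - h (y k)) (- h (y k)).
  rewrite opprK subrK normrN -natr1 => h2 _ h3; lra.
have := step K (leqnn _); rewrite (_ : y K = x)//.
by apply: eq_from_tnth => i; rewrite tnth_mktuple divff ?mul1r// gt_eqF.
Qed.

(** Uniform continuity bounds h on the cube only; cutting h to 0 elsewhere, where X does
    not go, makes it bounded. *)
Definition patch_cube (h : d.-tuple R -> R) x : R := h x * \1_(@cube R d) x.

Lemma patch_cubeE h x : cube x -> patch_cube h x = h x.
Proof. by move=> cx; rewrite /patch_cube indicE mem_set// mulr1. Qed.

Lemma bm_patch_cube h : measurable_fun setT h -> unif_cont_cube h -> bm (patch_cube h).
Proof.
move=> mh /unif_cont_bounded[C hC]; split.
  by apply: measurable_funM => //; apply: bm_meas; apply: bm_indic; exact: measurable_cube.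
exists `|C| => x; rewrite /patch_cube indicE; case: (boolP (x \in _)) => [/set_mem cx|_].
  by rewrite mulr1 (le_trans (hC _ cx))// ler_norm.
by rewrite mulr0 normr0.
Qed.

Lemma unif_cont_eq (h h' : d.-tuple R -> R) : (forall x, cube x -> h x = h' x) ->
  unif_cont_cube h -> unif_cont_cube h'.
Proof.
move=> hh uh e e0; have [dl dl0 hdl] := uh e e0; exists dl => // x y cx cy xy.
by rewrite -!hh//; exact: hdl.
Qed.

Lemma coef_eq (h h' e : d.-tuple R -> R) : (forall x, cube x -> h x = h' x) ->
  coef h e = coef h' e.
Proof.
by move=> hh; apply: eq_Rintegral => x /set_mem cx; rewrite hh.
Qed.

(** Truncation turns the almost sure bounds on A and Y into bounds everywhere. *)
Definition clamp (B v : R) : R := Num.max (- B) (Num.min B v).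

Lemma clamp_id B v : `|v| <= B -> clamp B v = v.
Proof.
by rewrite ler_norml => /andP[h1 h2]; rewrite /clamp (min_idPr h2) (max_idPr h1).
Qed.

Lemma clamp_le B v : 0 <= B -> `|clamp B v| <= B.
Proof.
move=> B0; rewrite /clamp ler_norml le_max lexx /= ge_max ge_min lexx /=; lra.
Qed.

Lemma bm_clamp B (f : obsd -> R) : 0 <= B -> measurable_fun setT f ->
  bm (fun o => clamp B (f o)).
Proof.
move=> B0 mf; split; last by exists B => o; exact: clamp_le.
by apply: measurable_maxr => //; exact: measurable_minr.
Qed.

End clamp.

HB.instance Definition _ (R : realType) (d : nat) :=
  isMeasurableFun.Build _ _ _ _ (@oX R d) measurable_oX.

Section law_of_X.
Context {R : realType} {d : nat}.
Local Notation obsd := (obs (R := R) d).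
Variable P : probability obsd R.
Hypothesis PX : forall B : set (d.-tuple R), measurable B -> P (@oX R d @^-1` B) = unif d B.

Lemma Ex_law_X (h : d.-tuple R -> R) : bm h -> Ex P (fun o => h (oX o)) = Ex (unif d) h.
Proof.
move=> bh; rewrite -(Ex_distribution P (@oX R d) bh) /Ex /Rintegral; congr fine.
apply: eq_measure_integral => B mB _; exact: PX.
Qed.

Lemma ae_cube : {ae P, forall o, cube (oX o)}.
Proof.
have mc : measurable (~` @cube R d) by apply: measurableC; exact: measurable_cube.
exists (@oX R d @^-1` (~` @cube R d)); split => //.
  by rewrite -[X in measurable X]setTI; exact: measurable_oX.
rewrite [LHS]PX//.
have h0 : Ex (unif d) (\1_(~` @cube R d) : d.-tuple R -> R) = 0.
  rewrite -(Ex_cst (unif d) 0); apply: eq_Ex_cube; [exact: bm_indic|exact: bm_cst|].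
  by move=> x cx; rewrite indicE memNset//; apply.
have := congr1 (@EFin R) h0; rewrite EFin_Ex; last exact: bm_indic.
by rewrite integral_indic// setIT.
Qed.

End law_of_X.

Section cond_exp_facts.
Context {R : realType} {d : nat}.
Local Notation obsd := (obs (R := R) d).
Variable P : probability obsd R.
Hypothesis PX : forall B : set (d.-tuple R), measurable B -> P (@oX R d @^-1` B) = unif d B.

Lemma mX_pre (D : set (d.-tuple R)) : measurable D -> measurable (@oX R d @^-1` D).
Proof. by move=> mD; rewrite -[X in measurable X]setTI; exact: measurable_oX. Qed.

Lemma bm_oX (h : d.-tuple R -> R) : bm h -> bm (fun o : obsd => h (oX o)).
Proof. by move=> bh; apply: (bm_comp bh); exact: measurable_oX. Qed.

(** Conditional expectation against functions of X, for the truncation F of f. *)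
Lemma cond_exp_pull (F f : obsd -> R) (p : d.-tuple R -> R) :
  bm F -> measurable_fun setT f -> {ae P, forall o, F o = f o} -> bm (patch_cube p) ->
  is_cond_exp P (@oX R d) f p -> forall g : d.-tuple R -> R, bm g ->
  Ex P (fun o => F o * g (oX o)) = ip (patch_cube p) g.
Proof.
move=> bF mf Ff bp [mp ip_ pE] g bg.
have bpX := bm_oX bp; have bgX := bm_oX bg.
rewrite /ip -(Ex_law_X PX (bmM bp bg)).
apply/eqP; rewrite -subr_eq0 -ExB; [|by bmt..]; apply/eqP.
rewrite (eq_Ex (fun o => (F o - patch_cube p (oX o)) * g (oX o))); last first.
  by move=> o; rewrite mulrBl.
apply: (@Ex_indic_ext _ _ _ _ _ P (@oX R d)) => //; first by bmt.
move=> D mD; have b1 := bm_oX (@bm_indic _ _ R D mD).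
rewrite (eq_Ex (fun o => F o * \1_D (oX o) - patch_cube p (oX o) * \1_D (oX o))); last first.
  by move=> o; rewrite mulrBl.
rewrite ExB; [|by bmt..].
apply/eqP; rewrite subr_eq0; apply/eqP; apply: EFin_inj.
rewrite (Ex_indic P (@oX R d) bF mD) (Ex_indic P (@oX R d) bpX mD).
have mXD := mX_pre mD.
transitivity (\int[P]_(o in @oX R d @^-1` D) (f o)%:E)%E.
  apply: ae_eq_integral => //.
  - exact/measurable_funTS/measurable_EFinP/bm_meas.
  - exact/measurable_funTS/measurable_EFinP.
  - by apply: filterS Ff => o /= ->.
rewrite -pE//; apply: ae_eq_integral => //.
- apply/measurable_funTS/measurable_EFinP; exact: (measurableT_comp mp).
- exact/measurable_funTS/measurable_EFinP/bm_meas.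
- by apply: filterS (ae_cube PX) => o /= cx _; rewrite patch_cubeE.
Qed.

Lemma cond_exp_unique (f : obsd -> R) (a p : d.-tuple R -> R) :
  is_cond_exp P (@oX R d) f a -> is_cond_exp P (@oX R d) f p ->
  {ae P, forall o, a (oX o) = p (oX o)}.
Proof.
move=> [ma ia aE] [mp ip_ pE].
pose Q : probability _ R := distribution P (@oX R d).
have mX := @measurable_oX R d.
have ma' := (measurable_EFinP _ _).2 ma; have mp' := (measurable_EFinP _ _).2 mp.
have [N [mN N0 subN]] : ae_eq Q setT (EFin \o a) (EFin \o p).
  apply: integral_ae_eq => //.
    by apply: (integrable_pushforward mX ma' (D := setT)).
  move=> E _ mE.
  have mXE := mX_pre mE.
  rewrite (integral_pushforward mX ma' (integrableS _ mXE _ ia))//.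
  rewrite (integral_pushforward mX mp' (integrableS _ mXE _ ip_))//.
  by rewrite [LHS]aE// -pE.
exists (@oX R d @^-1` N); split => //; first exact: mX_pre.
move=> o /= ho; apply: subN => /= h; apply: ho.
by have [] := h I.
Qed.

End cond_exp_facts.

Section facts.
Context {R : realType} {d : nat}.
Local Notation obsd := (obs (R := R) d).

(** The interface between a law and the analysis of the estimators.  A and Y are
    bounded random variables that agree almost surely with the two coordinates; p and b
    are bounded versions of the regression functions. *)
Record facts (B : R) (P : probability obsd R) (A Y : obsd -> R) (p b : d.-tuple R -> R) : Prop := {
  f_A : bm A; f_Y : bm Y;
  f_AB : forall o, `|A o| <= B; f_YB : forall o, `|Y o| <= B;
  f_p : bm p; f_b : bm b;
  f_X : forall h, bm h -> Ex P (fun o => h (oX o)) = Ex (unif d) h;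
  f_Ap : forall g : d.-tuple R -> R, bm g -> Ex P (fun o => A o * g (oX o)) = ip p g;
  f_Yb : forall g : d.-tuple R -> R, bm g -> Ex P (fun o => Y o * g (oX o)) = ip b g;
  f_psi : psi P = Ex P (fun o => A o * Y o) - ip p b;
  f_ae : {ae P, forall o, [/\ oA o = A o, oY o = Y o & cube (oX o)]} }.

(** The formula for psi is E[(A - p(X))(Y - b(X))] = E[AY] - <p, b>.  The functional
    is defined from chosen versions of the regression functions: these agree with p and b
    almost surely, and the conditional covariance exists because the product of the residuals is
    almost surely equal to a bounded variable. *)
Lemma facts_of (B C1 C2 : R) (P : probability obsd R) (p b : d.-tuple R -> R) :
  B = `|C1| + `|C2| ->
  (forall D : set (d.-tuple R), measurable D -> P (@oX R d @^-1` D) = unif d D) ->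
  {ae P, forall o, C1 <= oA o <= C2 /\ C1 <= oY o <= C2} ->
  unif_cont_cube p -> unif_cont_cube b ->
  is_cond_exp P (@oX R d) (@oA R d) p -> is_cond_exp P (@oX R d) (@oY R d) b ->
  facts B P (fun o => clamp B (oA o)) (fun o => clamp B (oY o))
    (patch_cube p) (patch_cube b).
Proof.
move=> BE PX aeC up ub cp cb.
have B0 : 0 <= B by rewrite BE addr_ge0.
pose A (o : obsd) := clamp B (oA o); pose Y (o : obsd) := clamp B (oY o).
have bA : bm A by apply: bm_clamp => //; exact: measurable_oA.
have bY : bm Y by apply: bm_clamp => //; exact: measurable_oY.
have bp : bm (patch_cube p) by apply: bm_patch_cube => //; case: cp.
have bb : bm (patch_cube b) by apply: bm_patch_cube => //; case: cb.
have inB v : C1 <= v <= C2 -> clamp B v = v.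
  move=> /andP[h1 h2]; apply: clamp_id; rewrite BE.
  have := ler_norm C2; have := ler_norm (- C1); rewrite normrN => h3 h4.
  have := normr_ge0 C1; have := normr_ge0 C2 => h5 h6.
  rewrite ler_norml; apply/andP; split; lra.
have aeAY : {ae P, forall o, A o = oA o /\ Y o = oY o}.
  by apply: filterS aeC => o /= [h1 h2]; rewrite /A /Y !inB.
have aeA : {ae P, forall o, A o = oA o} by apply: filterS aeAY => o /= [].
have aeY : {ae P, forall o, Y o = oY o} by apply: filterS aeAY => o /= [].
have hAp := cond_exp_pull PX bA (@measurable_oA R d) aeA bp cp.
have hYb := cond_exp_pull PX bY (@measurable_oY R d) aeY bb cb.
have ae3 : {ae P, forall o, [/\ oA o = A o, oY o = Y o & cube (oX o)]}.
  by apply: filterS2 aeAY (ae_cube PX) => o /= [-> ->].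
split => //.
- by move=> o; exact: clamp_le.
- by move=> o; exact: clamp_le.
- by move=> h bh; exact: Ex_law_X.
rewrite /psi.
set a := cond_exp P (@oX R d) (@oA R d); set y := cond_exp P (@oX R d) (@oY R d).
have ca : is_cond_exp P (@oX R d) (@oA R d) a.
  by apply: (@xgetPex _ (cst 0) [set g | is_cond_exp P (@oX R d) (@oA R d) g]); exists p.
have cy : is_cond_exp P (@oX R d) (@oY R d) y.
  by apply: (@xgetPex _ (cst 0) [set g | is_cond_exp P (@oX R d) (@oY R d) g]); exists b.
pose f (o : obsd) := (oA o - a (oX o)) * (oY o - y (oX o)).
pose f' (o : obsd) := (A o - patch_cube p (oX o)) * (Y o - patch_cube b (oX o)).
have bpX := bm_oX bp; have bbX := bm_oX bb.
have bf' : bm f' by rewrite /f'; bmt.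
have mf : measurable_fun setT f.
  have [ma _ _] := ca; have [my _ _] := cy.
  apply: measurable_funM; apply: measurable_funB.
  - exact: measurable_oA.
  - exact: (measurableT_comp ma (@measurable_oX R d)).
  - exact: measurable_oY.
  - exact: (measurableT_comp my (@measurable_oX R d)).
have ff' : {ae P, forall o, f o = f' o}.
  have ua := cond_exp_unique ca cp; have uy := cond_exp_unique cy cb.
  have h : {ae P, forall o, a (oX o) = p (oX o) /\ y (oX o) = b (oX o)}.
    by apply: filterS2 ua uy => o /= -> ->.
  apply: filterS2 h ae3 => o /= [h1 h2] [h3 h4 cx].
  by rewrite /f /f' h1 h2 h3 h4 !patch_cubeE.
have intf (D : set (d.-tuple R)) : measurable D ->
    (\int[P]_(o in @oX R d @^-1` D) (f o)%:E = \int[P]_(o in @oX R d @^-1` D) (f' o)%:E)%E.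
  move=> mD; have mXD := mX_pre mD; apply: ae_eq_integral => //.
  - exact/measurable_funTS/measurable_EFinP.
  - exact/measurable_funTS/measurable_EFinP/bm_meas.
  - by apply: filterS ff' => o /= ->.
have [g [mg ig gE]] := cond_exp_exists P (@oX R d) bf'.
have cg : is_cond_exp P (@oX R d) f g by split => // D mD; rewrite gE// intf.
have [_ _ /(_ setT measurableT)] : is_cond_exp P (@oX R d) f (cond_exp P (@oX R d) f).
  by apply: (@xgetPex _ (cst 0) [set g | is_cond_exp P (@oX R d) f g]); exists g.
rewrite intf// preimage_setT -(EFin_Ex P bf') => cE.
rewrite unlock /cond_cov -/a -/y [X in fine X]cE /=.
rewrite /f' (eq_Ex (fun o => A o * Y o - A o * patch_cube b (oX o) -
   Y o * patch_cube p (oX o) + patch_cube p (oX o) * patch_cube b (oX o))); last first.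
  by move=> o; ring.
rewrite ExD; [|by bmt..]; rewrite ExB; [|by bmt..]; rewrite ExB; [|by bmt..].
rewrite hAp// hYb// (ipC (patch_cube b)) (Ex_law_X PX (bmM bp bb)) /ip; ring.
Qed.

End facts.

(** * Mean and variance of the estimators under a law *)

Section estimator_moments.
Context {R : realType} {J0 S : nat} (w : cdv_basis R J0 S) {d : nat}.
Hypothesis S_ge1 : (1 <= S)%N.
Local Notation obsd := (obs (R := R) d).
Variables (B : R) (P : probability obsd R) (A Y : obsd -> R) (p b : d.-tuple R -> R).
Hypothesis hf : facts B P A Y p b.

Let bA := f_A hf.
Let bY := f_Y hf.
Let bp := f_p hf.
Let bb := f_b hf.

Definition EAY (g : d.-tuple R -> R) : R := Ex P (fun o => A o * Y o * g (oX o)).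

Definition kdiag j (x : d.-tuple R) : R := K w j x x.

Let bmX (h : d.-tuple R -> R) : bm h -> bm (fun o : obsd => h (oX o)).
Proof. exact: bm_oX. Qed.

Lemma Ex_Y_K j x : Ex P (fun o => Y o * K w j x (oX o)) = vproj w j b x.
Proof. by rewrite (f_Yb hf (bm_K w S_ge1 j x)) ipC. Qed.

Lemma Ex_A_K j x : Ex P (fun o => A o * K w j x (oX o)) = vproj w j p x.
Proof. by rewrite (f_Ap hf (bm_K w S_ge1 j x)) ipC. Qed.

Lemma Ex_clean_U2 j n :
  Ex (iid P n) (U2 A Y (Kobs w j)) =
  n%:R * (n%:R - 1) * ip p (vproj w j b) + n%:R * EAY (kdiag j).
Proof.
rewrite (Ex_U2 P bA bY n (bm_Kobs w S_ge1 j)); congr (_ * _ + _).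
rewrite -(f_Ap hf (bm_proj w S_ge1 j bb)); apply: eq_Ex => x.
have bKX := bmX (bm_K w S_ge1 j (oX x)).
rewrite (eq_Ex (fun y => A x * (Y y * Kobs w j x y))); last by move=> y; rewrite mulrA.
rewrite ExZl; last by apply: bmM.
by rewrite [X in _ * X]Ex_Y_K.
Qed.

Lemma EAY_cube g h : bm g -> bm h -> (forall x, cube x -> g x = h x) -> EAY g = EAY h.
Proof.
move=> bg bh gh; have bgX := bmX bg; have bhX := bmX bh.
apply: Ex_ae; [by bmt..|]; apply: filterS (f_ae hf) => o /= [_ _ cx].
by rewrite gh.
Qed.

(** The five patterns of [Ex_U3].  In the first one the centre has the uniform law, and
    integrating out the two arguments leaves <P_j1 p, P_j2 b>, the inner product with
    the projection on the smaller space; in the second one the centre is integrated out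
    and leaves the kernel of the smaller space on the diagonal. *)
Lemma Ex_clean_U3 j1 j2 n : (J0 <= j1)%N -> (J0 <= j2)%N ->
  Ex (iid P n) (U3 A Y (Kobs w j1) (Kobs w j2)) =
  n%:R * (n%:R - 1) * (n%:R - 2) * ip p (vproj w (minn j1 j2) b) +
  n%:R * (n%:R - 1) * (EAY (kdiag (minn j1 j2)) +
    ip p (fun x => kdiag j1 x * vproj w j2 b x) +
    ip b (fun x => kdiag j2 x * vproj w j1 p x)) +
  n%:R * EAY (fun x => kdiag j1 x * kdiag j2 x).
Proof.
move=> j1J j2J.
have bK j x := bmX (bm_K w S_ge1 j x).
have [bp1 bb2] := (bm_proj w S_ge1 j1 bp, bm_proj w S_ge1 j2 bb).
have bd j := bm_Kdiag w S_ge1 (d := d) j.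
have Kr (j : nat) (o o' : obsd) : Kobs w j o o' = K w j (oX o') (oX o) by exact: K_sym.
rewrite (Ex_U3 P bA bY n (bm_Kobs w S_ge1 j1) (bm_Kobs w S_ge1 j2)).
congr (_ * _ + _ * (_ + _ + _) + _ * _).
- rewrite -(ip_proj_proj w S_ge1 j1J j2J bp bb) /ip -(f_X hf (bmM bp1 bb2)).
  apply: eq_Ex => z.
  rewrite (eq_Ex (fun x => (A x * K w j1 (oX z) (oX x)) * vproj w j2 b (oX z))).
    by rewrite ExZr ?Ex_A_K//; bmt.
  move=> x.
  rewrite (eq_Ex (fun y => (A x * K w j1 (oX z) (oX x)) * (Y y * K w j2 (oX z) (oX y)))).
    by rewrite ExZl ?Ex_Y_K//; bmt.
  by move=> y; rewrite !Kr.
- rewrite -(EAY_cube (g := fun x => Ex (unif d) (fun u => K w j1 x u * K w j2 x u))).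
  + apply: eq_Ex => x.
    rewrite (eq_Ex (fun z => (A x * Y x) * (K w j1 (oX x) (oX z) * K w j2 (oX x) (oX z)))).
      rewrite ExZl; last by bmt.
      by rewrite (f_X hf (bmM (bm_K w S_ge1 j1 (oX x)) (bm_K w S_ge1 j2 (oX x)))).
    by move=> z; rewrite /Kobs; ring.
  + apply: (@bm_comp _ _ _ _ _ _ (fun x => (x, x)) (bm_KK2 w S_ge1 j1 j2)).
    exact: measurable_fun_pair.
  + exact: bd.
  + by move=> x cx; rewrite K_K_min.
- rewrite -(f_Ap hf (bmM (bd j1) bb2)); apply: eq_Ex => x.
  rewrite (eq_Ex (fun y => (A x * kdiag j1 (oX x)) * (Y y * K w j2 (oX x) (oX y)))).
    by rewrite ExZl ?Ex_Y_K ?mulrA//; bmt.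
  by move=> y; rewrite (Kr j2).
- rewrite -(f_Yb hf (bmM (bd j2) bp1)); apply: eq_Ex => y.
  rewrite (eq_Ex (fun x => (A x * K w j1 (oX y) (oX x)) * (Y y * kdiag j2 (oX y)))).
    rewrite ExZr; last by bmt.
    by rewrite Ex_A_K /kdiag; ring.
  by move=> x; rewrite (Kr j1).
- by apply: eq_Ex => x; rewrite /Kobs /kdiag /=; ring.
Qed.

(** Everywhere bounded random variables that are almost surely equal to the
    estimators. *)
Definition clean_INT n j1 j2 (s : n.-tuple obsd) : R :=
  n%:R^-1 * U1 A Y s - n%:R^-1 ^+ 2 * U2 A Y (Kobs w (minn j1 j2)) s.
Definition clean_MC n j1 j2 (s : n.-tuple obsd) : R :=
  n%:R^-1 * U1 A Y s - n%:R^-1 ^+ 3 * U3 A Y (Kobs w j1) (Kobs w j2) s.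
Definition clean_IF n j1 j2 (s : n.-tuple obsd) : R :=
  n%:R^-1 * U1 A Y s - n%:R^-1 ^+ 2 * U2 A Y (Kobs w j1) s -
    n%:R^-1 ^+ 2 * U2 A Y (Kobs w j2) s +
    n%:R^-1 ^+ 3 * U3 A Y (Kobs w j1) (Kobs w j2) s.

Let bU1 n : bm (fun s : n.-tuple obsd => U1 A Y s).
Proof. by apply: bm_sum => i; apply: bmM; exact: bm_tnth. Qed.

Let bU2 n j : bm (fun s : n.-tuple obsd => U2 A Y (Kobs w j) s).
Proof.
do 2 apply: bm_sum => ?; apply: bmM; last exact: bm_tnth2 (bm_Kobs w S_ge1 j).
by apply: bmM; exact: bm_tnth.
Qed.

Let bU3 n j1 j2 : bm (fun s : n.-tuple obsd => U3 A Y (Kobs w j1) (Kobs w j2) s).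
Proof.
do 3 apply: bm_sum => ?; apply: bmM; apply: bmM.
- exact: bm_tnth.
- exact: bm_tnth2 (bm_Kobs w S_ge1 j1).
- exact: bm_tnth.
- exact: bm_tnth2 (bm_Kobs w S_ge1 j2).
Qed.

Lemma bm_clean_INT n j1 j2 : bm (@clean_INT n j1 j2).
Proof. by have b1 := bU1 n; have b2 := bU2 n; rewrite /clean_INT; bmt. Qed.
Lemma bm_clean_MC n j1 j2 : bm (@clean_MC n j1 j2).
Proof. by have b1 := bU1 n; have b2 := bU3 n; rewrite /clean_MC; bmt. Qed.
Lemma bm_clean_IF n j1 j2 : bm (@clean_IF n j1 j2).
Proof.
by have b1 := bU1 n; have b2 := bU2 n; have b3 := bU3 n; rewrite /clean_IF; bmt.
Qed.

Let ae_good n := iid_ae n (f_ae hf).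

Lemma ae_INT n j1 j2 : (J0 <= j1)%N -> (J0 <= j2)%N ->
  {ae iid P n, forall s, psi_INT w j1 j2 s = clean_INT j1 j2 s}.
Proof.
move=> j1J j2J; apply: filterS (ae_good n) => s /= gs.
rewrite psi_INTE// /clean_INT /U1 /U2; congr (_ * _ - _ * _).
  by apply: eq_bigr => i _; have [-> -> _] := gs i.
apply: eq_bigr => i _; apply: eq_bigr => k _.
have [-> _ ci] := gs i; have [_ -> ck] := gs k; congr (_ * _ * _).
by rewrite /KKobs K_K_min.
Qed.

Lemma ae_MC n j1 j2 : {ae iid P n, forall s, psi_MC w j1 j2 s = clean_MC j1 j2 s}.
Proof.
apply: filterS (ae_good n) => s /= gs.
rewrite psi_MCE// /clean_MC /U1 /U3; congr (_ * _ - _ * _).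
  by apply: eq_bigr => i _; have [-> -> _] := gs i.
apply: eq_bigr => i _; apply: eq_bigr => a _; apply: eq_bigr => k _.
by have [-> _ _] := gs a; have [_ -> _] := gs k.
Qed.

Lemma ae_IF n j1 j2 : {ae iid P n, forall s, psi_IF w j1 j2 s = clean_IF j1 j2 s}.
Proof.
apply: filterS (ae_good n) => s /= gs.
have h2 j : U2 (@oA R d) (@oY R d) (Kobs w j) s = U2 A Y (Kobs w j) s.
  apply: eq_bigr => i _; apply: eq_bigr => k _.
  by have [-> _ _] := gs i; have [_ -> _] := gs k.
rewrite psi_IFE// /clean_IF !h2 /U1 /U3; congr (_ * _ - _ - _ + _ * _).
  by apply: eq_bigr => i _; have [-> -> _] := gs i.
apply: eq_bigr => i _; apply: eq_bigr => a _; apply: eq_bigr => k _.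
by have [-> _ _] := gs a; have [_ -> _] := gs k.
Qed.

Lemma measurable_INT n j1 j2 : measurable_fun setT (fun s : n.-tuple obsd => psi_INT w j1 j2 s).
Proof.
have [mA mY] := (@measurable_oA R d, @measurable_oY R d).
rewrite (funext (psi_INTE w S_ge1 j1 j2)); apply: measurable_funB;
  apply: measurable_funM => //.
- exact: measurable_U1.
- by apply: measurable_U2 => //; exact: bm_KKobs.
Qed.

Lemma measurable_MC n j1 j2 : measurable_fun setT (fun s : n.-tuple obsd => psi_MC w j1 j2 s).
Proof.
have [mA mY] := (@measurable_oA R d, @measurable_oY R d).
rewrite (funext (@psi_MCE _ _ _ w d n j1 j2)); apply: measurable_funB;
  apply: measurable_funM => //.
- exact: measurable_U1.
- by apply: measurable_U3 => //; exact: bm_Kobs.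
Qed.

Lemma measurable_IF n j1 j2 : measurable_fun setT (fun s : n.-tuple obsd => psi_IF w j1 j2 s).
Proof.
have [mA mY] := (@measurable_oA R d, @measurable_oY R d).
rewrite (funext (@psi_IFE _ _ _ w d n j1 j2)).
apply: measurable_funD; first (apply: measurable_funB; first apply: measurable_funB);
  apply: measurable_funM => //.
- exact: measurable_U1.
- by apply: measurable_U2 => //; exact: bm_Kobs.
- by apply: measurable_U2 => //; exact: bm_Kobs.
- by apply: measurable_U3 => //; exact: bm_Kobs.
Qed.

Lemma expectation_shift n (f g : n.-tuple obsd -> R) : measurable_fun setT f -> bm g ->
  {ae iid P n, forall s, f s = g s} ->
  ('E_(iid P n)[fun s => (f s - psi P)%R] = (Ex (iid P n) g - psi P)%:E)%E.
Proof.
move=> mf bg fg; rewrite (expectation_ae (g := fun s => g s - psi P)).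
- by rewrite ExB ?Ex_cst//; exact: bm_cst.
- by apply: measurable_funB => //; exact: measurable_cst.
- by bmt.
- by apply: filterS fg => s /= ->.
Qed.

(** The means of U3/n^3 and of U2/n^2. *)
Definition bracket3 (n : nat) j1 j2 : R :=
  (1 - n%:R^-1) * (1 - 2 * n%:R^-1) * ip p (vproj w (minn j1 j2) b) +
  n%:R^-1 * (1 - n%:R^-1) * (EAY (kdiag (minn j1 j2)) +
    ip p (fun x => kdiag j1 x * vproj w j2 b x) +
    ip b (fun x => kdiag j2 x * vproj w j1 p x)) +
  n%:R^-1 ^+ 2 * EAY (fun x => kdiag j1 x * kdiag j2 x).

Definition bracket2 (n : nat) j : R :=
  (1 - n%:R^-1) * ip p (vproj w j b) + n%:R^-1 * EAY (kdiag j).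

Lemma Ex_scaled_U1 n : (0 < n)%N ->
  n%:R^-1 * Ex (iid P n) (U1 A Y) - psi P = ip p b.
Proof.
move=> n0; rewrite Ex_U1// (f_psi hf) mulrA mulVf ?pnatr_eq0 -?lt0n// mul1r; ring.
Qed.

Lemma Ex_scaled_U2 n j : (0 < n)%N ->
  n%:R^-1 ^+ 2 * Ex (iid P n) (U2 A Y (Kobs w j)) = bracket2 n j.
Proof.
move=> n0; rewrite Ex_clean_U2 /bracket2; field.
by rewrite pnatr_eq0 -lt0n.
Qed.

Lemma Ex_scaled_U3 n j1 j2 : (0 < n)%N -> (J0 <= j1)%N -> (J0 <= j2)%N ->
  n%:R^-1 ^+ 3 * Ex (iid P n) (U3 A Y (Kobs w j1) (Kobs w j2)) = bracket3 n j1 j2.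
Proof.
move=> n0 j1J j2J; rewrite Ex_clean_U3// /bracket3.
have n0' : n%:R != 0 :> R by rewrite pnatr_eq0 -lt0n.
have alg (N u v t : R) : N != 0 -> N^-1 ^+ 3 * (N * (N - 1) * (N - 2) * u +
    N * (N - 1) * v + N * t) =
    (1 - N^-1) * (1 - 2 * N^-1) * u + N^-1 * (1 - N^-1) * v + N^-1 ^+ 2 * t.
  by move=> N0; field.
exact: alg.
Qed.

Lemma bias_INT n j1 j2 : (0 < n)%N -> (J0 <= j1)%N -> (J0 <= j2)%N ->
  ('E_(iid P n)[fun s => (psi_INT w j1 j2 s - psi P)%R] =
   (ip p b - bracket2 n (minn j1 j2))%:E)%E.
Proof.
move=> n0 j1J j2J; have [b1 b2] := (bU1 n, bU2 n).
rewrite (expectation_shift (@measurable_INT n j1 j2) (bm_clean_INT n j1 j2) (ae_INT n j1J j2J)).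
congr EFin; rewrite /clean_INT ExB; [|by bmt..].
by rewrite !ExZl// Ex_scaled_U2// -[in RHS](Ex_scaled_U1 n0); ring.
Qed.

Lemma bias_MC n j1 j2 : (0 < n)%N -> (J0 <= j1)%N -> (J0 <= j2)%N ->
  ('E_(iid P n)[fun s => (psi_MC w j1 j2 s - psi P)%R] =
   (ip p b - bracket3 n j1 j2)%:E)%E.
Proof.
move=> n0 j1J j2J; have [b1 b3] := (bU1 n, bU3 n).
rewrite (expectation_shift (@measurable_MC n j1 j2) (bm_clean_MC n j1 j2) (ae_MC n j1 j2)).
congr EFin; rewrite /clean_MC ExB; [|by bmt..].
by rewrite !ExZl// Ex_scaled_U3// -[in RHS](Ex_scaled_U1 n0); ring.
Qed.

Lemma bias_IF n j1 j2 : (0 < n)%N -> (J0 <= j1)%N -> (J0 <= j2)%N ->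
  ('E_(iid P n)[fun s => (psi_IF w j1 j2 s - psi P)%R] =
   (ip p b - bracket2 n j1 - bracket2 n j2 + bracket3 n j1 j2)%:E)%E.
Proof.
move=> n0 j1J j2J; have [b1 b2 b3] := And3 (bU1 n) (bU2 n) (bU3 n).
rewrite (expectation_shift (@measurable_IF n j1 j2) (bm_clean_IF n j1 j2) (ae_IF n j1 j2)).
congr EFin; rewrite /clean_IF ExD; [|by bmt..]; rewrite ExB; [|by bmt..].
rewrite ExB; [|by bmt..].
by rewrite !ExZl// Ex_scaled_U3// !Ex_scaled_U2// -[in RHS](Ex_scaled_U1 n0); ring.
Qed.

Variable c : R.
Hypothesis c_ge1 : 1 <= c.
Hypothesis Kc : forall j (x y : d.-tuple R), `|K w j x y| <= c * (res d j)%:R.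
Hypothesis Kint : forall j (x : d.-tuple R), Ex (unif d) (fun y => `|K w j x y|) <= c.

Lemma Kobs_size j : kernel_of_size P c (res d j)%:R (Kobs w j).
Proof.
split; first exact: bm_Kobs; first by move=> o o'; exact: K_sym.
split=> //.
- exact: bm_norm (bm_Kobs w S_ge1 j).
- by move=> o o'; rewrite /Kobs K_sym.
- by move=> o o'; exact: Kc.
- move=> o; rewrite (eq_Ex (fun o' => `|K w j (oX o) (oX o')|)); last first.
    by move=> o'; rewrite /Kobs K_sym.
  by rewrite (f_X hf (bm_norm (bm_K w S_ge1 j (oX o)))).
Qed.

Let B0 : 0 <= B.
Proof.
apply: le_trans (f_AB hf ([tuple 0 | i < d], 0, 0)); exact: normr_ge0.
Qed.

Let c0 : 0 <= c. Proof. exact: le_trans c_ge1. Qed.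

Lemma Var_scaled_U1 n : (0 < n)%N ->
  Var (iid P n) (fun s => n%:R^-1 * U1 A Y s) <= B ^+ 4 * n%:R^-1.
Proof.
move=> n0; rewrite VarZ; last exact: bU1.
have np : 0 < n%:R :> R by rewrite ltr0n.
apply: (@le_trans _ _ (n%:R^-1 ^+ 2 * (n%:R * B ^+ 4))).
  by rewrite ler_wpM2l ?exprn_ge0//; exact: (Var_U1 P bA bY (f_AB hf) (f_YB hf) B0).
by rewrite le_eqVlt; apply/orP; left; apply/eqP; field; rewrite gt_eqF.
Qed.

Lemma Var_scaled_U2 n j : (0 < n)%N ->
  Var (iid P n) (fun s => n%:R^-1 ^+ 2 * U2 A Y (Kobs w j) s) <=
  72 * B ^+ 4 * c ^+ 2 * (n%:R^-1 + (res d j)%:R / n%:R ^+ 2 + (res d j)%:R ^+ 2 / n%:R ^+ 3).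
Proof.
move=> n0; rewrite VarZ; last exact: bU2.
have np : 0 < n%:R :> R by rewrite ltr0n.
have h := Var_U2 bA bY (f_AB hf) (f_YB hf) c0 B0 n (Kobs_size j).
apply: (le_trans (ler_wpM2l _ h)); first by rewrite !exprn_ge0.
by rewrite le_eqVlt; apply/orP; left; apply/eqP; rewrite /mom_bound; field; rewrite gt_eqF.
Qed.

Lemma Var_scaled_U3 n j1 j2 : (0 < n)%N ->
  Var (iid P n) (fun s => n%:R^-1 ^+ 3 * U3 A Y (Kobs w j1) (Kobs w j2) s) <=
  2916 * B ^+ 4 * c ^+ 4 *
   ((n%:R ^+ 2 + n%:R * (res d j1)%:R + (res d j1)%:R ^+ 2) *
    (n%:R ^+ 2 + n%:R * (res d j2)%:R + (res d j2)%:R ^+ 2) / n%:R ^+ 5).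
Proof.
move=> n0; rewrite VarZ; last exact: bU3.
have np : 0 < n%:R :> R by rewrite ltr0n.
have h := Var_U3 bA bY (f_AB hf) (f_YB hf) c0 B0 n (Kobs_size j1) (Kobs_size j2).
apply: (le_trans (ler_wpM2l _ h)); first by rewrite !exprn_ge0.
by rewrite le_eqVlt; apply/orP; left; apply/eqP; rewrite /mom_bound; field; rewrite gt_eqF.
Qed.

End estimator_moments.

(** * Rates for the bias and the variance under a law *)

Section upper_bounds.
Context {R : realType} {J0 S : nat} (w : cdv_basis R J0 S) {d : nat}.
Hypothesis S_ge1 : (1 <= S)%N.
Local Notation obsd := (obs (R := R) d).
Variables (B : R) (P : probability obsd R) (A Y : obsd -> R) (p b : d.-tuple R -> R).
Hypothesis hf : facts B P A Y p b.
Variable c : R.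
Hypothesis c_ge1 : 1 <= c.
Hypothesis Kc : forall j (x y : d.-tuple R), `|K w j x y| <= c * (res d j)%:R.
Hypothesis Kint : forall j (x : d.-tuple R), Ex (unif d) (fun y => `|K w j x y|) <= c.
Local Notation k j := ((res d j)%:R : R).
Local Notation EAY := (EAY P A Y).
Local Notation kdiag := (kdiag w).

Let bA := f_A hf.
Let bY := f_Y hf.
Let bp := f_p hf.
Let bb := f_b hf.
Let c0 : 0 <= c. Proof. exact: le_trans c_ge1. Qed.
Let B0 : 0 <= B.
Proof. by apply: le_trans (f_AB hf ([tuple 0 | i < d], 0, 0)); exact: normr_ge0. Qed.
Let bmX (h : d.-tuple R -> R) : bm h -> bm (fun o : obsd => h (oX o)).
Proof. exact: bm_oX. Qed.

Lemma k_ge1 j : 1 <= k j.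
Proof. by rewrite ler1n /res expn_gt0. Qed.

Lemma EAY_le g G : bm g -> 0 <= G -> (forall x, `|g x| <= G) -> `|EAY g| <= B ^+ 2 * G.
Proof.
move=> bg G0 gG; have bgX := bmX bg.
apply: norm_Ex_le; first by bmt.
move=> o; rewrite !normrM expr2; apply: ler_pM; rewrite ?mulr_ge0//.
by apply: ler_pM => //; [exact: (f_AB hf)|exact: (f_YB hf)].
Qed.

Lemma ipA_le g G : bm g -> 0 <= G -> (forall x, `|g x| <= G) -> `|ip p g| <= B * G.
Proof.
move=> bg G0 gG; have bgX := bmX bg; rewrite -(f_Ap hf bg).
apply: norm_Ex_le; first by bmt.
by move=> o; rewrite normrM; apply: ler_pM => //; exact: (f_AB hf).
Qed.

Lemma ipY_le g G : bm g -> 0 <= G -> (forall x, `|g x| <= G) -> `|ip b g| <= B * G.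
Proof.
move=> bg G0 gG; have bgX := bmX bg; rewrite -(f_Yb hf bg).
apply: norm_Ex_le; first by bmt.
by move=> o; rewrite normrM; apply: ler_pM => //; exact: (f_YB hf).
Qed.

(** The bound is in terms of B, not of the sup norm of p and b: the projection of b at x
    is the mean of Y K(x, X). *)
Lemma vproj_law_le j x : `|vproj w j b x| <= c * B /\ `|vproj w j p x| <= c * B.
Proof.
have bKX := bmX (bm_K w S_ge1 j x).
have hK : Ex P (fun o => `|K w j x (oX o)|) <= c.
  by rewrite (f_X hf (bm_norm (bm_K w S_ge1 j x))).
split.
- rewrite -(Ex_Y_K w S_ge1 hf); apply: (le_trans (norm_Ex _ _)); first by bmt.
  apply: (@le_trans _ _ (Ex P (fun o => `|K w j x (oX o)| * B))).
    apply: le_Ex; [by bmt..|] => o; rewrite normrM mulrC ler_wpM2l//; exact: (f_YB hf).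
  by rewrite ExZr; [rewrite ler_wpM2r|bmt].
- rewrite -(Ex_A_K w S_ge1 hf); apply: (le_trans (norm_Ex _ _)); first by bmt.
  apply: (@le_trans _ _ (Ex P (fun o => `|K w j x (oX o)| * B))).
    apply: le_Ex; [by bmt..|] => o; rewrite normrM mulrC ler_wpM2l//; exact: (f_AB hf).
  by rewrite ExZr; [rewrite ler_wpM2r|bmt].
Qed.

Let bd j : bm (kdiag j : d.-tuple R -> R). Proof. exact: bm_Kdiag. Qed.

Lemma kdiag_le j (x : d.-tuple R) : `|kdiag j x| <= c * k j.
Proof. exact: Kc. Qed.

Let E := c ^+ 2 * B ^+ 2.
Let E0 : 0 <= E. Proof. by rewrite mulr_ge0 ?sqr_ge0. Qed.
Let cE : c * B ^+ 2 <= E.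
Proof. by rewrite /E expr2 ler_wpM2r ?sqr_ge0// ler_peMl. Qed.

Lemma Q_le j : `|ip p (vproj w j b)| <= E.
Proof.
apply: (le_trans (ipA_le (bm_proj w S_ge1 j bb) _ (fun x => (vproj_law_le j x).1))).
  exact: mulr_ge0.
by rewrite (_ : B * (c * B) = c * B ^+ 2); [exact: cE|ring].
Qed.

Lemma M1_le j : `|EAY (kdiag j)| <= E * k j.
Proof.
apply: (le_trans (EAY_le (bd j) _ (kdiag_le j))); first by rewrite mulr_ge0.
by rewrite mulrA ler_wpM2r// mulrC.
Qed.

Lemma M2_le j1 j2 : `|EAY (fun x => kdiag j1 x * kdiag j2 x)| <= E * (k j1 * k j2).
Proof.
have b12 : bm (fun x : d.-tuple R => kdiag j1 x * kdiag j2 x) by exact: bmM.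
apply: (le_trans (EAY_le (G := (c * k j1) * (c * k j2)) b12 _ _)).
- by rewrite !mulr_ge0.
- by move=> x; rewrite normrM; apply: ler_pM => //; exact: kdiag_le.
by rewrite le_eqVlt /E; apply/orP; left; apply/eqP; ring.
Qed.

Lemma A1_le j1 j2 : `|ip p (fun x => kdiag j1 x * vproj w j2 b x)| <= E * k j1.
Proof.
have b12 : bm (fun x : d.-tuple R => kdiag j1 x * vproj w j2 b x).
  by apply: bmM => //; exact: bm_proj.
apply: (le_trans (ipA_le (G := (c * k j1) * (c * B)) b12 _ _)).
- by rewrite !mulr_ge0.
- move=> x; rewrite normrM; apply: ler_pM => //; first exact: kdiag_le.
  exact: (vproj_law_le j2 x).1.
by rewrite le_eqVlt /E; apply/orP; left; apply/eqP; ring.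
Qed.

Lemma A2_le j1 j2 : `|ip b (fun x => kdiag j2 x * vproj w j1 p x)| <= E * k j2.
Proof.
have b12 : bm (fun x : d.-tuple R => kdiag j2 x * vproj w j1 p x).
  by apply: bmM => //; exact: bm_proj.
apply: (le_trans (ipY_le (G := (c * k j2) * (c * B)) b12 _ _)).
- by rewrite !mulr_ge0.
- move=> x; rewrite normrM; apply: ler_pM => //; first exact: kdiag_le.
  exact: (vproj_law_le j1 x).2.
by rewrite le_eqVlt /E; apply/orP; left; apply/eqP; ring.
Qed.

Lemma inv_n n : (0 < n)%N -> 0 <= (n%:R^-1 : R) <= 1.
Proof.
move=> n0; rewrite invr_ge0 ler0n /= invf_le1 ?ltr0n// ler1n//.
Qed.

Lemma bias_INT_le n j (T : R) : (0 < n)%N -> `|ip p b - ip p (vproj w j b)| <= T ->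
  `|ip p b - bracket2 w P A Y p b n j| <= T + 2 * E * (k j / n%:R).
Proof.
move=> n0; have /andP[u0 u1] := inv_n n0; rewrite /bracket2.
have := Q_le j; have := M1_le j; have := k_ge1 j.
move: (ip p (vproj _ _ _)) (EAY _) (ip p b) (n%:R^-1) u0 u1 (k j) => Q m t u u0 u1 kk.
move=> k1; rewrite !ler_norml => /andP[m1 m2] /andP[q1 q2] /andP[t1 t2].
have h1 := ler_wpM2l u0 m1; have h2 := ler_wpM2l u0 m2.
have h3 := ler_wpM2l u0 q1; have h4 := ler_wpM2l u0 q2.
have h5 : u * E <= E * (kk * u).
  by rewrite mulrC ler_wpM2l// ler_peMl.
by apply/andP; split; lra.
Qed.

(** Only k_1 k_2 / n^2 could exceed k_max / n; it is at most k_max / n as soon as k_min is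
    at most n. *)
Lemma bracket3_le n j1 j2 km kM : (0 < n)%N -> 0 <= km -> 1 <= kM -> km / n%:R <= 1 ->
  k (minn j1 j2) <= kM -> k j1 <= kM -> k j2 <= kM -> k j1 * k j2 = km * kM ->
  `|ip p (vproj w (minn j1 j2) b) - bracket3 w P A Y p b n j1 j2| <= 7 * E * (kM / n%:R).
Proof.
move=> n0 km0 kM1 kmn hm h1 h2 h12; have /andP[u0 u1] := inv_n n0; rewrite /bracket3.
have := Q_le (minn j1 j2); have := M1_le (minn j1 j2); have := A1_le j1 j2.
have := A2_le j1 j2; have := M2_le j1 j2; rewrite h12.
have {hm} := ler_wpM2l E0 hm; have {h1} := ler_wpM2l E0 h1; have {h2} := ler_wpM2l E0 h2.
have E1 := ler_wpM2l E0 kM1; rewrite mulr1 in E1.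
move: (ip p (vproj _ _ _)) (EAY (kdiag _)) (ip p _) (ip b _) (EAY _)
  (E * k j1) (E * k j2) (E * k (minn j1 j2)) => Q m a1 a2 mm e1 e2 em h2 h1 hm.
move: (n%:R^-1) u0 u1 kmn => u u0 u1 kmn.
move=> hmm ha2 ha1 hm' hQ.
have EkM0 : 0 <= E * kM by rewrite mulr_ge0// (le_trans _ kM1).
have f1 : `|Q| <= E * kM by apply: le_trans E1.
have f2 : `|m + a1 + a2| <= 3 * (E * kM).
  apply: (le_trans (ler_normD _ _)); apply: (le_trans (lerD (ler_normD _ _) (lexx _))); lra.
have f3 : `|u * mm| <= E * kM.
  rewrite normrM (ger0_norm u0); apply: (le_trans (ler_wpM2l u0 hmm)).
  rewrite (_ : u * _ = (E * kM) * (km * u)); last by ring.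
  by rewrite ler_piMr.
have -> : Q - ((1 - u) * (1 - 2 * u) * Q + u * (1 - u) * (m + a1 + a2) + u ^+ 2 * mm) =
  u * ((3 - 2 * u) * Q - (1 - u) * (m + a1 + a2) - u * mm) by ring.
rewrite normrM (ger0_norm u0) (_ : 7 * E * (kM * u) = u * (7 * (E * kM))); last by ring.
apply: ler_wpM2l => //.
apply: (le_trans (ler_normB _ _)); apply: (le_trans (lerD (ler_normB _ _) (lexx _))).
have g1 : `|(3 - 2 * u) * Q| <= 3 * (E * kM).
  rewrite normrM; apply: ler_pM => //; rewrite ger0_norm; lra.
have g2 : `|(1 - u) * (m + a1 + a2)| <= 3 * (E * kM).
  rewrite normrM -[leRHS]mul1r; apply: ler_pM => //; rewrite ger0_norm; lra.
lra.
Qed.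

Lemma bias_MC_le n j1 j2 km kM (T : R) : (0 < n)%N -> 0 <= km -> 1 <= kM -> km / n%:R <= 1 ->
  k (minn j1 j2) <= kM -> k j1 <= kM -> k j2 <= kM -> k j1 * k j2 = km * kM ->
  `|ip p b - ip p (vproj w (minn j1 j2) b)| <= T ->
  `|ip p b - bracket3 w P A Y p b n j1 j2| <= T + 7 * E * (kM / n%:R).
Proof.
move=> n0 km0 kM1 kmn hm h1 h2 h12 hT.
apply: (le_trans (ler_distD (ip p (vproj w (minn j1 j2) b)) _ _)).
by apply: lerD => //; exact: bracket3_le km0 kM1 kmn hm h1 h2 h12.
Qed.

(** The projections on the two spaces are those on the smaller and on the larger one, in
    some order; the former cancels with the one in the mean of U3. *)
Lemma bias_IF_le n j1 j2 km kM (T : R) : (0 < n)%N -> 0 <= km -> 1 <= kM -> km / n%:R <= 1 ->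
  k (minn j1 j2) <= kM -> k j1 <= kM -> k j2 <= kM -> k j1 * k j2 = km * kM ->
  `|ip p b - ip p (vproj w (maxn j1 j2) b)| <= T ->
  `|ip p b - bracket2 w P A Y p b n j1 - bracket2 w P A Y p b n j2 +
     bracket3 w P A Y p b n j1 j2| <= T + 11 * E * (kM / n%:R).
Proof.
move=> n0 km0 kM1 kmn hm h1 h2 h12 hT.
have := bracket3_le n0 km0 kM1 kmn hm h1 h2 h12.
set b3 := bracket3 _ _ _ _ _ _ _ _ _.
have hQ : ip p (vproj w j1 b) + ip p (vproj w j2 b) =
   ip p (vproj w (minn j1 j2) b) + ip p (vproj w (maxn j1 j2) b).
  by have [_|_] := leqP j1 j2; [by []|exact: addrC].
rewrite /bracket2; have /andP[u0 u1] := inv_n n0.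
have := Q_le j1; have := Q_le j2; have := M1_le j1; have := M1_le j2.
have {h1} := ler_wpM2l E0 h1; have {h2} := ler_wpM2l E0 h2.
have E1 := ler_wpM2l E0 kM1; rewrite mulr1 in E1.
move: hQ hT; move: (ip p (vproj w j1 b)) (ip p (vproj w j2 b)) (ip p (vproj w (minn _ _) b))
  (ip p (vproj w (maxn _ _) b)) (EAY (kdiag j1)) (EAY (kdiag j2)) (ip p b) => q1 q2 qm qM m1 m2 t.
move=> hQ hT h2 h1 hm2 hm1 hq2 hq1 h3.
rewrite (_ : 11 * E * _ = 7 * E * (kM / n%:R) + n%:R^-1 * (4 * (E * kM))); last by ring.
have -> : t - ((1 - n%:R^-1) * q1 + n%:R^-1 * m1) - ((1 - n%:R^-1) * q2 + n%:R^-1 * m2) + b3 =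
   (t - qM) - (qm - b3) + n%:R^-1 * (q1 + q2 - (m1 + m2)).
  rewrite (_ : qM = q1 + q2 - qm); [ring|rewrite hQ; ring].
apply: (le_trans (ler_normD _ _)); rewrite addrA; apply: lerD.
  by apply: (le_trans (ler_normB _ _)); exact: lerD.
rewrite normrM (ger0_norm u0) ler_wpM2l//.
apply: (le_trans (ler_normB _ _)); apply: (le_trans (lerD (ler_normD _ _) (ler_normD _ _))); lra.
Qed.

End upper_bounds.

Section variance_rates.
Context {R : realType}.

(** The variance rates of the integral estimator and of the other two. *)
Definition rate2 (n : nat) (k : R) : R := n%:R^-1 + k / n%:R ^+ 2 + k ^+ 2 / n%:R ^+ 3.

Definition rate3 (n : nat) (km kM : R) : R :=
  n%:R^-1 + kM / n%:R ^+ 2 + kM ^+ 2 / n%:R ^+ 3 + km * kM ^+ 2 / n%:R ^+ 4 +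
  km ^+ 2 * kM ^+ 2 / n%:R ^+ 5.

Lemma rate3_dom n km kM : (0 < n)%N -> 0 <= km -> km <= kM ->
  [/\ n%:R^-1 <= rate3 n km kM, rate2 n km <= rate3 n km kM, rate2 n kM <= rate3 n km kM &
  (n%:R ^+ 2 + n%:R * km + km ^+ 2) * (n%:R ^+ 2 + n%:R * kM + kM ^+ 2) / n%:R ^+ 5 <=
  3 * rate3 n km kM].
Proof.
move=> n0 m0 mM; have N0 : 0 < n%:R :> R by rewrite ltr0n.
have M0 : 0 <= kM by exact: le_trans mM.
rewrite /rate2 /rate3; set N : R := n%:R.
have i0 (e : nat) : 0 <= (N ^+ e)^-1 by rewrite invr_ge0 exprn_ge0// ltW.
have p1 : 0 <= N^-1 by rewrite invr_ge0 ltW.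
have t2 : 0 <= kM / N ^+ 2 by exact: mulr_ge0.
have t3 : 0 <= kM ^+ 2 / N ^+ 3 by rewrite mulr_ge0 ?sqr_ge0.
have t4 : 0 <= km * kM ^+ 2 / N ^+ 4 by rewrite !mulr_ge0.
have t5 : 0 <= km ^+ 2 * kM ^+ 2 / N ^+ 5 by rewrite !mulr_ge0 ?sqr_ge0.
have s2 : km / N ^+ 2 <= kM / N ^+ 2 by exact: ler_wpM2r.
have sq : km ^+ 2 <= kM ^+ 2 by rewrite lerXn2r ?nnegrE.
have s3 : km ^+ 2 / N ^+ 3 <= kM ^+ 2 / N ^+ 3 by exact: ler_wpM2r.
split; [lra|lra|lra|].
have -> : (N ^+ 2 + N * km + km ^+ 2) * (N ^+ 2 + N * kM + kM ^+ 2) / N ^+ 5 =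
  N^-1 + (km + kM) / N ^+ 2 + (kM ^+ 2 + km * kM + km ^+ 2) / N ^+ 3 +
  (km * kM ^+ 2 + km ^+ 2 * kM) / N ^+ 4 + km ^+ 2 * kM ^+ 2 / N ^+ 5.
  by field; rewrite gt_eqF.
have a2 : (km + kM) / N ^+ 2 <= 2 * (kM / N ^+ 2) by rewrite mulrDl; lra.
have a3 : (kM ^+ 2 + km * kM + km ^+ 2) / N ^+ 3 <= 3 * (kM ^+ 2 / N ^+ 3).
  rewrite mulrA ler_wpM2r//; have : km * kM <= kM ^+ 2 by rewrite expr2 ler_wpM2r.
  lra.
have a4 : (km * kM ^+ 2 + km ^+ 2 * kM) / N ^+ 4 <= 2 * (km * kM ^+ 2 / N ^+ 4).
  rewrite mulrA ler_wpM2r//; have : km ^+ 2 * kM <= km * kM ^+ 2.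
    by rewrite !expr2 -!mulrA ler_wpM2l// mulrC ler_wpM2l.
  lra.
lra.
Qed.

End variance_rates.

Section resolutions.
Context {R : realType} (d : nat).
Local Notation k j := ((res d j)%:R : R).

Lemma res_min j1 j2 : k (minn j1 j2) = Num.min (k j1) (k j2).
Proof.
case: (leqP j1 j2) => h; last move/ltnW in h.
  by rewrite min_l// ler_nat /res leq_pexp2l// leq_mul2r h orbT.
by rewrite min_r// ler_nat /res leq_pexp2l// leq_mul2r h orbT.
Qed.

Lemma res_max j1 j2 : k (maxn j1 j2) = Num.max (k j1) (k j2).
Proof.
case: (leqP j1 j2) => h; last move/ltnW in h.
  by rewrite max_r// ler_nat /res leq_pexp2l// leq_mul2r h orbT.
by rewrite max_l// ler_nat /res leq_pexp2l// leq_mul2r h orbT.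
Qed.

Lemma mul_min_max (x y : R) : x * y = Num.min x y * Num.max x y.
Proof. by case: (leP x y) => _ //; rewrite mulrC. Qed.

Lemma add_min_max (x y : R) : x + y = Num.min x y + Num.max x y.
Proof. by case: (leP x y) => _ //; rewrite addrC. Qed.

End resolutions.

Section law_variances.
Context {R : realType} {J0 S : nat} (w : cdv_basis R J0 S) {d : nat}.
Hypothesis S_ge1 : (1 <= S)%N.
Local Notation obsd := (obs (R := R) d).
Variables (B : R) (P : probability obsd R) (A Y : obsd -> R) (p b : d.-tuple R -> R).
Hypothesis hf : facts B P A Y p b.
Variable c : R.
Hypothesis c_ge1 : 1 <= c.
Hypothesis Kc : forall j (x y : d.-tuple R), `|K w j x y| <= c * (res d j)%:R.
Hypothesis Kint : forall j (x : d.-tuple R), Ex (unif d) (fun y => `|K w j x y|) <= c.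
Local Notation k j := ((res d j)%:R : R).
Local Notation kmin j1 j2 := (Num.min (k j1) (k j2)).
Local Notation kmax j1 j2 := (Num.max (k j1) (k j2)).

Variables (n j1 j2 : nat).
Hypothesis n_gt0 : (0 < n)%N.
Local Notation u1 := (fun s : n.-tuple obsd => n%:R^-1 * U1 A Y s).
Local Notation u2 j := (fun s : n.-tuple obsd => n%:R^-1 ^+ 2 * U2 A Y (Kobs w j) s).
Local Notation u3 := (fun s : n.-tuple obsd => n%:R^-1 ^+ 3 * U3 A Y (Kobs w j1) (Kobs w j2) s).

Let hK j := Kobs_size S_ge1 hf Kc Kint j.
Let b1 : bm u1.
Proof. by apply: bmM; [exact: bm_cst|exact: (bm_U1 (f_A hf) (f_Y hf))]. Qed.
Let b2 j : bm (u2 j).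
Proof. by have h := bm_U2 (f_A hf) (f_Y hf) n (hK j); apply: bmM; [exact: bm_cst|exact h]. Qed.
Let b3 : bm u3.
Proof.
by have h := bm_U3 (f_A hf) (f_Y hf) n (hK j1) (hK j2); apply: bmM; [exact: bm_cst|exact h].
Qed.

Let B4 : 0 <= B ^+ 4. Proof. by have := sqr_ge0 (B ^+ 2); rewrite -exprM. Qed.
Let c0 : 0 <= c. Proof. exact: le_trans c_ge1. Qed.
Let c2 : 0 <= c ^+ 2. Proof. exact: sqr_ge0. Qed.
Let c4 : 0 <= c ^+ 4. Proof. exact: exprn_ge0. Qed.
Let E2 := 72 * B ^+ 4 * c ^+ 2.
Let E3 := 2916 * B ^+ 4 * c ^+ 4.
Let E20 : 0 <= E2. Proof. by rewrite mulr_ge0// mulr_ge0. Qed.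
Let E30 : 0 <= E3. Proof. by apply: mulr_ge0 c4; apply: mulr_ge0 B4; exact: ler0n. Qed.

Let v1 := Var_scaled_U1 hf n_gt0.
Let v2 j := Var_scaled_U2 S_ge1 hf c_ge1 Kc Kint j n_gt0.
Let v3 := Var_scaled_U3 S_ge1 hf c_ge1 Kc Kint j1 j2 n_gt0.

Let n_inv_le x : 0 <= x -> (n%:R^-1 : R) <= rate2 n x.
Proof.
move=> x0; rewrite /rate2 -addrA lerDl addr_ge0// divr_ge0// ?exprn_ge0//.
Qed.

Lemma Var_clean_INT : Var (iid P n) (clean_INT w A Y j1 j2) <=
  (2 * B ^+ 4 + 2 * E2) * rate2 n (kmin j1 j2).
Proof.
rewrite -res_min; set J := minn j1 j2.
have bn : bm (fun s => - u2 J s) by exact: bmN.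
apply: (le_trans (VarD (iid P n) b1 bn)); rewrite VarN//.
have := ler_wpM2l B4 (n_inv_le (ler0n _ (res d J))); have := v1; have := v2 J.
rewrite -/(rate2 n (k J)) -/E2; move: (Var _ _) (Var _ _) => x y; lra.
Qed.

Let km0 : 0 <= kmin j1 j2. Proof. by rewrite -res_min. Qed.
Let mM : kmin j1 j2 <= kmax j1 j2. Proof. by rewrite ge_min le_max lexx. Qed.

Let v3' : Var (iid P n) u3 <= E3 * (3 * rate3 n (kmin j1 j2) (kmax j1 j2)).
Proof.
apply: (le_trans v3); rewrite -/E3 ler_wpM2l//.
have [_ _ _] := rate3_dom n_gt0 km0 mM; apply: le_trans.
by rewrite ler_wpM2r ?invr_ge0 ?exprn_ge0//; case: (leP (k j1) (k j2)) => _ //; rewrite mulrC.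
Qed.

Let v1' : Var (iid P n) u1 <= B ^+ 4 * rate3 n (kmin j1 j2) (kmax j1 j2).
Proof.
by apply: (le_trans v1); rewrite ler_wpM2l//; have [] := rate3_dom n_gt0 km0 mM.
Qed.

Let v2' j : j = j1 \/ j = j2 ->
  Var (iid P n) (u2 j) <= E2 * rate3 n (kmin j1 j2) (kmax j1 j2).
Proof.
move=> hj; apply: (le_trans (v2 j)); rewrite -/(rate2 n (k j)) -/E2 ler_wpM2l//.
have [_ + + _] := rate3_dom n_gt0 km0 mM.
by case: hj => ->; case: (leP (k j1) (k j2)).
Qed.

Lemma Var_clean_MC : Var (iid P n) (clean_MC w A Y j1 j2) <=
  (2 * B ^+ 4 + 6 * E3) * rate3 n (kmin j1 j2) (kmax j1 j2).
Proof.
have bn : bm (fun s => - u3 s) by exact: bmN.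
apply: (le_trans (VarD (iid P n) b1 bn)); rewrite VarN//.
have := v1'; have := v3'; move: (Var _ _) (Var _ _) => x y; lra.
Qed.

Lemma Var_clean_IF : Var (iid P n) (clean_IF w A Y j1 j2) <=
  (8 * B ^+ 4 + 12 * E2 + 6 * E3) * rate3 n (kmin j1 j2) (kmax j1 j2).
Proof.
have bn j : bm (fun s => - u2 j s) by exact: bmN.
have b12 := bmD b1 (bn j1); have b122 := bmD b12 (bn j2).
have h1 := VarD (iid P n) b1 (bn j1); have h2 := VarD (iid P n) b12 (bn j2).
apply: (le_trans (VarD (iid P n) b122 b3)).
rewrite VarN// in h1; rewrite VarN// in h2.
have := v1'; have := v2' (or_introl erefl); have := v2' (or_intror erefl); have := v3'.
move: h1 h2.
set x1 := Var _ u1; set x2 := Var _ (u2 j1); set x3 := Var _ (u2 j2); set x4 := Var _ u3.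
set y1 := Var _ (fun s => _ + _); set y2 := Var _ (fun s => _ + _).
move: x1 x2 x3 x4 y1 y2 => x1 x2 x3 x4 y1 y2; lra.
Qed.

End law_variances.

(** * Upper bounds over the model *)

Section upper_bounds_over_the_model.
Context {R : realType} {J0 S : nat} (w : cdv_basis R J0 S) {d : nat}.
Hypothesis S_ge1 : (1 <= S)%N.
Variables (alpha beta M C1 C2 : R).
Hypotheses (alpha_gt0 : 0 < alpha) (beta_gt0 : 0 < beta) (M_gt0 : 0 < M).
Implicit Types (p b h g D : d.-tuple R -> R).
Local Notation cls := ([set P : probability (obs (R := R) d) R | model w alpha beta M C1 C2 P]).
Local Notation k j := ((res d j)%:R : R).
Local Notation q := (2 `^ (- (alpha + beta)) : R).
Local Notation kmin j1 j2 := (Num.min (k j1) (k j2)).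
Local Notation kmax j1 j2 := (Num.max (k j1) (k j2)).
Let B := `|C1| + `|C2|.
Local Notation A := (fun o : obs d => clamp B (oA o)).
Local Notation Y := (fun o : obs d => clamp B (oY o)).

(** Patching leaves the wavelet coefficients unchanged, as they are integrals over the
    cube. *)
Lemma model_facts P : model w alpha beta M C1 C2 P -> exists p b,
  [/\ facts B P A Y p b, unif_cont_cube b, decay w alpha M p & decay w beta M b].
Proof.
case=> PX ae [p hp cp] [b hb cb].
have [up ub] := (hp.1, hb.1).
exists (patch_cube p), (patch_cube b); split.
- exact: facts_of.
- by apply: unif_cont_eq ub => x cx; rewrite patch_cubeE.
- move=> l m iota lJ ii; rewrite -(coef_eq (h := p)) => [|x cx]; last by rewrite patch_cubeE.
  exact: (holder_decay hp).
- move=> l m iota lJ ii; rewrite -(coef_eq (h := b)) => [|x cx]; last by rewrite patch_cubeE.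
  exact: (holder_decay hb).
Qed.

Lemma sup_bias_le (est : estimator R d) n j1 j2 (v : R) :
  (forall P, cls P -> exists2 t,
     'E_(iid P n)[fun s => (est n j1 j2 s - psi P)%R]%E = t%:E & `|t| <= v) ->
  (sup_bias cls est n j1 j2 <= v%:E)%E.
Proof.
move=> h; apply: ge_ereal_sup => _ [P Pc <-].
by have [t -> tv] := h P Pc; rewrite lee_fin.
Qed.

Lemma sup_var_le (est : estimator R d) n j1 j2 (v : R) :
  (forall P, cls P -> exists2 t, 'V_(iid P n)[@est n j1 j2]%E = t%:E & t <= v) ->
  (sup_var cls est n j1 j2 <= v%:E)%E.
Proof.
move=> h; apply: ge_ereal_sup => _ [P Pc <-].
by have [t -> tv] := h P Pc; rewrite lee_fin.
Qed.

Let T := 2 ^+ d * (M * M) / (1 - q).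
Let T_ge0 : 0 <= T.
Proof.
apply: divr_ge0; first by rewrite mulr_ge0 ?exprn_ge0// mulr_ge0 ?(ltW M_gt0).
rewrite subr_ge0 powRN invf_le1 ?powR_gt0//.
by rewrite -[leLHS](powRr0 2) ler_powR ?ler1n// addr_ge0// ltW.
Qed.

Let max_le (t x D E : R) : 0 <= t -> 0 <= D -> 0 <= E ->
  D * t + E * x <= (D + E + 1) * Num.max t x.
Proof.
move=> t0 D0 E0.
have m1 : t <= Num.max t x by rewrite le_max lexx.
have m2 : x <= Num.max t x by rewrite le_max lexx orbT.
have := ler_wpM2l D0 m1; have := ler_wpM2l E0 m2; move: m1 m2.
move: (Num.max t x) => m m1 m2; lra.
Qed.

Let consts : exists2 c : R, 1 <= c &
  (forall j (x y : d.-tuple R), `|K w j x y| <= c * k j) /\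
  (forall j (x : d.-tuple R), Ex (unif d) (fun y => `|K w j x y|) <= c).
Proof. by have [c c1 hc] := @K_consts _ _ _ w S_ge1 d; exists c => //; split=> j; case: (hc j). Qed.

Let km_div_le1 n j1 j2 : kmax j1 j2 / n%:R <= 1 -> kmin j1 j2 / n%:R <= 1.
Proof. by apply: le_trans; rewrite ler_wpM2r ?invr_ge0// ge_min le_max lexx. Qed.

Let kmax_ge1 j1 j2 : 1 <= kmax j1 j2.
Proof. by rewrite le_max k_ge1. Qed.

Let side j1 j2 : [/\ 0 <= kmin j1 j2, k (minn j1 j2) <= kmax j1 j2, k j1 <= kmax j1 j2,
  k j2 <= kmax j1 j2 & k j1 * k j2 = kmin j1 j2 * kmax j1 j2].
Proof.
split; [by rewrite -res_min|by rewrite res_min ge_min le_max lexx|by rewrite le_max lexx|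
  by rewrite le_max lexx orbT|exact: mul_min_max].
Qed.

Lemma upper_bias : exists2 C : R, 0 < C & forall n j1 j2, (0 < n)%N ->
  (J0 <= j1)%N -> (J0 <= j2)%N ->
  (sup_bias cls (@psi_INT R J0 S w d) n j1 j2 <=
    (C * Num.max (q ^+ minn j1 j2) (kmin j1 j2 / n%:R))%:E)%E /\
  (kmax j1 j2 / n%:R <= 1 ->
   (sup_bias cls (@psi_MC R J0 S w d) n j1 j2 <=
    (C * Num.max (q ^+ minn j1 j2) (kmax j1 j2 / n%:R))%:E)%E /\
   (sup_bias cls (@psi_IF R J0 S w d) n j1 j2 <=
    (C * Num.max (q ^+ maxn j1 j2) (kmax j1 j2 / n%:R))%:E)%E).
Proof.
have [c c1 [Kc Kint]] := consts; have c0 : 0 <= c by exact: le_trans c1.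
pose E := c ^+ 2 * B ^+ 2.
have E0 : 0 <= E by rewrite mulr_ge0 ?sqr_ge0.
have TE : 0 < T + 11 * E + 1 by move: T_ge0; lra.
exists (T + 11 * E + 1) => // n j1 j2 n0 j1J j2J.
have mJ : (J0 <= minn j1 j2)%N by rewrite leq_min j1J.
have MJ : (J0 <= maxn j1 j2)%N by rewrite leq_max j1J.
have [km0 h0 h1 h2 h12] := side j1 j2.
have q0 J : 0 <= q ^+ J by rewrite exprn_ge0 ?powR_ge0.
have x0 : 0 <= kmin j1 j2 / n%:R by rewrite divr_ge0.
have E11 : 0 <= 11 * E by rewrite mulr_ge0.
have key P : cls P -> exists p b, facts B P A Y p b /\ forall J, (J0 <= J)%N ->
    `|ip p b - ip p (vproj w J b)| <= T * q ^+ J.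
  move=> /model_facts[p [b [hf ub dp db]]]; exists p, b; split => // J JJ.
  have ab : 0 < alpha + beta by exact: addr_gt0.
  exact: (bias_proj_le S_ge1 ab JJ (ltW M_gt0) (ltW M_gt0) (f_p hf) (f_b hf) ub dp db).
split; [|move=> kn; split].
- apply: sup_bias_le => P /key[p [b [hf hT]]].
  exists (ip p b - bracket2 w P A Y p b n (minn j1 j2)); first exact: (bias_INT w S_ge1 hf).
  apply: (le_trans (bias_INT_le S_ge1 hf c1 Kc Kint n0 (hT _ mJ))).
  apply: le_trans (max_le _ (q0 _) T_ge0 E11).
  rewrite lerD2l res_min; apply: ler_wpM2r => //; rewrite -/E; lra.
- have kmn := km_div_le1 kn.
  apply: sup_bias_le => P /key[p [b [hf hT]]].
  exists (ip p b - bracket3 w P A Y p b n j1 j2); first exact: (bias_MC w S_ge1 hf).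
  apply: (le_trans (bias_MC_le S_ge1 hf c1 Kc Kint n0 km0 (kmax_ge1 _ _) kmn h0 h1 h2 h12 (hT _ mJ))).
  apply: le_trans (max_le _ (q0 _) T_ge0 E11).
  rewrite lerD2l; apply: ler_wpM2r; last by rewrite -/E; lra.
  by rewrite divr_ge0// (le_trans _ (kmax_ge1 _ _)).
- have kmn := km_div_le1 kn.
  apply: sup_bias_le => P /key[p [b [hf hT]]].
  exists (ip p b - bracket2 w P A Y p b n j1 - bracket2 w P A Y p b n j2 +
    bracket3 w P A Y p b n j1 j2); first exact: (bias_IF w S_ge1 hf).
  apply: (le_trans (bias_IF_le S_ge1 hf c1 Kc Kint n0 km0 (kmax_ge1 _ _) kmn h0 h1 h2 h12 (hT _ MJ))).
  exact: (max_le _ (q0 _) T_ge0 E11).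
Qed.

Lemma upper_var : exists2 C : R, 0 < C & forall n j1 j2, (0 < n)%N ->
  (J0 <= j1)%N -> (J0 <= j2)%N ->
  [/\ (sup_var cls (@psi_INT R J0 S w d) n j1 j2 <= (C * rate2 n (kmin j1 j2))%:E)%E,
      (sup_var cls (@psi_MC R J0 S w d) n j1 j2 <=
        (C * rate3 n (kmin j1 j2) (kmax j1 j2))%:E)%E &
      (sup_var cls (@psi_IF R J0 S w d) n j1 j2 <=
        (C * rate3 n (kmin j1 j2) (kmax j1 j2))%:E)%E].
Proof.
have [c c1 [Kc Kint]] := consts; have c0 : 0 <= c by exact: le_trans c1.
have B4 : 0 <= B ^+ 4 by have := sqr_ge0 (B ^+ 2); rewrite -exprM.
have E2 : 0 <= 72 * B ^+ 4 * c ^+ 2 by rewrite mulr_ge0 ?sqr_ge0// mulr_ge0.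
have E3 : 0 <= 2916 * B ^+ 4 * c ^+ 4 by apply: mulr_ge0 (exprn_ge0 _ c0); apply: mulr_ge0 B4; exact: ler0n.
exists (8 * B ^+ 4 + 12 * (72 * B ^+ 4 * c ^+ 2) + 6 * (2916 * B ^+ 4 * c ^+ 4) + 1).
  by move: B4 E2 E3; lra.
move=> n j1 j2 n0 j1J j2J; have [km0 _ _ _ _] := side j1 j2.
have kM0 : 0 <= kmax j1 j2 by exact: le_trans (kmax_ge1 _ _).
have r2 : 0 <= rate2 n (kmin j1 j2).
  by rewrite /rate2 !addr_ge0 ?invr_ge0 ?divr_ge0 ?exprn_ge0.
have r3 : 0 <= rate3 n (kmin j1 j2) (kmax j1 j2).
  by rewrite /rate3 !addr_ge0 ?invr_ge0 ?divr_ge0 ?mulr_ge0 ?exprn_ge0.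
split; apply: sup_var_le => P /model_facts[p [b [hf _ _ _]]].
- exists (Var (iid P n) (clean_INT w A Y j1 j2)).
    apply: variance_ae; [exact: (measurable_INT w S_ge1)|exact: (bm_clean_INT w S_ge1 hf)|].
    exact: (ae_INT w S_ge1 hf).
  apply: (le_trans (Var_clean_INT S_ge1 hf c1 Kc Kint j1 j2 n0)).
  by apply: ler_wpM2r => //; move: B4 E2 E3; lra.
- exists (Var (iid P n) (clean_MC w A Y j1 j2)).
    apply: variance_ae; [exact: (measurable_MC w S_ge1)|exact: (bm_clean_MC w S_ge1 hf)|].
    exact: (ae_MC w hf).
  apply: (le_trans (Var_clean_MC S_ge1 hf c1 Kc Kint j1 j2 n0)).
  by apply: ler_wpM2r => //; move: B4 E2 E3; lra.
- exists (Var (iid P n) (clean_IF w A Y j1 j2)).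
    apply: variance_ae; [exact: (measurable_IF w S_ge1)|exact: (bm_clean_IF w S_ge1 hf)|].
    exact: (ae_IF w hf).
  apply: (le_trans (Var_clean_IF S_ge1 hf c1 Kc Kint j1 j2 n0)).
  by apply: ler_wpM2r => //; move: B4 E2 E3; lra.
Qed.

End upper_bounds_over_the_model.

(** * Uniformly continuous functions on the cube *)

Section uniform_continuity.
Context {R : realType}.

Lemma heine01 (f : R -> R) : continuous f -> forall e : R, 0 < e ->
  exists2 dl : R, 0 < dl & forall x y, 0 <= x <= 1 -> `|x - y| < dl -> `|f x - f y| < e.
Proof.
move=> cf e e0.
have /compact_near_coveringP cpt := @segment_compact R 0 1.
have nearP : \forall dl \near (0 : R)^'+, `[0, 1]%classic `<=`
    (fun x => forall y, `|x - y| < dl -> `|f x - f y| < e).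
  apply: cpt => x _.
  have /cvgrPdist_lt /(_ (e / 2) (divr_gt0 e0 (ltr0n _ 2))) := cf x.
  rewrite -nbhs_nearE => /nbhs_ballP[r r0 hr].
  exists (ball x (r / 2), [set dl : R | 0 < dl < r / 2]); first split => /=.
  - by apply: nbhsx_ballx; rewrite divr_gt0.
  - near=> dl; apply/andP; split; near: dl; first exact: nbhs_right_gt.
    by apply: nbhs_right_lt; rewrite divr_gt0.
  move=> [x' dl] [/= bx /andP[dl0 dlr]] y hy.
  have h1 : `|f x - f x'| < e / 2.
    by apply: hr; apply: lt_trans bx _; rewrite ltr_pdivrMr// ltr_pMr// ltr1n.
  have h2 : `|f x - f y| < e / 2.
    apply: hr; rewrite /ball /= in bx *.
    by have := ler_distD x' x y; move: bx hy => /=; lra.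
  have := ler_distD (f x) (f x') (f y); rewrite (distrC (f x') (f x)); lra.
have [dl [dl0 hdl]] : exists dl : R, 0 < dl /\ `[0, 1]%classic `<=`
    (fun x => forall y, `|x - y| < dl -> `|f x - f y| < e).
  near (0 : R)^'+ => dl; exists dl; split; near: dl => //.
  exact: nbhs_right_gt.
exists dl => // x y x01 xy; apply: hdl => //.
Unshelve. all: by end_near.
Qed.

Context {d : nat}.
Implicit Types f g h : d.-tuple R -> R.

Lemma unif_cont_coord (i : 'I_d) (f : R -> R) : continuous f ->
  unif_cont_cube (fun x : d.-tuple R => f (tnth x i)).
Proof.
move=> cf e e0; have [dl dl0 h] := heine01 cf e0; exists dl => // x y cx cy xy.
exact: h.
Qed.

Lemma unif_cont_cst c : unif_cont_cube (fun _ : d.-tuple R => c).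
Proof. by move=> e e0; exists 1 => // x y _ _ _; rewrite subrr normr0. Qed.

Lemma unif_contD f g : unif_cont_cube f -> unif_cont_cube g ->
  unif_cont_cube (fun x => f x + g x).
Proof.
move=> uf ug e e0; have e2 : 0 < e / 2 by rewrite divr_gt0.
have [d1 d10 h1] := uf _ e2; have [d2 d20 h2] := ug _ e2.
exists (Num.min d1 d2); first by rewrite lt_min d10.
move=> x y cx cy xy; rewrite opprD addrACA.
apply: le_lt_trans (ler_normD _ _) _; rewrite (splitr e); apply: ltrD.
  by apply: h1 => // i; have := xy i; rewrite lt_min => /andP[].
by apply: h2 => // i; have := xy i; rewrite lt_min => /andP[].
Qed.

Lemma unif_contM f g : unif_cont_cube f -> unif_cont_cube g ->
  unif_cont_cube (fun x => f x * g x).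
Proof.
move=> uf ug e e0.
have [Cf hCf] := unif_cont_bounded uf; have [Cg hCg] := unif_cont_bounded ug.
pose C := `|Cf| + `|Cg| + 1.
have C0 : 0 < C by rewrite ltr_wpDl// addr_ge0.
have e2 : 0 < e / 2 / C by rewrite !divr_gt0.
have [d1 d10 h1] := uf _ e2; have [d2 d20 h2] := ug _ e2.
exists (Num.min d1 d2); first by rewrite lt_min d10.
move=> x y cx cy xy.
have a1 : `|f x - f y| < e / 2 / C.
  by apply: h1 => // i; have := xy i; rewrite lt_min => /andP[].
have a2 : `|g x - g y| < e / 2 / C.
  by apply: h2 => // i; have := xy i; rewrite lt_min => /andP[].
have b1 : `|g x| <= C.
  apply: (le_trans (hCg _ cx)); apply: (le_trans (ler_norm _)).
  by rewrite /C; have := normr_ge0 Cf; lra.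
have b2 : `|f y| <= C.
  apply: (le_trans (hCf _ cy)); apply: (le_trans (ler_norm _)).
  by rewrite /C; have := normr_ge0 Cg; lra.
rewrite (_ : f x * g x - f y * g y = (f x - f y) * g x + f y * (g x - g y)); last by ring.
apply: le_lt_trans (ler_normD _ _) _; rewrite !normrM (splitr e); apply: ltr_leD.
  apply: (@le_lt_trans _ _ (`|f x - f y| * C)); first by rewrite ler_wpM2l.
  by rewrite -ltr_pdivlMr.
apply: (@le_trans _ _ (C * `|g x - g y|)); first by rewrite ler_wpM2r.
by rewrite mulrC -ler_pdivlMr// ltW.
Qed.

Lemma unif_cont_sum I (s : seq I) (F : I -> d.-tuple R -> R) :
  (forall i, unif_cont_cube (F i)) -> unif_cont_cube (fun x => \sum_(i <- s) F i x).
Proof.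
move=> uF; elim: s => [|i s IH].
  by rewrite (_ : (fun x => _) = fun=> 0); [exact: unif_cont_cst|apply/funext => x; rewrite big_nil].
rewrite (_ : (fun x => _) = fun x => F i x + \sum_(i <- s) F i x); first exact: unif_contD.
by apply/funext => x; rewrite big_cons.
Qed.

Lemma unif_cont_prod I (s : seq I) (F : I -> d.-tuple R -> R) :
  (forall i, unif_cont_cube (F i)) -> unif_cont_cube (fun x => \prod_(i <- s) F i x).
Proof.
move=> uF; elim: s => [|i s IH].
  by rewrite (_ : (fun x => _) = fun=> 1); [exact: unif_cont_cst|apply/funext => x; rewrite big_nil].
rewrite (_ : (fun x => _) = fun x => F i x * \prod_(i <- s) F i x); first exact: unif_contM.
by apply/funext => x; rewrite big_cons.
Qed.

(** The function is the limit of step functions on a regular grid.  As the cells are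
    half-open, the grid goes one cell beyond 1, to cover the points with a coordinate
    equal to 1. *)
Lemma unif_cont_measurable h : unif_cont_cube h -> bm (patch_cube h).
Proof.
move=> uh.
have b1 : bm (\1_(@cube R d) : d.-tuple R -> R) by apply: bm_indic; exact: measurable_cube.
pose node n (m : {ffun 'I_d -> 'I_n.+2}) : d.-tuple R := [tuple (m i)%:R / n.+1%:R | i < d].
pose cell n (m : {ffun 'I_d -> 'I_n.+2}) (x : d.-tuple R) : R :=
  \prod_(i < d) \1_[set` `[(m i)%:R / n.+1%:R, (m i).+1%:R / n.+1%:R[] (tnth x i).
have bcell n m : bm (@cell n m).
  by apply: bm_prod => i; apply: bm_tnth; apply: bm_indic; exact: measurable_itv.
pose hn n x : R := (\sum_(m : {ffun 'I_d -> 'I_n.+2}) cell n m x * patch_cube h (node n m))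
   * \1_(@cube R d) x.
have bhn n : bm (hn n).
  by apply: bmM => //; apply: bm_sum => m; apply: bmM; [exact: bcell|exact: bm_cst].
have key n x : cube x -> exists y, [/\ cube y, hn n x = h y &
    forall i, `|tnth x i - tnth y i| < n.+1%:R^-1].
  move=> cx.
  have N0 : 0 < n.+1%:R :> R by [].
  have xi i : (Num.trunc (tnth x i * n.+1%:R) < n.+2)%N.
    have /andP[x0 x1] := cx i.
    rewrite ltnS -(ler_nat R); apply: (@le_trans _ _ (tnth x i * n.+1%:R)).
      by have /andP[] := trunc_itv (mulr_ge0 x0 (ltW N0)).
    by rewrite ler_piMl.
  pose m : {ffun 'I_d -> 'I_n.+2} := [ffun i => Ordinal (xi i)].
  have tr i : (m i)%:R <= tnth x i * n.+1%:R < (m i).+1%:R.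
    by rewrite ffunE /=; apply: trunc_itv; have /andP[x0 _] := cx i; rewrite mulr_ge0.
  have in_cell i : (m i)%:R / n.+1%:R <= tnth x i < (m i).+1%:R / n.+1%:R.
    by have := tr i; rewrite ler_pdivrMr// ltr_pdivlMr.
  have cnode : cube (node n m).
    move=> i; rewrite tnth_mktuple divr_ge0//=.
    have /andP[x0 x1] := cx i; have /andP[h1 _] := in_cell i; exact: le_trans x1.
  exists (node n m); split => //.
    rewrite /hn indicE mem_set// mulr1 (bigD1 m)//= big1 ?addr0.
      rewrite patch_cubeE// /cell big1 ?mul1r// => i _.
      by rewrite indicE mem_set//= in_itv /= in_cell.
    move=> m' /eqP mm'.
    have [i hi] : exists i, m' i != m i.
      apply: contrapT => hn'; apply: mm'; apply/ffunP => i; apply/eqP.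
      by apply: contrapT => /negP hi; apply: hn'; exists i.
    rewrite /cell (bigD1 i)//= indicE memNset ?mul0r//= in_itv /= => /andP[h1 h2].
    move/negP: hi; apply; apply/eqP/val_inj => /=; apply/eqP; rewrite eqn_leq.
    have /andP[h3 h4] := in_cell i.
    have := le_lt_trans h1 h4; have := le_lt_trans h3 h2.
    by rewrite !ltr_pM2r ?invr_gt0// !ltr_nat !ltnS => -> ->.
  move=> i; rewrite tnth_mktuple; have /andP[h1 h2] := in_cell i.
  rewrite ger0_norm ?subr_ge0// ltrBlDl; move: h2.
  by rewrite -natr1 mulrDl mul1r.
split; last first.
  have [C hC] := unif_cont_bounded uh; exists `|C| => x; rewrite /patch_cube indicE.
  case: (boolP (x \in _)) => [/set_mem cx|_]; last by rewrite mulr0 normr0.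
  by rewrite mulr1 (le_trans (hC _ cx))// ler_norm.
apply: (measurable_fun_cvg (h := hn)) => [n|x _]; first exact: bm_meas.
apply/cvgrPdist_lt => e e0; have [dl dl0 hdl] := uh e e0.
near=> n.
rewrite /patch_cube; have [cx|ncx] := pselect (cube x); last first.
  by rewrite /hn !indicE memNset// !mulr0 subrr normr0.
have [y [cy -> xy]] := key n x cx; rewrite indicE mem_set// mulr1.
apply: hdl => // i; apply: (lt_trans (xy i)); near: n.
have [N _ hN] := @near_infty_natSinv_lt R (PosNum dl0).
by exists N => // n /= /hN.
Unshelve. all: by end_near.
Qed.

End uniform_continuity.

(** * Laws with prescribed regression functions *)

Lemma measure_Ex {dd} {T : measurableType dd} {R : realType} (P : probability T R)
    (D : set T) : measurable D -> P D = (Ex P (\1_D : T -> R))%:E.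
Proof. by move=> mD; rewrite EFin_Ex; [rewrite integral_indic// setIT|exact: bm_indic]. Qed.

Section coin.
Context {R : realType}.

Definition coin : probability bool R := bernoulli_prob 2^-1.

Lemma bm_bool (f : bool -> R) : bm f.
Proof.
split; first by [].
exists (`|f true| + `|f false|) => -[]; rewrite ?lerDl ?lerDr//.
Qed.

Lemma Ex_coin (f : bool -> R) : Ex coin f = (f true + f false) / 2.
Proof.
have h01 : 0 <= (2^-1 : R) <= 1 by rewrite invr_ge0 ler0n invf_le1// ler1n.
have ge0 (g : bool -> R) : (forall x, 0 <= g x) -> Ex coin g = (g true + g false) / 2.
  move=> g0; apply: EFin_inj; rewrite EFin_Ex; last exact: bm_bool.
  rewrite integral_bernoulli_prob//.
  by rewrite -!EFinM -EFinD; congr EFin; rewrite /unstable.onem; field.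
pose C := `|f true| + `|f false|.
have := ge0 (fun x => f x + C); rewrite ExD; [|exact: bm_bool..].
rewrite Ex_cst => h; apply: (addIr C); rewrite h; first by field.
have h1 := ler_norm (- f true); have h2 := ler_norm (- f false).
rewrite !normrN in h1 h2.
have h3 := normr_ge0 (f true); have h4 := normr_ge0 (f false).
by case; rewrite /C; lra.
Qed.

Definition sgb (x : bool) : R := if x then 1 else -1.

End coin.

Section two_point_law.
Context {R : realType} {d : nat}.
Local Notation obsd := (obs (R := R) d).
Variables (p b : d.-tuple R -> R) (e s : R).
Hypotheses (bp : bm p) (bb : bm b).

(** A common sign gives A and Y the conditional covariance s e^2, without affecting their
    regression functions. *)
Definition draw (z : d.-tuple R * bool) : obsd :=
  (z.1, p z.1 + e * sgb z.2, b z.1 + s * e * sgb z.2).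

Lemma measurable_draw : measurable_fun setT draw.
Proof.
have m2 : measurable_fun setT (fun z : d.-tuple R * bool => sgb z.2 : R).
  exact: (measurableT_comp (bm_meas (bm_bool _)) measurable_snd).
have mp : measurable_fun setT (fun z : d.-tuple R * bool => p z.1).
  exact: (measurableT_comp (bm_meas bp) measurable_fst).
have mb : measurable_fun setT (fun z : d.-tuple R * bool => b z.1).
  exact: (measurableT_comp (bm_meas bb) measurable_fst).
apply: measurable_fun_pair; first apply: measurable_fun_pair.
- exact: measurable_fst.
- by apply: measurable_funD => //; apply: measurable_funM.
- by apply: measurable_funD => //; apply: measurable_funM.
Qed.

Let draw_mixin := isMeasurableFun.Build _ _ _ _ draw measurable_draw.
Let draw_pack := MeasurableFun.Pack (MeasurableFun.Class draw_mixin).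

Definition law : probability obsd R := distribution (unif d \x @coin R)%E draw_pack.

Lemma Ex_law (F : obsd -> R) : bm F ->
  Ex law F = Ex (unif d) (fun x => (F (draw (x, true)) + F (draw (x, false))) / 2).
Proof.
move=> bF; rewrite /law Ex_distribution//.
have bFd : bm (fun z => F (draw z)) by apply: (bm_comp bF); exact: measurable_draw.
rewrite (Ex_prod (unif d) coin bFd); apply: eq_Ex => x; exact: Ex_coin.
Qed.

Lemma law_X (D : set (d.-tuple R)) : measurable D -> law (@oX R d @^-1` D) = unif d D.
Proof.
move=> mD; have mXD := mX_pre mD.
rewrite (measure_Ex law mXD) (measure_Ex (unif d) mD) Ex_law; last exact: bm_indic.
congr EFin; apply: eq_Ex => x; rewrite !indicE.
have h y : (draw (x, y) \in @oX R d @^-1` D) = (x \in D).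
  by apply/idP/idP => [/set_mem|/set_mem] h; apply: mem_set.
by rewrite !h; field.
Qed.

Variables (C1 C2 : R).
Hypotheses (e_ge0 : 0 <= e) (s_le1 : `|s| <= 1).
Hypothesis p_range : forall x, cube x -> C1 + e <= p x <= C2 - e.
Hypothesis b_range : forall x, cube x -> C1 + e <= b x <= C2 - e.

Lemma draw_range x y : cube x ->
  C1 <= oA (draw (x, y)) <= C2 /\ C1 <= oY (draw (x, y)) <= C2.
Proof.
move=> cx; have /andP[p1 p2] := p_range cx; have /andP[b1 b2] := b_range cx.
have se : `|s * e| <= e by rewrite normrM (ger0_norm e_ge0) ler_piMl.
move: se; rewrite ler_norml => /andP[s1 s2].
by rewrite /oA /oY /draw /sgb /=; case: y; split; apply/andP; split; lra.
Qed.

Lemma law_ae : {ae law, forall o, C1 <= oA o <= C2 /\ C1 <= oY o <= C2}.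
Proof.
pose G := (@oA R d @^-1` `[C1, C2]%classic) `&` (@oY R d @^-1` `[C1, C2]%classic).
have mG : measurable G.
  apply: measurableI; rewrite -[X in measurable X]setTI.
    by apply: measurable_oA => //; exact: measurable_itv.
  by apply: measurable_oY => //; exact: measurable_itv.
exists (~` G); split; first exact: measurableC.
- have mGC := measurableC mG.
  rewrite (measure_Ex law mGC) Ex_law; last exact: bm_indic.
  congr EFin; rewrite -[RHS](Ex_cst (unif d) 0); apply: eq_Ex_cube.
  + have b1 y : bm (fun x => \1_(~` G) (draw (x, y)) : R).
      apply: (@bm_slice2 _ _ _ _ _ (fun z => \1_(~` G) (draw z)) y).
      by apply: (bm_comp (bm_indic mGC)); exact: measurable_draw.
    by bmt.
  + exact: bm_cst.
  + move=> x cx; have inG y : draw (x, y) \in G.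
      apply: mem_set; have [h1 h2] := draw_range y cx; split => /=; by rewrite in_itv.
    have nG y : \1_(~` G) (draw (x, y)) = 0 :> R.
      by rewrite indicE memNset// => /=; apply; exact: (set_mem (inG y)).
    by rewrite !nG addr0 mul0r.
- move=> o /= ho hG; apply: ho; case: hG => /=; rewrite !in_itv /=; by [].
Qed.

Let B := `|C1| + `|C2|.

Let clamp_in v : C1 <= v <= C2 -> clamp B v = v.
Proof.
move=> /andP[h1 h2]; apply: clamp_id; rewrite /B.
have := ler_norm C2; have := ler_norm (- C1); rewrite normrN => h3 h4.
have := normr_ge0 C1; have := normr_ge0 C2 => h5 h6.
rewrite ler_norml; apply/andP; split; lra.
Qed.

Let B0 : 0 <= B. Proof. by rewrite addr_ge0. Qed.

Lemma law_cond_exp (f : obsd -> R) (q : d.-tuple R -> R) : measurable_fun setT f -> bm q ->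
  {ae law, forall o, C1 <= f o <= C2} ->
  (forall x, cube x -> (forall y, C1 <= f (draw (x, y)) <= C2) /\
     (f (draw (x, true)) + f (draw (x, false))) / 2 = q x) ->
  is_cond_exp law (@oX R d) f q.
Proof.
move=> mf bq aef fq.
pose F o := clamp B (f o).
have bF : bm F by exact: bm_clamp.
have bqX := bm_oX bq.
split; [exact: bm_meas|exact: bm_integrable|].
move=> D mD; rewrite -(Ex_indic law (@oX R d) bqX mD).
have mXD := mX_pre mD.
transitivity (\int[law]_(o in @oX R d @^-1` D) (F o)%:E)%E; last first.
  apply: ae_eq_integral => //.
  - exact/measurable_funTS/measurable_EFinP/bm_meas.
  - exact/measurable_funTS/measurable_EFinP.
  - by apply: filterS aef => o /= h _; rewrite /F clamp_in.
rewrite -(Ex_indic law (@oX R d) bF mD); congr EFin.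
have b1 := bm_oX (@bm_indic _ _ R D mD).
have bd (G : obsd -> R) y : bm G -> bm (fun x => G (draw (x, y))).
  move=> bG; apply: (@bm_slice2 _ _ _ _ _ (fun z => G (draw z)) y).
  by apply: (bm_comp bG); exact: measurable_draw.
rewrite !Ex_law; [|by bmt..].
have bqd y := bd _ y bqX; have bFd y := bd _ y bF; have b1d y := bd _ y b1.
apply: eq_Ex_cube; [by bmt..|].
move=> x cx; have [h1 h2] := fq x cx.
by rewrite /F !clamp_in//= -h2 /oX /=; field.
Qed.

Lemma law_A : is_cond_exp law (@oX R d) (@oA R d) p.
Proof.
apply: law_cond_exp => //; first exact: measurable_oA.
  by apply: filterS law_ae => o /= [].
move=> x cx; split; first by move=> y; have [] := draw_range y cx.
by rewrite /oA /draw /sgb /=; field.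
Qed.

Lemma law_Y : is_cond_exp law (@oX R d) (@oY R d) b.
Proof.
apply: law_cond_exp => //; first exact: measurable_oY.
  by apply: filterS law_ae => o /= [].
move=> x cx; split; first by move=> y; have [] := draw_range y cx.
by rewrite /oY /draw /sgb /=; field.
Qed.

Hypotheses (up : unif_cont_cube p) (ub : unif_cont_cube b).

Lemma law_facts : facts B law (fun o => clamp B (oA o)) (fun o => clamp B (oY o)) p b.
Proof.
have := facts_of (erefl B) law_X law_ae up ub law_A law_Y.
have [ep eb] := (@patch_cubeE _ _ p, @patch_cubeE _ _ b).
case=> bA bY AB YB bpp bbb hX hAp hYb hpsi hae.
split=> //.
- by move=> g bg; rewrite hAp//; exact: eq_ip_cube.
- by move=> g bg; rewrite hYb//; exact: eq_ip_cube.
- by rewrite hpsi; congr (_ - _); exact: eq_ip_cube.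
Qed.

(** The only place where the covariance enters the bias. *)
Lemma law_EAY (g : d.-tuple R -> R) : bm g ->
  EAY law (fun o => clamp B (oA o)) (fun o => clamp B (oY o)) g =
  ip p (fun x => b x * g x) + s * e ^+ 2 * Ex (unif d) g.
Proof.
move=> bg; rewrite /EAY.
have bgX := bm_oX bg.
have bA := bm_clamp B0 (@measurable_oA R d); have bY := bm_clamp B0 (@measurable_oY R d).
pose G (o : obsd) := clamp B (oA o) * clamp B (oY o) * g (oX o).
have bG : bm G by rewrite /G; bmt.
have bGd y : bm (fun x => G (draw (x, y))).
  apply: (@bm_slice2 _ _ _ _ _ (fun z => G (draw z)) y).
  by apply: (bm_comp bG); exact: measurable_draw.
rewrite (Ex_law bG) /ip -ExZl// -ExD; [|by bmt..].
apply: eq_Ex_cube; [by bmt..|] => x cx.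
have [a1 y1] := draw_range true cx; have [a2 y2] := draw_range false cx.
by rewrite /G !clamp_in//= /oA /oY /oX /draw /sgb /=; field.
Qed.

Lemma law_model (J0 S : nat) (w : cdv_basis R J0 S) (alpha beta M : R) :
  holder_ball w alpha M p -> holder_ball w beta M b ->
  model w alpha beta M C1 C2 law.
Proof.
move=> hp hb; split.
- exact: law_X.
- exact: law_ae.
- by exists p => //; exact: law_A.
- by exists b => //; exact: law_Y.
Qed.

End two_point_law.

(** * The bias as a bilinear form in the regression functions *)

Section linear_operators.
Context {R : realType} {d : nat}.
Implicit Types (p b h g : d.-tuple R -> R).

Definition linop (Op : (d.-tuple R -> R) -> d.-tuple R -> R) :=
  (forall h, bm h -> bm (Op h)) /\
  (forall h g t x, bm h -> bm g -> Op (fun y => h y + t * g y) x = Op h x + t * Op g x).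

Lemma linop_id : linop id.
Proof. by []. Qed.

Lemma linop_mul k : bm k -> linop (fun h x => k x * h x).
Proof. by move=> bk; split => [h bh|h g t x _ _]; [bmt|ring]. Qed.

Lemma linop_add Op Op' : linop Op -> linop Op' -> linop (fun h x => Op h x + Op' h x).
Proof.
move=> [b1 l1] [b2 l2]; split => [h bh|h g t x bh bg].
  by apply: bmD; [exact: b1|exact: b2].
by rewrite l1// l2//; ring.
Qed.

Lemma linop_scale Op c : linop Op -> linop (fun h x => c * Op h x).
Proof.
move=> [b1 l1]; split => [h bh|h g t x bh bg].
  by apply: bmM; [exact: bm_cst|exact: b1].
by rewrite l1//; ring.
Qed.

Lemma linop_sub Op Op' : linop Op -> linop Op' -> linop (fun h x => Op h x - Op' h x).
Proof.
move=> [b1 l1] [b2 l2]; split => [h bh|h g t x bh bg].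
  by apply: bmB; [exact: b1|exact: b2].
by rewrite l1// l2//; ring.
Qed.

Lemma linop_mulC k Op : bm k -> linop Op -> linop (fun h x => k x * Op h x).
Proof.
move=> bk [b1 l1]; split => [h bh|h g t x bh bg].
  by apply: bmM => //; exact: b1.
by rewrite l1//; ring.
Qed.

(** The second mixed difference of the bilinear form <p, Op b> is 4 <D, Op D'>, and it is
    bounded by four times the largest of the four values. *)
Lemma mixed_difference Op p b D D' r : linop Op -> bm p -> bm b -> bm D -> bm D' ->
  (forall s t : bool, `|ip (fun x => p x + sgb s * D x) (Op (fun x => b x + sgb t * D' x))| <= r) ->
  `|ip D (Op D')| <= r.
Proof.
move=> [bO lO] bp bb bD bD' hr.
have [bOb bOD] := (bO _ bb, bO _ bD').
have E s t : ip (fun x => p x + sgb s * D x) (Op (fun x => b x + sgb t * D' x)) =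
   ip p (Op b) + sgb t * ip p (Op D') + sgb s * ip D (Op b) + sgb s * sgb t * ip D (Op D').
  rewrite /ip -!ExZl; [|by bmt..]; rewrite -!ExD; [|by bmt..].
  by apply: eq_Ex => x; rewrite lO//; ring.
have := hr true true; have := hr true false; have := hr false true; have := hr false false.
rewrite !E /sgb !ler_norml => /andP[? ?] /andP[? ?] /andP[? ?] /andP[? ?].
by apply/andP; split; lra.
Qed.

End linear_operators.

Section bias_operators.
Context {R : realType} {J0 S : nat} (w : cdv_basis R J0 S) {d : nat}.
Hypothesis S_ge1 : (1 <= S)%N.
Local Notation kdiag := (kdiag w).
Implicit Types (p b h g : d.-tuple R -> R).

(** The operators for which the means of U2/n^2 and U3/n^3 are <p, O2 b> and <p, O3 b> when
    A and Y are conditionally uncorrelated. *)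
Definition O2 (n j : nat) h x : R :=
  (1 - n%:R^-1) * vproj w j h x + n%:R^-1 * (kdiag j x * h x).

Definition O3 (n j1 j2 : nat) h x : R :=
  (1 - n%:R^-1) * (1 - 2 * n%:R^-1) * vproj w (minn j1 j2) h x +
  n%:R^-1 * (1 - n%:R^-1) * (kdiag (minn j1 j2) x * h x + kdiag j1 x * vproj w j2 h x +
     vproj w j1 (fun y => kdiag j2 y * h y) x) +
  n%:R^-1 ^+ 2 * ((kdiag j1 x * kdiag j2 x) * h x).

Definition opINT n j1 j2 h x : R := h x - O2 n (minn j1 j2) h x.
Definition opMC n j1 j2 h x : R := h x - O3 n j1 j2 h x.
Definition opIF n j1 j2 h x : R := h x - O2 n j1 h x - O2 n j2 h x + O3 n j1 j2 h x.

Let bd j : bm (kdiag j : d.-tuple R -> R). Proof. exact: bm_Kdiag. Qed.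

Lemma linop_vproj j : linop (@vproj _ _ _ w d j).
Proof.
split => [h bh|h g t x bh bg]; first exact: bm_proj.
have bK := bm_K w S_ge1 j x.
rewrite /vproj -ExZl; [|by bmt]; rewrite -ExD; [|by bmt..].
by apply: eq_Ex => u; ring.
Qed.

Lemma linop_vproj_mul j1 j2 : linop (fun h x => vproj w j1 (fun y => kdiag j2 y * h y) x).
Proof.
have [b1 l1] := linop_vproj j1; have [b2 l2] := linop_mul (bd j2).
split => [h bh|h g t x bh bg]; first exact/b1/b2.
rewrite -l1; [|exact: b2..]; apply: eq_Ex => u; congr (_ * _).
by rewrite l2.
Qed.

Lemma linop_O2 n j : linop (O2 n j).
Proof. by apply: linop_add; apply: linop_scale; [exact: linop_vproj|exact: linop_mul]. Qed.

Lemma linop_O3 n j1 j2 : linop (O3 n j1 j2).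
Proof.
apply: linop_add; first apply: linop_add.
- exact/linop_scale/linop_vproj.
- apply: linop_scale; apply: linop_add; last exact: linop_vproj_mul.
  apply: linop_add; first exact: linop_mul.
  by apply: linop_mulC => //; exact: linop_vproj.
- by apply: linop_scale; apply: linop_mul; exact: bmM.
Qed.

Lemma linop_INT n j1 j2 : linop (opINT n j1 j2).
Proof. by apply: linop_sub; [exact: linop_id|exact: linop_O2]. Qed.

Lemma linop_MC n j1 j2 : linop (opMC n j1 j2).
Proof. by apply: linop_sub; [exact: linop_id|exact: linop_O3]. Qed.

Lemma linop_IF n j1 j2 : linop (opIF n j1 j2).
Proof.
apply: linop_add; last exact: linop_O3.
by apply: linop_sub; [apply: linop_sub; [exact: linop_id|exact: linop_O2]|exact: linop_O2].
Qed.

Lemma ip_O2 n j f h : bm f -> bm h ->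
  ip f (O2 n j h) = (1 - n%:R^-1) * ip f (vproj w j h) +
    n%:R^-1 * ip f (fun x => kdiag j x * h x).
Proof.
move=> bf bh; have b1 := bm_proj w S_ge1 j bh; have b2 := bd j.
rewrite /ip -!ExZl; [|by bmt..]; rewrite -!ExD; [|by bmt..].
by apply: eq_Ex => x; rewrite /O2; ring.
Qed.

Lemma ip_O3 n j1 j2 f h : bm f -> bm h ->
  ip f (O3 n j1 j2 h) =
  (1 - n%:R^-1) * (1 - 2 * n%:R^-1) * ip f (vproj w (minn j1 j2) h) +
  n%:R^-1 * (1 - n%:R^-1) * (ip f (fun x => kdiag (minn j1 j2) x * h x) +
    ip f (fun x => kdiag j1 x * vproj w j2 h x) +
    ip f (vproj w j1 (fun y => kdiag j2 y * h y))) +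
  n%:R^-1 ^+ 2 * ip f (fun x => (kdiag j1 x * kdiag j2 x) * h x).
Proof.
move=> bf bh; have b1 j := bm_proj w S_ge1 j bh; have b2 j := bd j.
have b3 := bm_proj w S_ge1 j1 (bmM (bd j2) bh).
rewrite /ip -!ExD; [|by bmt..]; rewrite -!ExZl; [|by bmt..].
rewrite -!ExD; [|by bmt..].
by apply: eq_Ex => x; rewrite /O3; ring.
Qed.

(** The contribution of a constant conditional covariance when all three indices of U3
    coincide. *)
Definition cov_trace (j1 j2 : nat) : R := Ex (unif d) (fun x => kdiag j1 x * kdiag j2 x).

Section law.
Variables (p b : d.-tuple R -> R) (e s C1 C2 : R).
Hypotheses (bp : bm p) (bb : bm b) (up : unif_cont_cube p) (ub : unif_cont_cube b).
Hypotheses (e_ge0 : 0 <= e) (s_le1 : `|s| <= 1).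
Hypothesis p_range : forall x, cube x -> C1 + e <= p x <= C2 - e.
Hypothesis b_range : forall x, cube x -> C1 + e <= b x <= C2 - e.
Local Notation P := (law e s bp bb).
Let B := `|C1| + `|C2|.
Local Notation A := (fun o : obs d => clamp B (oA o)).
Local Notation Y := (fun o : obs d => clamp B (oY o)).

Let hf := law_facts bp bb e_ge0 s_le1 p_range b_range up ub.
Let hE := law_EAY bp bb e_ge0 s_le1 p_range b_range.

Lemma bracket2_law n j : (J0 <= j)%N ->
  bracket2 w P A Y p b n j = ip p (O2 n j b) + s * e ^+ 2 * (n%:R^-1 * (res d j)%:R).
Proof.
move=> jJ; have bdj := bd j; rewrite /bracket2 (hE bdj).
rewrite ip_O2// (K_trace w S_ge1)//.
rewrite [ip p (fun x => b x * _)](_ : _ = ip p (fun x => kdiag j x * b x)); last first.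
  by apply: eq_Ex => x; rewrite [b x * _]mulrC.
ring.
Qed.

Lemma bracket3_law n j1 j2 : (J0 <= j1)%N -> (J0 <= j2)%N ->
  bracket3 w P A Y p b n j1 j2 = ip p (O3 n j1 j2 b) + s * e ^+ 2 *
    (n%:R^-1 * (1 - n%:R^-1) * (res d (minn j1 j2))%:R + n%:R^-1 ^+ 2 * cov_trace j1 j2).
Proof.
move=> j1J j2J; rewrite /bracket3 (hE (bd _)) (hE (bmM (bd j1) (bd j2))).
have mJ : (J0 <= minn j1 j2)%N by rewrite leq_min j1J.
rewrite ip_O3// (K_trace w S_ge1)//.
rewrite [ip p (fun x => b x * (kdiag (minn j1 j2) x))](_ : _ =
   ip p (fun x => kdiag (minn j1 j2) x * b x)); last first.
  by apply: eq_Ex => x; rewrite [b x * _]mulrC.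
rewrite [ip p (fun x => b x * (kdiag j1 x * kdiag j2 x))](_ : _ =
   ip p (fun x => (kdiag j1 x * kdiag j2 x) * b x)); last first.
  by apply: eq_Ex => x; rewrite [b x * _]mulrC.
rewrite [ip b _](_ : _ = ip p (vproj w j1 (fun y => kdiag j2 y * b y))); last first.
  rewrite -(proj_adj w S_ge1 j1 bp (bmM (bd j2) bb)).
  by apply: eq_Ex => x; ring.
rewrite /cov_trace; ring.
Qed.

Lemma law_bias_INT n j1 j2 : (0 < n)%N -> (J0 <= j1)%N -> (J0 <= j2)%N ->
  ('E_(iid P n)[fun s => (psi_INT w j1 j2 s - psi P)%R] =
   (ip p (opINT n j1 j2 b) + s * e ^+ 2 * (- (n%:R^-1 * (res d (minn j1 j2))%:R)))%:E)%E.
Proof.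
move=> n0 j1J j2J; rewrite (bias_INT w S_ge1 hf n0 j1J j2J) bracket2_law; last first.
  by rewrite leq_min j1J.
congr EFin; rewrite /opINT ipBr//; last by apply: (linop_O2 _ _).1.
ring.
Qed.

Lemma law_bias_MC n j1 j2 : (0 < n)%N -> (J0 <= j1)%N -> (J0 <= j2)%N ->
  ('E_(iid P n)[fun s => (psi_MC w j1 j2 s - psi P)%R] =
   (ip p (opMC n j1 j2 b) + s * e ^+ 2 *
    (- (n%:R^-1 * (1 - n%:R^-1) * (res d (minn j1 j2))%:R + n%:R^-1 ^+ 2 * cov_trace j1 j2)))%:E)%E.
Proof.
move=> n0 j1J j2J; rewrite (bias_MC w S_ge1 hf n0 j1J j2J) bracket3_law//.
congr EFin; rewrite /opMC ipBr//; last by apply: (linop_O3 _ _ _).1.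
ring.
Qed.

Lemma law_bias_IF n j1 j2 : (0 < n)%N -> (J0 <= j1)%N -> (J0 <= j2)%N ->
  ('E_(iid P n)[fun s => (psi_IF w j1 j2 s - psi P)%R] =
   (ip p (opIF n j1 j2 b) + s * e ^+ 2 *
    (- (n%:R^-1 * ((res d j1)%:R + (res d j2)%:R)) +
     (n%:R^-1 * (1 - n%:R^-1) * (res d (minn j1 j2))%:R + n%:R^-1 ^+ 2 * cov_trace j1 j2)))%:E)%E.
Proof.
move=> n0 j1J j2J; rewrite (bias_IF w S_ge1 hf n0 j1J j2J) !bracket2_law// bracket3_law//.
congr EFin.
have b1 := (linop_O2 n j1).1 _ bb; have b2 := (linop_O2 n j2).1 _ bb.
have b3 := (linop_O3 n j1 j2).1 _ bb.
have -> : ip p (opIF n j1 j2 b) =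
  ip p b - ip p (O2 n j1 b) - ip p (O2 n j2 b) + ip p (O3 n j1 j2 b).
  rewrite /ip -!ExB; [|by bmt..]; rewrite -ExD; [|by bmt..].
  by apply: eq_Ex => x; rewrite /opIF; ring.
ring.
Qed.

End law.
End bias_operators.

(** * Perturbations of the regression functions *)

Section perturbations.
Context {R : realType} {J0 S : nat} (w : cdv_basis R J0 S) {d : nat}.
Hypothesis S_ge1 : (1 <= S)%N.
Hypothesis d_gt0 : (0 < d)%N.
Implicit Types (h D : d.-tuple R -> R).
Local Notation weight l a := (2 `^ (l%:R * (a + d%:R / 2))).

(** A perturbation of size e in all the constraints of the model: the range and both parts
    of the Hoelder norm. *)
Definition pert (a e : R) D : Prop :=
  [/\ bm D, unif_cont_cube D, forall x, cube x -> `|D x| <= e,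
      forall m : Z d J0, weight J0 a * `|ip D (Phi w m)| <= e &
      forall l (m : Z d l) (iota : {ffun 'I_d -> bool}), (J0 <= l)%N -> (exists i, iota i) ->
        weight l a * `|ip D (Psi w iota m)| <= e].

Lemma holder_pert a M h e D s : holder_ball w a (M - 2 * e) h -> pert a e D -> `|s| <= 1 ->
  holder_ball w a M (fun x => patch_cube h x + s * D x).
Proof.
move=> [uh hM] [bD uD De DPhi DPsi] s1.
have bh := unif_cont_measurable uh.
split.
  apply: unif_contD.
    by apply: unif_cont_eq uh => x cx; rewrite patch_cubeE.
  by apply: unif_contM => //; exact: unif_cont_cst.
have coefD (E : d.-tuple R -> R) W : bm E -> 0 <= W -> W * `|ip D E| <= e ->
    W * `|coef (fun x => patch_cube h x + s * D x) E| <= W * `|coef h E| + e.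
  move=> bE W0 WD.
  rewrite (coef_eq (h := h) (h' := patch_cube h)); last by move=> x cx; rewrite patch_cubeE.
  rewrite !coef_ip//; last by bmt.
  have -> : ip (fun x => patch_cube h x + s * D x) E = ip (patch_cube h) E + s * ip D E.
    rewrite ipDl; [|by bmt..]; congr (_ + _).
    by rewrite /ip -ExZl; [apply: eq_Ex => x; rewrite mulrA|bmt].
  apply: (@le_trans _ _ (W * (`|ip (patch_cube h) E| + `|ip D E|))).
    rewrite ler_wpM2l//; apply: (le_trans (ler_normD _ _)); rewrite lerD2l normrM.
    by rewrite ler_piMl.
  by rewrite mulrDr lerD2l.
have W0 l : 0 <= weight l a by exact: powR_ge0.
move: hM; rewrite /holder_norm.
set F := \big[Num.max/0]_m `|coef h _|; set F' := \big[Num.max/0]_m `|coef _ _|.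
set G := ereal_sup _; set G' := ereal_sup _ => hM.
have FF : weight J0 a * F' <= weight J0 a * F + e.
  have e0 : 0 <= e.
    apply: le_trans (normr_ge0 _) (De [tuple 0 | i < d] _).
    by move=> i; rewrite tnth_mktuple lexx ler01.
  have F0 : 0 <= F by rewrite /F; elim/big_ind: _ => // x y x0 y0; rewrite le_max x0.
  rewrite /F'; elim/big_ind: _ => [|x y hx hy|m _].
  - by rewrite mulr0 addr_ge0// mulr_ge0.
  - by rewrite maxEle; case: ifP.
  - apply: (le_trans (coefD _ _ (bm_Phi w S_ge1 m) (W0 _) (DPhi m))).
    by rewrite lerD2r ler_wpM2l//; apply: le_bigmax.
have GG : (G' <= G + e%:E)%E.
  apply: ge_ereal_sup => _ [l [m [iota [lJ ii ->]]]].
  apply: (@le_trans _ _ ((weight l a * `|coef h (Psi w iota m)|)%:E + e%:E)%E).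
    by rewrite -EFinD lee_fin; apply: coefD; [exact: bm_Psi|exact: W0|exact: DPsi].
  by apply: leeD => //; apply: ereal_sup_ubound; exists l, m, iota.
apply: (le_trans (leeD (_ : _ <= (weight J0 a * F + e)%:E)%E GG)); first by rewrite lee_fin.
rewrite EFinD addeACA -EFinD.
apply: (le_trans (leeD hM (lexx _))); rewrite -EFinD lee_fin; lra.
Qed.

(** An interior point of the constraints, around which there is room both for D and for the
    noise of amplitude e of the two-point laws. *)
Lemma slack_point a M C1 C2 : has_slack w d a M C1 C2 ->
  exists h e0, [/\ 0 < e0, bm h & forall e D s, e <= e0 -> pert a e D -> `|s| <= 1 ->
    [/\ holder_ball w a M (fun x => h x + s * D x), bm (fun x => h x + s * D x) &
       forall x, cube x -> C1 + e <= h x + s * D x <= C2 - e]].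
Proof.
move=> [h [e0 [e0_gt0 hb hr]]].
have bh : bm (patch_cube h) by apply: unif_cont_measurable; exact: hb.1.
exists (patch_cube h), (e0 / 2); split => //; first by rewrite divr_gt0.
move=> e D s ee pD s1; have [bD uD De _ _] := pD.
split.
- apply: (holder_pert (e := e)) => //; case: hb => uh hM; split => //.
  by apply: (le_trans hM); rewrite lee_fin; lra.
- by bmt.
- move=> x cx; rewrite patch_cubeE//.
  have /andP[h1 h2] := hr x cx.
  have : `|s * D x| <= e.
    by rewrite normrM; apply: le_trans (De x cx); rewrite ler_piMl.
  by rewrite ler_norml => /andP[h3 h4]; apply/andP; split; lra.
Qed.

Lemma pert0 a e : 0 <= e -> pert a e (fun=> 0).
Proof.
move=> e0; split => [|| |m|l m iota _ _].
- exact: bm_cst.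
- exact: unif_cont_cst.
- by move=> x _; rewrite normr0.
- by rewrite /ip (eq_Ex (fun=> 0)) ?Ex_cst ?normr0 ?mulr0// => x; rewrite mul0r.
- by rewrite /ip (eq_Ex (fun=> 0)) ?Ex_cst ?normr0 ?mulr0// => x; rewrite mul0r.
Qed.

Lemma vproj_Psi0 j l (m : Z d l) (iota : {ffun 'I_d -> bool}) x : (J0 <= j)%N -> (j <= l)%N ->
  (exists i, iota i) -> vproj w j (Psi w iota m) x = 0.
Proof.
move=> jJ jl [i ii].
have bP := bm_Psi w S_ge1 iota m; have bPhi (m' : Z d j) := bm_Phi w S_ge1 m'.
rewrite /vproj (eq_Ex (fun u => \sum_(m' : Z d j) Phi w m' x * (Phi w m' u * Psi w iota m u))).
  rewrite Ex_sum; last by move=> m'; bmt.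
  apply: big1 => m' _; rewrite ExZl; last by bmt.
  rewrite (eq_Ex (fun u => Psi w [ffun=> false] m' u * Psi w iota m u)); last first.
    by move=> u; rewrite PhiE.
  move: jl; rewrite leq_eqVlt => /orP[/eqP jl|jl]; last first.
    by rewrite (orth_Psi_lower w S_ge1 _ _ _ jJ jl ii) mulr0.
  subst l; rewrite (orth_Psi w S_ge1)//.
  case: eqP => [e|_]; last by rewrite mulr0.
  by move: ii; rewrite -e ffunE.
by move=> u; rewrite /K mulr_suml; apply: eq_bigr => m' _; rewrite mulrA.
Qed.

Lemma vproj1 j x : (J0 <= j)%N -> cube x -> vproj w j (fun _ : d.-tuple R => 1) x = 1.
Proof.
move=> jJ cx; rewrite -[RHS](K_mass w S_ge1 jJ cx).
by apply: eq_Ex => u; rewrite mulr1.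
Qed.

(** Constants are in V_J0, to which the wavelets are orthogonal. *)
Lemma ip1_Psi l (m : Z d l) (iota : {ffun 'I_d -> bool}) : (J0 <= l)%N ->
  (exists i, iota i) -> ip (fun=> 1) (Psi w iota m) = 0.
Proof.
move=> lJ ii; have bP := bm_Psi w S_ge1 iota m; have b1 : bm (fun _ : d.-tuple R => 1 : R) by exact: bm_cst.
rewrite -(eq_ip_cube (f := vproj w J0 (fun _ : d.-tuple R => 1)) (g := Psi w iota m)) => //.
- rewrite (proj_adj w S_ge1)// /ip (eq_Ex (fun=> 0)) ?Ex_cst// => x.
  by rewrite vproj_Psi0// mulr0.
- exact: bm_proj.
- by move=> x cx; rewrite vproj1.
Qed.

Lemma cst_pert a e : 0 < e -> exists2 dl : R, 0 < dl & pert a e (fun=> dl).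
Proof.
move=> e0; have [c c1 hc] := @K_consts _ _ _ w S_ge1 d.
have [_ _ _ hPsi] := hc J0.
have c0 : 0 <= c by exact: le_trans c1.
pose T := weight J0 a * (c * Num.sqrt (res d J0)%:R).
have T0 : 0 <= T by rewrite !mulr_ge0 ?powR_ge0 ?sqrtr_ge0.
have T1 : 0 < 1 + T by rewrite ltr_pwDl.
have dl0 : 0 < e / (1 + T) by rewrite divr_gt0.
have dlT : e / (1 + T) * T <= e by rewrite -mulrA ler_piMr ?(ltW e0)// mulrC ler_pdivrMr// mul1r lerDr.
have cstE E : bm E -> ip (fun=> e / (1 + T)) E = e / (1 + T) * ip (fun=> 1) E.
  move=> bE; rewrite /ip -ExZl; last by bmt.
  by apply: eq_Ex => x; rewrite mul1r.
exists (e / (1 + T)) => //; split => [|| |m|l m iota lJ ii].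
- exact: bm_cst.
- exact: unif_cont_cst.
- by move=> x _; rewrite gtr0_norm// ler_pdivrMr// mulrDr mulr1 lerDl mulr_ge0// (ltW e0).
- rewrite cstE; last exact: bm_Phi.
  apply: le_trans dlT; rewrite normrM (gtr0_norm dl0) mulrCA ler_wpM2l ?(ltW dl0)// /T.
  rewrite ler_wpM2l ?powR_ge0//; apply: norm_Ex_le.
    by apply: bmM; [exact: bm_cst|exact: bm_Phi].
  move=> x; rewrite mul1r PhiE; apply: le_trans (hPsi [ffun=> false] x).
  by rewrite (bigD1 m)//= lerDl sumr_ge0.
- rewrite cstE; last exact: bm_Psi.
  by rewrite ip1_Psi// mulr0 normr0 mulr0 (ltW e0).
Qed.

(** All the wavelets of level J with a wavelet factor in every direction: a function with
    constant coefficients at a single level, hence extremal in Hoelder balls. *)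
Definition wave (J : nat) (x : d.-tuple R) : R := \sum_(m : Z d J) Psi w [ffun=> true] m x.

Let true_ex : exists i : 'I_d, [ffun=> true] i. Proof. by exists (Ordinal d_gt0); rewrite ffunE. Qed.

Lemma bm_wave J : bm (wave J).
Proof. by apply: bm_sum => m; exact: bm_Psi. Qed.

Lemma unif_cont_wave J : unif_cont_cube (wave J).
Proof.
apply: unif_cont_sum => m; apply: unif_cont_prod => i.
have [C [r [_ hphi hpsi]]] := gens_good w S_ge1.
apply: unif_cont_coord; rewrite ffunE; exact: (dilate_continuous hpsi (ltn_ord _)).
Qed.

Lemma ip_wave_Psi J l (m : Z d l) (iota : {ffun 'I_d -> bool}) : (J0 <= J)%N -> (J0 <= l)%N ->
  (exists i, iota i) \/ (l <= J)%N ->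
  ip (wave J) (Psi w iota m) = ((l == J) && (iota == [ffun=> true]))%:R.
Proof.
move=> JJ lJ hl.
have bP l' (m' : Z d l') i := bm_Psi w S_ge1 i m'.
rewrite /ip (eq_Ex (fun x => \sum_(m' : Z d J) Psi w [ffun=> true] m' x * Psi w iota m x)); last first.
  by move=> x; rewrite mulr_suml.
rewrite Ex_sum; last by move=> m'; bmt.
have [e|lt|gt] := ltngtP l J.
- rewrite big1// => m' _.
  rewrite (eq_Ex (fun x => Psi w iota m x * Psi w [ffun=> true] m' x)); last by move=> x; rewrite mulrC.
  by have [i ii] := true_ex; exact: (orth_Psi_lower w S_ge1 _ _ _ lJ e ii).
- rewrite big1// => m' _; case: hl => [[i ii]|]; last by rewrite leqNgt lt.
  exact: (orth_Psi_lower w S_ge1 _ _ _ JJ lt ii).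
- subst l; under eq_bigr do rewrite orth_Psi//.
  rewrite eq_sym; case: eqP => _ /=; last by rewrite big1.
  by rewrite (bigD1 m)//= eqxx big1 ?addr0// => m' /negPf ->.
Qed.

Lemma ip_wave J : (J0 <= J)%N -> ip (wave J) (wave J) = (res d J)%:R.
Proof.
move=> JJ; have bw := bm_wave J; have bP (m : Z d J) i := bm_Psi w S_ge1 i m.
rewrite {2}/wave /ip (eq_Ex (fun x => \sum_(m : Z d J) wave J x * Psi w [ffun=> true] m x)).
  rewrite Ex_sum; last by move=> m; bmt.
  rewrite (eq_bigr (fun=> 1)); last first.
    by move=> m _; rewrite -[LHS]/(ip _ _) ip_wave_Psi ?eqxx//; right.
  by rewrite sumr_const /Z card_ffun !card_ord /res expnM.
by move=> x; rewrite mulr_sumr.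
Qed.

Lemma vproj_wave j J x t : (J0 <= j)%N -> (j <= J)%N -> vproj w j (fun y => t * wave J y) x = 0.
Proof.
move=> jJ jJ'; have bP (m : Z d J) i := bm_Psi w S_ge1 i m; have bK := bm_K w S_ge1 j x.
rewrite /vproj (eq_Ex (fun u => t * \sum_(m : Z d J) (K w j x u * Psi w [ffun=> true] m u))).
  rewrite ExZl; last by bmt.
  rewrite Ex_sum; last by move=> m; bmt.
  rewrite big1 ?mulr0// => m _; exact: vproj_Psi0.
by move=> u; rewrite mulrCA -mulr_sumr.
Qed.

(** At any point, O(1) wavelets of size 2^(Jd/2) overlap: with coefficients
    2^(-J(a + d/2)) the sum is of size 2^(-Ja). *)
Lemma wave_pert a e t c J : 0 < a -> 0 <= t -> 1 <= c -> c * t <= e -> (J0 <= J)%N ->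
  (forall (iota : {ffun 'I_d -> bool}) x,
     \sum_(m : Z d J) `|Psi w iota m x| <= c * Num.sqrt (res d J)%:R) ->
  pert a e (fun x => t / weight J a * wave J x) /\
  forall x, `|t / weight J a * wave J x| <= c * t * (2 `^ (- a)) ^+ J.
Proof.
move=> a0 t0 c1 cte JJ hc.
have W0 : 0 < weight J a by exact: powR_gt0.
have c0 : 0 <= c by exact: le_trans c1.
have te : t <= e by apply: le_trans cte; rewrite ler_peMl.
have tW0 : 0 <= t / weight J a by rewrite divr_ge0// ltW.
have sup x : `|t / weight J a * wave J x| <= c * t * (2 `^ (- a)) ^+ J.
  rewrite normrM ger0_norm//.
  have hw : `|wave J x| <= c * Num.sqrt (res d J)%:R.
    by apply: le_trans (hc [ffun=> true] x); exact: ler_norm_sum.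
  apply: (le_trans (ler_wpM2l tW0 hw)).
  have -> : Num.sqrt (res d J)%:R = 2 `^ (J%:R * (d%:R / 2)) :> R.
    rewrite -powR12_sqrt ?ler0n//.
    by rewrite /res natrX -powR_mulrn// -powRrM natrM; congr (_ `^ _); field.
  rewrite -powR2_natmul mulrDr powRD ?pnatr_eq0 ?implybT// powRN le_eqVlt.
  by apply/orP; left; apply/eqP; field; rewrite !gt_eqF ?powR_gt0.
have bw := bm_wave J.
have ipE E : bm E -> ip (fun x => t / weight J a * wave J x) E = t / weight J a * ip (wave J) E.
  move=> bE; rewrite /ip -ExZl; last by bmt.
  by apply: eq_Ex => x; rewrite mulrA.
split => //; split => [|| x _|m|l m iota lJ ii].
- by bmt.
- by apply: unif_contM; [exact: unif_cont_cst|exact: unif_cont_wave].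
- apply: (le_trans (sup x)); apply: le_trans cte; rewrite ler_piMr ?mulr_ge0//.
  rewrite exprn_ile1 ?powR_ge0// powRN invf_le1 ?powR_gt0//.
  by rewrite -[leLHS](powRr0 2) ler_powR ?ler1n// ltW.
- rewrite ipE; last exact: bm_Phi.
  have -> : ip (wave J) (Phi w m) = ip (wave J) (Psi w [ffun=> false] m).
    by apply: eq_Ex => x; rewrite PhiE.
  rewrite ip_wave_Psi//; last by right.
  rewrite [[ffun=> false] == _](_ : _ = false) ?andbF ?mulr0 ?normr0 ?mulr0 ?(le_trans t0)//.
  by apply/eqP => /ffunP /(_ (Ordinal d_gt0)); rewrite !ffunE.
- rewrite ipE; last exact: bm_Psi.
  rewrite ip_wave_Psi//; last by left.
  case: eqP => [->|_] /=; last by rewrite mulr0 normr0 mulr0 (le_trans t0).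
  rewrite normrM (ger0_norm tW0) mulrA mulrCA divff ?gt_eqF// mulr1.
  by case: eqP => _; rewrite ?normr1 ?normr0 ?mulr1 ?mulr0// (le_trans t0).
Qed.

End perturbations.

(** * Lower bounds on the worst-case bias *)

Section lower_bounds.
Context {R : realType} {J0 S : nat} (w : cdv_basis R J0 S) {d : nat}.
Hypothesis S_ge1 : (1 <= S)%N.
Hypothesis d_gt0 : (0 < d)%N.
Variables (alpha beta M C1 C2 : R).
Hypotheses (alpha_gt0 : 0 < alpha) (beta_gt0 : 0 < beta).
Implicit Types (p b h g D : d.-tuple R -> R).
Local Notation cls := ([set P : probability (obs (R := R) d) R | model w alpha beta M C1 C2 P]).
Local Notation kdiag := (kdiag w).
Local Notation k j := ((res d j)%:R : R).
Local Notation q := (2 `^ (- (alpha + beta)) : R).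

(** Reduces lower bounds on an extended real supremum to reasoning with real upper bounds
    r on it.  A nonempty class excludes a supremum equal to -oo. *)
Lemma le_sup_bias (cl : set (probability (obs (R := R) d) R)) est n j1 j2 (v : R) :
  (exists P, cl P) ->
  (forall r : R, (forall P t, cl P ->
     'E_(iid P n)[fun s => (est n j1 j2 s - psi P)%R]%E = t%:E -> `|t| <= r) -> v <= r) ->
  (v%:E <= sup_bias cl est n j1 j2)%E.
Proof.
move=> [P0 P0c] hv.
have ub P t : cl P -> 'E_(iid P n)[fun s => (est n j1 j2 s - psi P)%R]%E = t%:E ->
   (`|t|%:E <= sup_bias cl est n j1 j2)%E.
  by move=> Pc Et; apply: ereal_sup_ubound; exists P => //; rewrite Et.
case E : (sup_bias cl est n j1 j2) => [r| |].
- by rewrite lee_fin; apply: hv => P t Pc Et; have := ub P t Pc Et; rewrite E lee_fin.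
- by rewrite leey.
- exfalso; have : (0 <= sup_bias cl est n j1 j2)%E.
    apply: (@le_trans _ _ `|'E_(iid P0 n)[fun s => (est n j1 j2 s - psi P0)%R]|%E); first exact: abse_ge0.
    by apply: ereal_sup_ubound; exists P0.
  by rewrite E.
Qed.

(** Regression functions and covariance enter the bias separately: this is all that the
    perturbation argument uses of an estimator. *)
Definition law_bias (est : estimator R d) n j1 j2 (Op : (d.-tuple R -> R) -> d.-tuple R -> R)
    (lam : R) := forall p b e s (bp : bm p) (bb : bm b),
  unif_cont_cube p -> unif_cont_cube b -> 0 <= e -> `|s| <= 1 ->
  (forall x, cube x -> C1 + e <= p x <= C2 - e) ->
  (forall x, cube x -> C1 + e <= b x <= C2 - e) ->
  ('E_(iid (law e s bp bb) n)[fun z => (est n j1 j2 z - psi (law e s bp bb))%R] =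
    (ip p (Op b) + s * e ^+ 2 * lam)%:E)%E.

(** The first bound uses the four laws with regression functions p +- D and b +- D', the
    second one the two laws with regression functions p and b and opposite
    covariances. *)
Lemma two_lower_bounds : has_slack w d alpha M C1 C2 -> has_slack w d beta M C1 C2 ->
  exists2 e : R, 0 < e & forall (est : estimator R d) n j1 j2 Op lam, linop Op ->
    law_bias est n j1 j2 Op lam ->
    (forall D D', pert w alpha e D -> pert w beta e D' ->
       (`|ip D (Op D')|%:E <= sup_bias cls est n j1 j2)%E) /\
    ((e ^+ 2 * `|lam|)%:E <= sup_bias cls est n j1 j2)%E.
Proof.
move=> /(slack_point S_ge1)[p [e1 [e10 bp hp]]] /(slack_point S_ge1)[b [e2 [e20 bb hb]]].
pose e := Num.min e1 e2.
have e0 : 0 < e by rewrite lt_min e10.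
have ee1 : e <= e1 by rewrite ge_min lexx.
have ee2 : e <= e2 by rewrite ge_min lexx orbT.
have sgb1 (x : bool) : `|sgb x : R| <= 1 by case: x; rewrite /sgb ?normrN normr1.
exists e => // est n j1 j2 Op lam lO hlaw.
have key D D' s t u : pert w alpha e D -> pert w beta e D' -> `|s| <= 1 -> `|t| <= 1 -> `|u| <= 1 ->
    exists P, cls P /\ ('E_(iid P n)[fun z => (est n j1 j2 z - psi P)%R] =
      (ip (fun x => p x + s * D x) (Op (fun x => b x + t * D' x)) + u * e ^+ 2 * lam)%:E)%E.
  move=> pD pD' s1 t1 u1.
  have [hp1 hp2 hp3] := hp e D s ee1 pD s1; have [hb1 hb2 hb3] := hb e D' t ee2 pD' t1.
  exists (law e u hp2 hb2); split.
    by apply: law_model => //; exact: ltW.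
  by apply: hlaw => //; [exact: hp1.1|exact: hb1.1|exact: ltW].
have n10 : `|0 : R| <= 1 by rewrite normr0.
have p0 a : pert w a e (fun _ : d.-tuple R => 0) by apply: pert0 => //; exact: ltW.
have ne : exists P, cls P by have [P [Pc _]] := key _ _ 0 0 0 (p0 _) (p0 _) n10 n10 n10; exists P.
split.
- move=> D D' pD pD'; have [bD _ _ _ _] := pD; have [bD' _ _ _ _] := pD'.
  apply: le_sup_bias => // r hr; apply: (mixed_difference lO bp bb bD bD') => s t.
  have [P [Pc EP]] := key D D' (sgb s) (sgb t) 0 pD pD' (sgb1 s) (sgb1 t) n10.
  by have := hr P _ Pc EP; rewrite !mul0r addr0.
- apply: le_sup_bias => // r hr.
  have [P [Pc EP]] := key _ _ 0 0 1 (p0 _) (p0 _) n10 n10 (sgb1 true).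
  have [Q [Qc EQ]] := key _ _ 0 0 (- 1) (p0 _) (p0 _) n10 n10 (sgb1 false).
  have := hr P _ Pc EP; have := hr Q _ Qc EQ.
  rewrite mul1r mulN1r mulNr; move: (ip _ _) => v.
  have -> : e ^+ 2 * `|lam| = `|e ^+ 2 * lam| by rewrite normrM ger0_norm// sqr_ge0.
  move: (e ^+ 2 * lam) => y; rewrite !ler_norml => /andP[a1 a2] /andP[a3 a4].
  by apply/andP; split; lra.
Qed.

Section wavelet_pair.
Variable c : R.
Hypothesis c_ge1 : 1 <= c.
Hypothesis Kc : forall j (x y : d.-tuple R), `|K w j x y| <= c * (res d j)%:R.
Hypothesis Kint : forall j (x : d.-tuple R), Ex (unif d) (fun y => `|K w j x y|) <= c.
Hypothesis Psic : forall j (iota : {ffun 'I_d -> bool}) x,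
  \sum_(m : Z d j) `|Psi w iota m x| <= c * Num.sqrt (res d j)%:R.

Let c0 : 0 <= c. Proof. exact: le_trans c_ge1. Qed.
Let bd j : bm (kdiag j : d.-tuple R -> R). Proof. exact: bm_Kdiag. Qed.
Let kdc j (x : d.-tuple R) : `|kdiag j x| <= c * k j. Proof. exact: Kc. Qed.

(** The inner product is t^2 2^(-J(alpha + beta + d)) times the number 2^(Jd) of
    wavelets, with t = e / c. *)
Lemma wave_pair e J : 0 < e -> (J0 <= J)%N -> exists D D' Sa Sb,
  [/\ [/\ pert w alpha e D, pert w beta e D' & ip D D' = (e / c) ^+ 2 * q ^+ J],
      [/\ 0 <= Sa, 0 <= Sb, forall x, `|D x| <= Sa & forall x, `|D' x| <= Sb],
      Sa * Sb = c ^+ 2 * ((e / c) ^+ 2 * q ^+ J) &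
      forall l, (J0 <= l)%N -> (l <= J)%N -> vproj w l D' = fun=> 0].
Proof.
move=> e0 JJ; have cgt0 : 0 < c by exact: lt_le_trans c_ge1.
have t0 : 0 <= e / c by rewrite divr_ge0// ltW.
have cte : c * (e / c) <= e by rewrite mulrCA divff ?mulr1// gt_eqF.
have [pD sD] := wave_pert S_ge1 d_gt0 alpha_gt0 t0 c_ge1 cte JJ (@Psic J).
have [pD' sD'] := wave_pert S_ge1 d_gt0 beta_gt0 t0 c_ge1 cte JJ (@Psic J).
eexists _, _, _, _; split; [split; [exact: pD|exact: pD'|]|split; [| |exact: sD|exact: sD']| |].
- have bw : bm (wave w J : d.-tuple R -> R) by exact: bm_wave.
  rewrite /ip (eq_Ex (fun x => e / c / 2 `^ (J%:R * (alpha + d%:R / 2)) *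
     (e / c / 2 `^ (J%:R * (beta + d%:R / 2))) * (wave w J x * wave w J x))); last first.
    by move=> x; ring.
  rewrite ExZl; last by bmt.
  rewrite -[Ex _ _]/(ip _ _) ip_wave// -powR2_natmul.
  have -> : k J = 2 `^ (J%:R * d%:R).
    by rewrite /res natrX -powR_mulrn// natrM.
  rewrite (_ : J%:R * d%:R = J%:R * (alpha + d%:R / 2) + J%:R * (beta + d%:R / 2) +
     - (J%:R * (alpha + beta))); last by field.
  rewrite powRD ?pnatr_eq0 ?implybT// powRD ?pnatr_eq0 ?implybT//.
  by field; rewrite !gt_eqF ?powR_gt0.
- by apply: mulr_ge0; [exact: mulr_ge0|apply: exprn_ge0; exact: powR_ge0].
- by apply: mulr_ge0; [exact: mulr_ge0|apply: exprn_ge0; exact: powR_ge0].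
- rewrite (_ : q = 2 `^ (- alpha) * 2 `^ (- beta)); last by rewrite opprD powRD ?pnatr_eq0 ?implybT.
  by rewrite [(_ * _) ^+ J]exprMn; ring.
- by move=> l lJ lJ'; apply/funext => x; exact: vproj_wave.
Qed.

Variables (n : nat) (D D' : d.-tuple R -> R) (Sa Sb : R).
Hypothesis n_gt0 : (0 < n)%N.
Hypotheses (bD : bm D) (bD' : bm D') (Sa0 : 0 <= Sa) (Sb0 : 0 <= Sb).
Hypotheses (DS : forall x, `|D x| <= Sa) (DS' : forall x, `|D' x| <= Sb).

Let u0 : 0 <= (n%:R^-1 : R). Proof. by rewrite invr_ge0. Qed.
Let u1 : (n%:R^-1 : R) <= 1. Proof. by rewrite invf_le1 ?ltr0n// ler1n. Qed.
Let ip0 : ip D (fun=> 0) = 0.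
Proof. by rewrite /ip (eq_Ex (fun=> 0)) ?Ex_cst// => x; rewrite mulr0. Qed.

Lemma ip_O2_small j : vproj w j D' = (fun=> 0) ->
  `|ip D (O2 w n j D')| <= c * (k j / n%:R) * (Sa * Sb).
Proof.
move=> v0; rewrite ip_O2// v0 ip0 mulr0 add0r normrM (ger0_norm u0).
have h : `|ip D (fun x => kdiag j x * D' x)| <= Sa * (c * k j * Sb).
  apply: ip_le => //; [by bmt|] => x _; rewrite normrM; exact: ler_pM.
by apply: (le_trans (ler_wpM2l u0 h)); rewrite le_eqVlt; apply/orP; left; apply/eqP; ring.
Qed.

(** Compared with [ip_O2_small], k_min <= n is used to absorb k_1 k_2 / n^2 into
    k_max / n. *)
Lemma ip_O3_small j1 j2 km kM : 0 <= km -> 1 <= kM -> km / n%:R <= 1 ->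
  k (minn j1 j2) <= kM -> k j1 <= kM -> k j2 <= kM -> k j1 * k j2 = km * kM ->
  vproj w (minn j1 j2) D' = (fun=> 0) ->
  `|ip D (O3 w n j1 j2 D')| <= 4 * c ^+ 2 * (kM / n%:R) * (Sa * Sb).
Proof.
move=> km0 kM1 kmn hm h1 h2 h12 v0; rewrite ip_O3// v0 ip0 mulr0 add0r.
have bv := bm_proj w S_ge1 j2 bD'.
have cc : c <= c ^+ 2 by rewrite expr2 ler_peMr.
have SS : 0 <= Sa * Sb by exact: mulr_ge0.
have kM0 : 0 <= kM by exact: le_trans kM1.
pose X := c ^+ 2 * kM * (Sa * Sb).
have f1 : `|ip D (fun x => kdiag (minn j1 j2) x * D' x)| <= X.
  apply: (le_trans (ip_le (B := Sa) (B' := c * k (minn j1 j2) * Sb) bD _ _ _)) => //.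
  - by bmt.
  - by move=> x _; rewrite normrM; exact: ler_pM.
  - rewrite /X mulrCA; apply: ler_wpM2r => //; apply: ler_pM => //.
have f2 : `|ip D (fun x => kdiag j1 x * vproj w j2 D' x)| <= X.
  apply: (le_trans (ip_le (B := Sa) (B' := c * k j1 * (c * Sb)) bD _ _ _)) => //.
  - by bmt.
  - move=> x _; rewrite normrM; apply: ler_pM => //.
    exact: (proj_le S_ge1 (Kint j2) bD' Sb0 DS').
  - rewrite /X (_ : Sa * (c * k j1 * (c * Sb)) = c ^+ 2 * k j1 * (Sa * Sb)); last by ring.
    by apply: ler_wpM2r => //; apply: ler_wpM2l => //; exact: sqr_ge0.
have f3 : `|ip D (vproj w j1 (fun y => kdiag j2 y * D' y))| <= X.
  have bk : bm (fun y => kdiag j2 y * D' y) by bmt.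
  apply: (le_trans (ip_le (B := Sa) (B' := c * (c * k j2 * Sb)) bD _ _ _)) => //.
  - exact: bm_proj.
  - move=> x _; apply: (proj_le S_ge1 (Kint j1) bk); first by rewrite !mulr_ge0.
    by move=> y; rewrite normrM; exact: ler_pM.
  - rewrite /X (_ : Sa * (c * (c * k j2 * Sb)) = c ^+ 2 * k j2 * (Sa * Sb)); last by ring.
    by apply: ler_wpM2r => //; apply: ler_wpM2l => //; exact: sqr_ge0.
have f4 : n%:R^-1 * `|ip D (fun x => kdiag j1 x * kdiag j2 x * D' x)| <= X.
  apply: (@le_trans _ _ (n%:R^-1 * (Sa * (c * k j1 * (c * k j2) * Sb)))).
    have b3 : bm (fun x => kdiag j1 x * kdiag j2 x * D' x) by bmt.
    apply: ler_wpM2l => //; apply: (ip_le bD b3) => // x _.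
    by rewrite !normrM; apply: ler_pM => //; exact: ler_pM.
  rewrite (_ : n%:R^-1 * (Sa * _) = c ^+ 2 * (n%:R^-1 * (k j1 * k j2)) * (Sa * Sb)); last by ring.
  rewrite h12 /X; apply: ler_wpM2r => //; apply: ler_wpM2l => //; first exact: sqr_ge0.
  by rewrite mulrA [n%:R^-1 * km]mulrC ler_piMl.
rewrite (_ : 4 * _ * _ * _ = n%:R^-1 * (3 * X + X)); last by rewrite /X; ring.
rewrite -mulrA expr2 -[n%:R^-1 * n%:R^-1 * _]mulrA -mulrDr normrM (ger0_norm u0).
apply: ler_wpM2l => //; apply: (le_trans (ler_normD _ _)); apply: lerD.
  rewrite normrM -[leRHS]mul1r; apply: ler_pM => //.
    by rewrite ger0_norm ?subr_ge0//; move: u0; lra.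
  apply: (le_trans (ler_normD _ _)); apply: (le_trans (lerD (ler_normD _ _) (lexx _))); lra.
by rewrite normrM (ger0_norm u0).
Qed.

End wavelet_pair.
End lower_bounds.

Section lower_bound_rates.
Context {R : realType} {J0 S : nat} (w : cdv_basis R J0 S) {d : nat}.
Hypothesis S_ge1 : (1 <= S)%N.
Hypothesis d_gt0 : (0 < d)%N.
Variables (alpha beta M C1 C2 : R).
Hypotheses (alpha_gt0 : 0 < alpha) (beta_gt0 : 0 < beta).
Hypothesis slack_p : has_slack w d alpha M C1 C2.
Hypothesis slack_b : has_slack w d beta M C1 C2.
Implicit Types (p b h g D : d.-tuple R -> R).
Local Notation cls := ([set P : probability (obs (R := R) d) R | model w alpha beta M C1 C2 P]).
Local Notation kdiag := (kdiag w).
Local Notation k j := ((res d j)%:R : R).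
Local Notation q := (2 `^ (- (alpha + beta)) : R).
Local Notation kmin j1 j2 := (Num.min (k j1) (k j2)).
Local Notation kmax j1 j2 := (Num.max (k j1) (k j2)).

Let bd j : bm (kdiag j : d.-tuple R -> R). Proof. exact: bm_Kdiag. Qed.

Lemma cov_trace_ge0 j1 j2 : 0 <= cov_trace w (d := d) j1 j2.
Proof.
by apply: Ex_ge0 => x; apply: mulr_ge0; apply: sumr_ge0 => m _; rewrite -expr2 sqr_ge0.
Qed.

Lemma cov_trace_le c j1 j2 : 0 <= c ->
  (forall j (x y : d.-tuple R), `|K w j x y| <= c * (res d j)%:R) ->
  cov_trace w (d := d) j1 j2 <= c ^+ 2 * (k j1 * k j2).
Proof.
move=> c0 Kc; apply: Ex_le_cst; first exact: bmM.
move=> x; apply: (le_trans (ler_norm _)).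
rewrite normrM (_ : c ^+ 2 * _ = (c * k j1) * (c * k j2)); last by ring.
by apply: ler_pM => //; exact: Kc.
Qed.

Lemma vproj_cst (t : R) j (x : d.-tuple R) : (J0 <= j)%N -> cube x -> vproj w j (fun=> t) x = t.
Proof.
move=> jJ cx; have bK := bm_K w S_ge1 j x.
by rewrite /vproj ExZr// K_mass// mul1r.
Qed.

Lemma ip_cst_kdiag (s t : R) j : (J0 <= j)%N ->
  ip (fun=> s) (fun x : d.-tuple R => kdiag j x * t) = s * t * k j.
Proof.
move=> jJ; rewrite -(K_trace w S_ge1 jJ) -ExZl; last exact: bd.
by apply: eq_Ex => x; rewrite [kdiag j x * t]mulrC mulrA.
Qed.

(** On constants the projections act trivially, and the bias is explicit. *)
Lemma ip_opMC_cst n (s t : R) j1 j2 : (J0 <= j1)%N -> (J0 <= j2)%N ->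
  ip (fun=> s) (opMC w n j1 j2 (fun _ : d.-tuple R => t)) = s * t *
    (1 - ((1 - n%:R^-1) * (1 - 2 * n%:R^-1) +
          n%:R^-1 * (1 - n%:R^-1) * (kmin j1 j2 + (k j1 + k j2)) +
          n%:R^-1 ^+ 2 * cov_trace w (d := d) j1 j2)).
Proof.
move=> j1J j2J; have mJ : (J0 <= minn j1 j2)%N by rewrite leq_min j1J.
have bs : bm (fun _ : d.-tuple R => s) by exact: bm_cst.
have bt : bm (fun _ : d.-tuple R => t) by exact: bm_cst.
have bkt j : bm (fun x : d.-tuple R => kdiag j x * t) by bmt.
have bv j (h : d.-tuple R -> R) : bm h -> bm (vproj w j h) by exact: bm_proj.
rewrite /opMC ipBr//; last by apply: (linop_O3 _ S_ge1 _ _ _).1.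
rewrite ip_O3//.
have -> : ip (fun _ : d.-tuple R => s) (fun=> t) = s * t by rewrite /ip Ex_cst.
rewrite (eq_ip_cube (f' := fun=> s) (g := vproj w (minn j1 j2) (fun=> t)) (g' := fun=> t)) //;
  [|exact: bv|by move=> x cx; exact: vproj_cst].
rewrite ip_cst_kdiag//.
rewrite (eq_ip_cube (f' := fun=> s) (g := fun x => kdiag j1 x * vproj w j2 (fun=> t) x)
  (g' := fun x => kdiag j1 x * t)) //;
  [|by apply: bmM => //; exact: bv|by move=> x cx; rewrite vproj_cst].
rewrite ip_cst_kdiag//.
rewrite -(proj_adj w S_ge1)//.
rewrite (eq_ip_cube (f := vproj w j1 (fun=> s)) (f' := fun=> s)
  (g' := fun x => kdiag j2 x * t)) //; [|exact: bv|by move=> x cx; exact: vproj_cst].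
rewrite ip_cst_kdiag//.
have -> : ip (fun=> s) (fun x : d.-tuple R => kdiag j1 x * kdiag j2 x * t) =
    s * t * cov_trace w (d := d) j1 j2.
  rewrite /cov_trace -ExZl; last exact: bmM.
  by apply: eq_Ex => x; move: (kdiag j1 x) (kdiag j2 x) => y z; ring.
rewrite /ip Ex_cst res_min; ring.
Qed.

Lemma sup_bias_max est n j1 j2 (x y : R) :
  (x%:E <= sup_bias cls est n j1 j2)%E -> (y%:E <= sup_bias cls est n j1 j2)%E ->
  ((Num.max x y)%:E <= sup_bias cls est n j1 j2)%E.
Proof. by move=> hx hy; rewrite /Num.max; case: ifP. Qed.

Let law_INT n j1 j2 : (0 < n)%N -> (J0 <= j1)%N -> (J0 <= j2)%N ->
  law_bias C1 C2 (@psi_INT R J0 S w d) n j1 j2 (opINT w n j1 j2) (- (n%:R^-1 * k (minn j1 j2))).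
Proof.
by move=> n0 j1J j2J p b e s bp bb up ub e0 s1 rp rb; exact: (law_bias_INT w S_ge1 bp bb up ub e0 s1 rp rb).
Qed.

Let law_MC n j1 j2 : (0 < n)%N -> (J0 <= j1)%N -> (J0 <= j2)%N ->
  law_bias C1 C2 (@psi_MC R J0 S w d) n j1 j2 (opMC w n j1 j2)
    (- (n%:R^-1 * (1 - n%:R^-1) * (res d (minn j1 j2))%:R +
        n%:R^-1 ^+ 2 * cov_trace w (d := d) j1 j2)).
Proof.
by move=> n0 j1J j2J p b e s bp bb up ub e0 s1 rp rb; exact: (law_bias_MC w S_ge1 bp bb up ub e0 s1 rp rb).
Qed.

Let law_IF n j1 j2 : (0 < n)%N -> (J0 <= j1)%N -> (J0 <= j2)%N ->
  law_bias C1 C2 (@psi_IF R J0 S w d) n j1 j2 (opIF w n j1 j2)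
    (- (n%:R^-1 * (k j1 + k j2)) +
     (n%:R^-1 * (1 - n%:R^-1) * k (minn j1 j2) + n%:R^-1 ^+ 2 * cov_trace w (d := d) j1 j2)).
Proof.
by move=> n0 j1J j2J p b e s bp bb up ub e0 s1 rp rb; exact: (law_bias_IF w S_ge1 bp bb up ub e0 s1 rp rb).
Qed.

Let q_ge0 J : 0 <= q ^+ J. Proof. by rewrite exprn_ge0 ?powR_ge0. Qed.
Let q_le1 J : q ^+ J <= 1.
Proof.
rewrite exprn_ile1 ?powR_ge0// powRN invf_le1 ?powR_gt0//.
by rewrite -[leLHS](powRr0 2) ler_powR ?ler1n// addr_ge0// ltW.
Qed.

Let mc_bias_cst (u m mm I : R) : 0 <= u -> u <= 2^-1 -> 2 <= m -> 0 <= mm -> 0 <= u ^+ 2 * I ->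
  2^-1 * (u * mm) <=
  (1 - u) * (1 - 2 * u) + u * (1 - u) * (m + (m + mm)) + u ^+ 2 * I - 1.
Proof.
move=> u0 u12 m2 mm0 uI.
have h3 : 0 <= u * (1 - u) by rewrite mulr_ge0//; lra.
have h4 := ler_wpM2l h3 m2.
have h5 : 0 <= u * (2^-1 - u) by rewrite mulr_ge0//; lra.
have h6 : 0 <= u * (2^-1 - u) * mm by exact: mulr_ge0.
rewrite (_ : (1 - u) * (1 - 2 * u) = 1 - 3 * u + 2 * u ^+ 2); last by ring.
rewrite (_ : u * (1 - u) * (m + (m + mm)) =
  2 * (u * (1 - u) * m) + (u * (2^-1 - u) * mm + 2^-1 * (u * mm))); last by field.
have h7 : u * (1 - u) * 2 = 2 * u - 2 * u ^+ 2 by ring.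
have h8 : u * (2^-1 - u) = 2^-1 * u - u ^+ 2 by ring.
rewrite h7 in h4; rewrite h8 in h5 h6 *.
lra.
Qed.

Let half_signal (c G x L Q : R) : 0 <= G -> c * x <= 2^-1 -> `|L| <= c * x * G ->
  Q = G - L -> G / 2 <= `|Q|.
Proof.
move=> G0 cx hL ->; apply: le_trans (ler_norm _).
have := ler_wpM2r G0 cx; have := ler_norm L; lra.
Qed.

(** If k_min / n is small, the wavelets of the lower level give the approximation term up
    to a factor 1/2.  Otherwise k_min / n is bounded below and dominates it up to a
    constant. *)
Lemma lower_INT : exists2 c0 : R, 0 < c0 & forall n j1 j2, (0 < n)%N ->
  (J0 <= j1)%N -> (J0 <= j2)%N ->
  ((c0 * Num.max (q ^+ minn j1 j2) (kmin j1 j2 / n%:R))%:E <=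
   sup_bias cls (@psi_INT R J0 S w d) n j1 j2)%E.
Proof.
have [e e0 he] := two_lower_bounds S_ge1 slack_p slack_b.
have [c c1 hc] := @K_consts _ _ _ w S_ge1 d; have cgt0 : 0 < c by exact: lt_le_trans c1.
have Kc j := let: And4 h _ _ _ := hc j in h; have Psic j := let: And4 _ _ _ h := hc j in h.
pose r : R := (2 * c ^+ 3)^-1.
have r0 : 0 < r by rewrite invr_gt0 mulr_gt0// exprn_gt0.
pose t2 := (e / c) ^+ 2.
have t20 : 0 < t2 by rewrite exprn_gt0// divr_gt0.
have e20 : 0 < e ^+ 2 by rewrite exprn_gt0.
exists (Num.min (t2 / 2) (Num.min (e ^+ 2 * r) (e ^+ 2))).
  by rewrite !lt_min e20 (divr_gt0 t20)//= mulr_gt0.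
move=> n j1 j2 n0 j1J j2J; set c0 := Num.min _ _.
have ct : c0 <= t2 / 2 by rewrite ge_min lexx.
have cer : c0 <= e ^+ 2 * r by rewrite !ge_min lexx orbT.
have ce : c0 <= e ^+ 2 by rewrite !ge_min lexx !orbT.
have mJ : (J0 <= minn j1 j2)%N by rewrite leq_min j1J.
have [h1 h2] := he _ _ _ _ _ _ (linop_INT w S_ge1 n j1 j2) (law_INT n0 j1J j2J).
have [D [D' [Sa [Sb [[pD pD' DD] [Sa0 Sb0 DS DS'] SS v0]]]]] :=
  wave_pair S_ge1 d_gt0 alpha_gt0 beta_gt0 c1 Psic e0 mJ.
have [bD _ _ _ _] := pD; have [bD' _ _ _ _] := pD'.
have := sup_bias_max (h1 _ _ pD pD') h2; apply: le_trans; rewrite lee_fin.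
rewrite -res_min; set x := k _ / n%:R; set J := minn j1 j2.
have x0 : 0 <= x by rewrite divr_ge0.
have L2 : `|- (n%:R^-1 * k J)| = x by rewrite normrN ger0_norm ?mulr_ge0 ?invr_ge0// mulrC.
rewrite L2.
have opE : ip D (opINT w n j1 j2 D') = t2 * q ^+ J - ip D (O2 w n J D').
  by rewrite /opINT ipBr ?DD//; exact: (linop_O2 w S_ge1 _ _).1.
have hO := ip_O2_small S_ge1 Kc n bD bD' DS DS' (v0 _ mJ (leqnn _)).
rewrite SS -/x -/J -/t2 in hO.
have c00 : 0 <= c0 by apply: ltW; rewrite !lt_min e20 (divr_gt0 t20)//= mulr_gt0.
rewrite le_max.
have [big|small] := leP (q ^+ J) x.
  by apply/orP; right; rewrite ler_wpM2r.
have [xr|rx] := leP x r.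
  apply/orP; left.
  apply: (@le_trans _ _ (t2 * q ^+ J / 2)).
    by rewrite mulrAC ler_wpM2r.
  apply: (half_signal (c := c ^+ 3) (x := x) _ _ _ opE).
  - by rewrite mulr_ge0 ?ltW// q_ge0.
  - have := ler_wpM2l (ltW (exprn_gt0 3 cgt0)) xr; rewrite /r => /le_trans; apply.
    by rewrite le_eqVlt; apply/orP; left; apply/eqP; field; rewrite gt_eqF.
  - by apply: (le_trans hO); rewrite le_eqVlt; apply/orP; left; apply/eqP; ring.
apply/orP; right; apply: (@le_trans _ _ (e ^+ 2 * r)).
  by rewrite -[leRHS]mulr1; apply: ler_pM => //; exact: q_le1.
by rewrite ler_wpM2l ?ltW.
Qed.

(** On constant perturbations the bias is the product of the constants with
    -(2 k_min + k_max)/n + 3/n, up to terms of second order, where 3/n is the proportion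
    of triples of indices that are not distinct; as k_min >= 2, the former wins. *)
Lemma lower_MC : exists c0 r : R, [/\ 0 < c0, 0 < r & forall n j1 j2, (2 <= n)%N ->
  (J0 <= j1)%N -> (J0 <= j2)%N -> kmax j1 j2 / n%:R <= r ->
  ((c0 * Num.max (q ^+ minn j1 j2) (kmax j1 j2 / n%:R))%:E <=
   sup_bias cls (@psi_MC R J0 S w d) n j1 j2)%E].
Proof.
have [e e0 he] := two_lower_bounds S_ge1 slack_p slack_b.
have [c c1 hc] := @K_consts _ _ _ w S_ge1 d; have cgt0 : 0 < c by exact: lt_le_trans c1.
have Kc j := let: And4 h _ _ _ := hc j in h; have Psic j := let: And4 _ _ _ h := hc j in h.
have Kint j := let: And4 _ h _ _ := hc j in h.
have [s s0 ps] := @cst_pert _ _ _ w d S_ge1 alpha _ e0.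
have [t t0 pt] := @cst_pert _ _ _ w d S_ge1 beta _ e0.
pose r : R := (8 * c ^+ 4)^-1.
have r0 : 0 < r by rewrite invr_gt0 mulr_gt0// exprn_gt0.
have r1 : r <= 1.
  rewrite invf_le1 ?mulr_gt0 ?exprn_gt0//; have := exprn_ege1 4 c1; lra.
pose t2 := (e / c) ^+ 2.
have t20 : 0 < t2 by rewrite exprn_gt0// divr_gt0.
exists (Num.min (t2 / 2) (s * t / 2)), r; split => //.
  by rewrite !lt_min !divr_gt0// mulr_gt0.
move=> n j1 j2 n2 j1J j2J xr; set c0 := Num.min _ _.
have n0 : (0 < n)%N by exact: ltnW.
have ct : c0 <= t2 / 2 by rewrite ge_min lexx.
have cst' : c0 <= s * t / 2 by rewrite !ge_min lexx orbT.
have mJ : (J0 <= minn j1 j2)%N by rewrite leq_min j1J.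
have [h1 _] := he _ _ _ _ _ _ (linop_MC w S_ge1 n j1 j2) (law_MC n0 j1J j2J).
have [D [D' [Sa [Sb [[pD pD' DD] [Sa0 Sb0 DS DS'] SS v0]]]]] :=
  wave_pair S_ge1 d_gt0 alpha_gt0 beta_gt0 c1 Psic e0 mJ.
have [bD _ _ _ _] := pD; have [bD' _ _ _ _] := pD'.
have := sup_bias_max (h1 _ _ pD pD') (h1 _ _ ps pt); apply: le_trans; rewrite lee_fin.
rewrite ip_opMC_cst// (add_min_max (k j1) (k j2)).
have := mul_min_max (k j1) (k j2).
have hM1 : k j1 <= kmax j1 j2 by rewrite le_max lexx.
have hM2 : k j2 <= kmax j1 j2 by rewrite le_max lexx orbT.
have km2 : 2 <= kmin j1 j2.
  rewrite -res_min /res natrX -{1}(expr1 2) ler_eXn2l ?ltr1n//.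
  by rewrite muln_gt0 d_gt0 andbT (leq_trans (J0_gt0 w S_ge1)).
have mM : kmin j1 j2 <= kmax j1 j2 by rewrite ge_min hM1.
have km := @res_min R d j1 j2.
move: (kmin _ _) (kmax _ _) xr hM1 hM2 km2 mM km => m mm xr hM1 hM2 km2 mM km h12.
set x := mm / n%:R in xr *; set J := minn j1 j2.
have n1 : 0 <= (n%:R^-1 : R) by rewrite invr_ge0.
have n12 : (n%:R^-1 : R) <= 2^-1 by rewrite lef_pV2 ?posrE ?ltr0n// ler_nat.
have xE : x = n%:R^-1 * mm by rewrite /x mulrC.
have m0 : 0 <= m by apply: le_trans km2; rewrite ler0n.
have x0 : 0 <= x by rewrite xE mulr_ge0// (le_trans m0).
have opE : ip D (opMC w n j1 j2 D') = t2 * q ^+ J - ip D (O3 w n j1 j2 D').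
  by rewrite /opMC ipBr ?DD//; exact: (linop_O3 w S_ge1 _ _ _).1.
have mm1 : 1 <= mm by apply: le_trans mM; apply: le_trans km2; rewrite ler1n.
have mn1 : m / n%:R <= 1.
  by apply: le_trans r1; apply: le_trans xr; rewrite /x ler_wpM2r.
have mM' : k (minn j1 j2) <= mm by rewrite km.
have hO := ip_O3_small S_ge1 c1 Kc Kint n0 bD bD' Sa0 Sb0 DS DS' m0 mm1 mn1 mM' hM1 hM2 h12
  (v0 _ mJ (leqnn _)).
rewrite SS -/x -/J -/t2 in hO.
rewrite le_max.
have [big|small] := leP (q ^+ J) x.
  apply/orP; right; rewrite normrM gtr0_norm ?mulr_gt0//.
  apply: (@le_trans _ _ (s * t / 2 * x)); first by rewrite ler_wpM2r.
  rewrite -mulrA ler_wpM2l ?mulr_ge0 ?(ltW s0) ?(ltW t0)// -normrN opprB.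
  apply: le_trans (ler_norm _).
  have := cov_trace_ge0 j1 j2; move: (cov_trace _ _ _) => I I0.
  have uI : 0 <= n%:R^-1 ^+ 2 * I by rewrite mulr_ge0 ?sqr_ge0.
  have mm0 : 0 <= mm by exact: le_trans mm1.
  by rewrite xE; exact: mc_bias_cst.
apply/orP; left.
apply: (@le_trans _ _ (t2 * q ^+ J / 2)).
  by rewrite mulrAC ler_wpM2r.
apply: (half_signal (c := 4 * c ^+ 4) (x := x) _ _ _ opE).
- by rewrite mulr_ge0 ?ltW// q_ge0.
- have c4 : 0 < 4 * c ^+ 4 by rewrite mulr_gt0// exprn_gt0.
  have := ler_wpM2l (ltW c4) xr; rewrite /r => /le_trans; apply.
  by rewrite le_eqVlt; apply/orP; left; apply/eqP; field; rewrite gt_eqF.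
- by apply: (le_trans hO); rewrite le_eqVlt; apply/orP; left; apply/eqP; ring.
Qed.

(** The covariance terms of the two U2 and of U3 add up to -(k_1 + k_2 - k_min)/n =
    -k_max/n, up to terms of second order, which are small when k_max / n is. *)
Lemma lower_IF : exists c0 r : R, [/\ 0 < c0, 0 < r & forall n j1 j2, (2 <= n)%N ->
  (J0 <= j1)%N -> (J0 <= j2)%N -> kmax j1 j2 / n%:R <= r ->
  ((c0 * Num.max (q ^+ maxn j1 j2) (kmax j1 j2 / n%:R))%:E <=
   sup_bias cls (@psi_IF R J0 S w d) n j1 j2)%E].
Proof.
have [e e0 he] := two_lower_bounds S_ge1 slack_p slack_b.
have [c c1 hc] := @K_consts _ _ _ w S_ge1 d; have cgt0 : 0 < c by exact: lt_le_trans c1.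
have Kc j := let: And4 h _ _ _ := hc j in h; have Psic j := let: And4 _ _ _ h := hc j in h.
have Kint j := let: And4 _ h _ _ := hc j in h.
pose r : R := (12 * c ^+ 4)^-1.
have c41 := exprn_ege1 4 c1.
have r0 : 0 < r by rewrite invr_gt0 mulr_gt0// exprn_gt0.
have r1 : r <= 1.
  by rewrite invf_le1 ?mulr_gt0 ?exprn_gt0//; lra.
have c24 : c ^+ 2 <= c ^+ 4 by rewrite ler_weXn2l.
have c34 : c ^+ 3 <= c ^+ 4 by rewrite ler_weXn2l.
have rE : c ^+ 4 * r = 12^-1 by rewrite /r; field; rewrite gt_eqF.
pose t2 := (e / c) ^+ 2.
have t20 : 0 < t2 by rewrite exprn_gt0// divr_gt0.
have e20 : 0 < e ^+ 2 by rewrite exprn_gt0.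
exists (Num.min (t2 / 2) (e ^+ 2 / 2)), r; split => //.
  by rewrite !lt_min !divr_gt0.
move=> n j1 j2 n2 j1J j2J xr; set c0 := Num.min _ _.
have n0 : (0 < n)%N by exact: ltnW.
have ct : c0 <= t2 / 2 by rewrite ge_min lexx.
have ce : c0 <= e ^+ 2 / 2 by rewrite !ge_min lexx orbT.
have mJ : (J0 <= minn j1 j2)%N by rewrite leq_min j1J.
have MJ : (J0 <= maxn j1 j2)%N by rewrite leq_max j1J.
have [h1 h2] := he _ _ _ _ _ _ (linop_IF w S_ge1 n j1 j2) (law_IF n0 j1J j2J).
have [D [D' [Sa [Sb [[pD pD' DD] [Sa0 Sb0 DS DS'] SS v0]]]]] :=
  wave_pair S_ge1 d_gt0 alpha_gt0 beta_gt0 c1 Psic e0 MJ.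
have [bD _ _ _ _] := pD; have [bD' _ _ _ _] := pD'.
have := sup_bias_max (h1 _ _ pD pD') h2; apply: le_trans; rewrite lee_fin.
have Ile := cov_trace_le j1 j2 (ltW cgt0) Kc.
rewrite (add_min_max (k j1) (k j2)).
have := mul_min_max (k j1) (k j2).
have hM1 : k j1 <= kmax j1 j2 by rewrite le_max lexx.
have hM2 : k j2 <= kmax j1 j2 by rewrite le_max lexx orbT.
have km1 : 1 <= kmin j1 j2 by rewrite -res_min ler1n /res expn_gt0.
have mM : kmin j1 j2 <= kmax j1 j2 by rewrite ge_min hM1.
have km := @res_min R d j1 j2; rewrite km.
move: (kmin _ _) (kmax _ _) xr hM1 hM2 km1 mM km => m mm xr hM1 hM2 km1 mM km h12.
rewrite h12 in Ile.
set x := mm / n%:R in xr *; set J := maxn j1 j2.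
have n1 : 0 <= (n%:R^-1 : R) by rewrite invr_ge0.
have xE : x = n%:R^-1 * mm by rewrite /x mulrC.
have m0 : 0 <= m by exact: le_trans km1.
have x0 : 0 <= x by rewrite xE mulr_ge0// (le_trans m0).
have b2 j := (linop_O2 w S_ge1 n j).1 _ bD'.
have b3 := (linop_O3 w S_ge1 n j1 j2).1 _ bD'.
have opE : ip D (opIF w n j1 j2 D') = t2 * q ^+ J -
    (ip D (O2 w n j1 D') + ip D (O2 w n j2 D') - ip D (O3 w n j1 j2 D')).
  rewrite -DD /ip -ExD; [|by bmt..]; rewrite -!ExB; [|by bmt..].
  by apply: eq_Ex => y; rewrite /opIF; ring.
have mm1 : 1 <= mm by exact: le_trans mM.
have mxr : m / n%:R <= r by apply: le_trans xr; rewrite /x ler_wpM2r.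
have mn1 : m / n%:R <= 1 by exact: le_trans r1.
have mM' : k (minn j1 j2) <= mm by rewrite km.
have minmax : (minn j1 j2 <= maxn j1 j2)%N by rewrite geq_min leq_maxl.
have hO3 := ip_O3_small S_ge1 c1 Kc Kint n0 bD bD' Sa0 Sb0 DS DS' m0 mm1 mn1 mM' hM1 hM2 h12
  (v0 _ mJ minmax).
have hO1 := ip_O2_small S_ge1 Kc n bD bD' DS DS' (v0 _ j1J (leq_maxl _ _)).
have hO2 := ip_O2_small S_ge1 Kc n bD bD' DS DS' (v0 _ j2J (leq_maxr _ _)).
rewrite SS -/J -/t2 in hO1 hO2 hO3; rewrite -/x in hO3.
have kx y : y <= mm -> y / n%:R <= x by move=> hy; rewrite ler_wpM2r.
have {}kx := (kx _ hM1, kx _ hM2).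
have G0 : 0 <= t2 * q ^+ J by rewrite mulr_ge0 ?ltW// q_ge0.
have xG0 : 0 <= x * (t2 * q ^+ J) by exact: mulr_ge0.
rewrite le_max.
have [big|small] := leP (q ^+ J) x.
  apply/orP; right.
  apply: (@le_trans _ _ (e ^+ 2 / 2 * x)); first by rewrite ler_wpM2r.
  rewrite -mulrA ler_wpM2l ?(ltW e20)// -normrN; apply: le_trans (ler_norm _).
  move: Ile; move: (cov_trace _ _ _) => I Ile.
  have uI : n%:R^-1 ^+ 2 * I <= 12^-1 * x.
    apply: (le_trans (ler_wpM2l (sqr_ge0 _) Ile)).
    rewrite (_ : _ * _ = (c ^+ 2 * (m / n%:R)) * x); last by rewrite xE; ring.
    rewrite ler_wpM2r// -rE; apply: ler_pM => //; rewrite ?sqr_ge0//.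
    by rewrite divr_ge0.
  have h3 : 0 <= n%:R^-1 ^+ 2 * m by rewrite mulr_ge0 ?sqr_ge0.
  rewrite (_ : - _ = x - n%:R^-1 ^+ 2 * I + n%:R^-1 ^+ 2 * m); last by rewrite xE; ring.
  move: uI h3 x0; lra.
apply/orP; left.
apply: (@le_trans _ _ (t2 * q ^+ J / 2)).
  by rewrite mulrAC ler_wpM2r.
apply: (half_signal (c := 6 * c ^+ 4) (x := x) _ _ _ opE) => //.
- have c4 : 0 <= c ^+ 4 by exact: le_trans c41.
  by have := ler_wpM2l c4 xr; rewrite rE; lra.
- apply: (le_trans (ler_normB _ _)).
  have g j : k j / n%:R <= x -> c * (k j / n%:R) * (c ^+ 2 * (t2 * q ^+ J)) <=
      c ^+ 3 * (x * (t2 * q ^+ J)).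
    move=> kjx; rewrite (_ : c * (k j / n%:R) * (c ^+ 2 * (t2 * q ^+ J)) = (k j / n%:R) * (c ^+ 3 * (t2 * q ^+ J))); last by ring.
    rewrite (_ : c ^+ 3 * (x * (t2 * q ^+ J)) = x * (c ^+ 3 * (t2 * q ^+ J))); last by ring.
    by rewrite ler_wpM2r// mulr_ge0// exprn_ge0// ltW.
  apply: (le_trans (lerD (le_trans (ler_normD _ _)
    (lerD (le_trans hO1 (g _ kx.1)) (le_trans hO2 (g _ kx.2)))) hO3)).
  have g3 : c ^+ 3 * (x * (t2 * q ^+ J)) <= c ^+ 4 * (x * (t2 * q ^+ J)) by rewrite ler_wpM2r.
  rewrite (_ : 4 * _ * _ * _ = 4 * (c ^+ 4 * (x * (t2 * q ^+ J)))); last by ring.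
  rewrite (_ : 6 * _ * _ * _ = 6 * (c ^+ 4 * (x * (t2 * q ^+ J)))); last by ring.
  lra.
Qed.

End lower_bound_rates.

(** * The theorem *)

Section rates.
Context {R : realType}.

(** The bounds are proved with levels, and stated with resolutions k = 2^(Jd). *)
Lemma res_powR (d J : nat) (a : R) : (0 < d)%N ->
  (res d J)%:R `^ (- (a / d%:R)) = (2 `^ (- a)) ^+ J :> R.
Proof.
move=> d0; rewrite -powR2_natmul /res natrX -powR_mulrn// -powRrM natrM; congr (_ `^ _).
by field; rewrite pnatr_eq0 -lt0n.
Qed.

Lemma lee_inv_scale (c x : R) (y : \bar R) : 0 < c -> ((c * x)%:E <= y)%E ->
  (x%:E <= c^-1%:E * y)%E.
Proof.
move=> c0 h; rewrite -[x](mulKf (lt0r_neq0 c0)) EFinM.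
by apply: lee_wpmul2l => //; rewrite lee_fin invr_ge0 ltW.
Qed.

Lemma small_levels_near (d J0 : nat) (j1 j2 : nat -> nat) (r : R) : 0 < r ->
  small_levels (R := R) d J0 j1 j2 ->
  \forall n \near \oo, Num.max (res d (j1 n))%:R (res d (j2 n))%:R / n%:R <= r.
Proof.
move=> r0 [_ h1 h2]; near=> n; rewrite /Num.max; case: ifP => _; near: n.
- exact: (cvgr_le _ h2).
- exact: (cvgr_le _ h1).
Unshelve. all: by end_near.
Qed.

End rates.

Unset Implicit Arguments.

Theorem theorem4 (R : realType) (d J0 S : nat) (w : cdv_basis R J0 S)
    (alpha beta M C1 C2 : R)
    (d_gt0 : (0 < d)%N) (S_ge1 : (1 <= S)%N) (J0_large : (S <= 2 ^ J0)%N)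
    (alpha_gt0 : 0 < alpha) (beta_gt0 : 0 < beta) (M_gt0 : 0 < M)
    (S_large : Num.max alpha beta < S%:R)
    (slack_p : has_slack w d alpha M C1 C2)
    (slack_b : has_slack w d beta M C1 C2) :
  let P := [set P : probability (obs d) R | model w alpha beta M C1 C2 P] in
  let k j : R := (res d j)%:R in
  let kmin j1 j2 : R := Num.min (k j1) (k j2) in
  let kmax j1 j2 : R := Num.max (k j1) (k j2) in
  let any := any_levels J0 in
  let small := small_levels (R := R) d J0 in
  let gamma := - ((alpha + beta) / d%:R) in
  let mc_if_var n j1 j2 : \bar R :=
    (n%:R^-1 + kmax j1 j2 / n%:R ^+ 2 + kmax j1 j2 ^+ 2 / n%:R ^+ 3 +
     kmin j1 j2 * kmax j1 j2 ^+ 2 / n%:R ^+ 4 +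
     kmin j1 j2 ^+ 2 * kmax j1 j2 ^+ 2 / n%:R ^+ 5)%:E in
  [/\ asymp_equiv any (sup_bias P (@psi_INT R J0 S w d))
        (fun n j1 j2 =>
          (Num.max (kmin j1 j2 `^ gamma) (kmin j1 j2 / n%:R))%:E) /\
      lesssim any (sup_var P (@psi_INT R J0 S w d))
        (fun n j1 j2 =>
          (n%:R^-1 + kmin j1 j2 / n%:R ^+ 2 + kmin j1 j2 ^+ 2 / n%:R ^+ 3)%:E),
      asymp_equiv small (sup_bias P (@psi_MC R J0 S w d))
        (fun n j1 j2 =>
          (Num.max (kmin j1 j2 `^ gamma) (kmax j1 j2 / n%:R))%:E) /\
      lesssim any (sup_var P (@psi_MC R J0 S w d)) mc_if_var &
      asymp_equiv small (sup_bias P (@psi_IF R J0 S w d))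
        (fun n j1 j2 =>
          (Num.max (kmax j1 j2 `^ gamma) (kmax j1 j2 / n%:R))%:E) /\
      lesssim any (sup_var P (@psi_IF R J0 S w d)) mc_if_var].
Proof.
move=> P k kmin kmax any small gamma mc_if_var.
have gmin j1 j2 : kmin j1 j2 `^ gamma = 2 `^ (- (alpha + beta)) ^+ minn j1 j2.
  by rewrite /kmin /k -res_min res_powR.
have gmax j1 j2 : kmax j1 j2 `^ gamma = 2 `^ (- (alpha + beta)) ^+ maxn j1 j2.
  by rewrite /kmax /k -res_max res_powR.
have [Cb Cb0 hb] := upper_bias w (d := d) S_ge1 C1 C2 alpha_gt0 beta_gt0 M_gt0.
have [Cv Cv0 hv] := upper_var w (d := d) S_ge1 alpha beta M C1 C2.
have [ci ci0 hi] := lower_INT S_ge1 d_gt0 alpha_gt0 beta_gt0 slack_p slack_b.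
have [cm [rm [cm0 rm0 hm]]] := lower_MC S_ge1 d_gt0 alpha_gt0 beta_gt0 slack_p slack_b.
have [cf [rf [cf0 rf0 hf]]] := lower_IF S_ge1 d_gt0 alpha_gt0 beta_gt0 slack_p slack_b.
have n0 : \forall n \near \oo, (0 < n)%N by exact: nbhs_infty_gt.
have n2 : \forall n \near \oo, (2 <= n)%N by exact: nbhs_infty_ge.
split; split; [split| |split| |split|].
- exists Cb => // j1 j2 lev; near=> n; have [l1 l2] := lev n; rewrite gmin -EFinM.
  have n_gt0 : (0 < n)%N by near: n.
  exact: (hb n _ _ n_gt0 l1 l2).1.
- exists ci^-1; first by rewrite invr_gt0.
  move=> j1 j2 lev; near=> n; have [l1 l2] := lev n; rewrite gmin.
  have n_gt0 : (0 < n)%N by near: n.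
  exact: lee_inv_scale (hi n _ _ n_gt0 l1 l2).
- exists Cv => // j1 j2 lev; near=> n; have [l1 l2] := lev n; rewrite -EFinM.
  have n_gt0 : (0 < n)%N by near: n.
  by have [] := hv n _ _ n_gt0 l1 l2.
- exists Cb => // j1 j2 lev; have nr := small_levels_near ltr01 lev; case: (lev) => lev' _ _.
  near=> n; have [l1 l2] := lev' n; rewrite gmin -EFinM.
  have n_gt0 : (0 < n)%N by near: n.
  have nr1 : kmax (j1 n) (j2 n) / n%:R <= 1 by near: n.
  exact: ((hb n _ _ n_gt0 l1 l2).2 nr1).1.
- exists cm^-1; first by rewrite invr_gt0.
  move=> j1 j2 lev; have nr := small_levels_near rm0 lev; case: (lev) => lev' _ _.
  near=> n; have [l1 l2] := lev' n; rewrite gmin.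
  have n_ge2 : (2 <= n)%N by near: n.
  have nr1 : kmax (j1 n) (j2 n) / n%:R <= rm by near: n.
  exact: lee_inv_scale (hm n _ _ n_ge2 l1 l2 nr1).
- exists Cv => // j1 j2 lev; near=> n; have [l1 l2] := lev n; rewrite -EFinM.
  have n_gt0 : (0 < n)%N by near: n.
  by have [] := hv n _ _ n_gt0 l1 l2.
- exists Cb => // j1 j2 lev; have nr := small_levels_near ltr01 lev; case: (lev) => lev' _ _.
  near=> n; have [l1 l2] := lev' n; rewrite gmax -EFinM.
  have n_gt0 : (0 < n)%N by near: n.
  have nr1 : kmax (j1 n) (j2 n) / n%:R <= 1 by near: n.
  exact: ((hb n _ _ n_gt0 l1 l2).2 nr1).2.
- exists cf^-1; first by rewrite invr_gt0.
  move=> j1 j2 lev; have nr := small_levels_near rf0 lev; case: (lev) => lev' _ _.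
  near=> n; have [l1 l2] := lev' n; rewrite gmax.
  have n_ge2 : (2 <= n)%N by near: n.
  have nr1 : kmax (j1 n) (j2 n) / n%:R <= rf by near: n.
  exact: lee_inv_scale (hf n _ _ n_ge2 l1 l2 nr1).
- exists Cv => // j1 j2 lev; near=> n; have [l1 l2] := lev n; rewrite -EFinM.
  have n_gt0 : (0 < n)%N by near: n.
  by have [] := hv n _ _ n_gt0 l1 l2.
Unshelve. all: by end_near.
Qed.
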